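(* Every finitely generated generalized $J$-group is reflection isomorphic to a reduced $J$-group.
   Context: For $p\geqslant 1$ and a tuple $K=(k_1,\dots,k_p)$ with entries in $\mathbb{N}_{\geqslant 2}\cup\{\infty\}$, let $J(K)=\langle s_1,\dots,s_p\mid s_1s_2\cdots s_p=s_2\cdots s_ps_1=\cdots=s_ps_1\cdots s_{p-1},\ s_i^{k_i}=1 \text{ for all } i \text{ with } k_i<\infty\rangle$. If $K'=(k'_1,\dots,k'_p)$ are positive integers with $k'_i\mid k_i$ (every positive integer divides $\infty$), then the generalized $J$-group $J\binom{K}{K'}$ is the normal closure of $\{s_1^{k'_1},\dots,s_p^{k'_p}\}$ in $J(K)$. Its reflections are the conjugates in $J(K)$ of the powers of the $s_i^{k'_i}$ that are different from $1$. A generalized $J$-group $J\binom{K}{K'}$ is called reduced if $K'$ contains at most two entries distinct from $1$ and the entries of $K'$ are pairwise coprime. Two generalized $J$-groups are reflection isomorphic if there is a group isomorphism between them mapping the set of reflections of one bijectively onto the set of reflections of the other. *)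

(* Defs.v *)
From HB Require Import structures.
From mathcomp Require Import all_boot.
From mathcomp Require Import boolp classical_sets functions cardinality.

Set Implicit Arguments.
Unset Strict Implicit.
Unset Printing Implicit Defensive.

Local Open Scope classical_set_scope.
Local Open Scope group_scope.

(* Groups given by a presentation < X | R >. A word is a sequence of letters,
   where (x, false) stands for x and (x, true) for x^-1; R u v means that
   u = v is one of the defining relations. *)

Definition word (X : Type) := seq (X * bool).

Definition word_inv (X : Type) (u : word X) : word X :=
  rev [seq (l.1, ~~ l.2) | l <- u].

Inductive pres_eq (X : Type) (R : word X -> word X -> Prop) :
    word X -> word X -> Prop :=
| pres_refl u : pres_eq R u u
| pres_sym u v : pres_eq R u v -> pres_eq R v u
| pres_trans u v w : pres_eq R u v -> pres_eq R v w -> pres_eq R u w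
| pres_rel u v : R u v -> pres_eq R u v
| pres_cancel x b : pres_eq R [:: (x, b); (x, ~~ b)] [::]
| pres_cat u u' v v' :
    pres_eq R u u' -> pres_eq R v v' -> pres_eq R (u ++ v) (u' ++ v').

Section Presentation.
Local Open Scope quotient_scope.
Variables (X : choiceType) (R : word X -> word X -> Prop).
Implicit Types u v w : word X.

Definition pres_eqb u v : bool := `[< pres_eq R u v >].

Lemma pres_eqb_refl : reflexive pres_eqb.
Proof. by move=> u; apply/asboolP/pres_refl. Qed.

Lemma pres_eqb_sym : symmetric pres_eqb.
Proof. by move=> u v; apply/asboolP/asboolP => /pres_sym. Qed.

Lemma pres_eqb_trans : transitive pres_eqb.
Proof.
by move=> v u w /asboolP uv /asboolP vw; apply/asboolP/(pres_trans uv vw).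
Qed.

Canonical pres_equiv_rel :=
  EquivRel pres_eqb pres_eqb_refl pres_eqb_sym pres_eqb_trans.

Definition presented : Type := {eq_quot pres_equiv_rel}.

HB.instance Definition _ := Choice.on presented.
HB.instance Definition _ := EqQuotient.on presented.

Lemma pi_presentedP u v : \pi_presented u = \pi_presented v <-> pres_eq R u v.
Proof.
split=> [/(@eqquotP _ pres_eqb presented u v)/asboolP//|uv].
by apply/(@eqquotP _ pres_eqb presented u v)/asboolP.
Qed.

Definition presented_one : presented := \pi_presented [::].
Definition presented_mul (a b : presented) : presented :=
  \pi_presented (repr a ++ repr b).
Definition presented_inv (a : presented) : presented :=
  \pi_presented (word_inv (repr a)).
Definition presented_gen (x : X) : presented := \pi_presented [:: (x, false)].

Lemma pres_eq_repr u : pres_eq R (repr (\pi_presented u)) u.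
Proof. by apply/pi_presentedP; rewrite reprK. Qed.

Lemma presented_mulE u v :
  presented_mul (\pi_presented u) (\pi_presented v) = \pi_presented (u ++ v).
Proof. by apply/pi_presentedP/pres_cat; exact: pres_eq_repr. Qed.

Lemma word_inv_cons (l : X * bool) u :
  word_inv (l :: u) = word_inv u ++ [:: (l.1, ~~ l.2)].
Proof. by rewrite /word_inv /= rev_cons -cats1. Qed.

Lemma word_invK : involutive (@word_inv X).
Proof.
move=> u; rewrite /word_inv map_rev revK -map_comp map_id_in // => -[x b] _ /=.
by rewrite negbK.
Qed.

Lemma pres_eq_invr u : pres_eq R (u ++ word_inv u) [::].
Proof.
elim: u => [|[x b] u IHu]; first exact: pres_refl.
rewrite word_inv_cons -cat1s -catA [u ++ _]catA.
apply: pres_trans (pres_cancel R x b).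
apply: (@pres_cat _ R [:: (x, b)] [:: (x, b)] _ [:: (x, ~~ b)]).
  exact: pres_refl.
exact: (pres_cat IHu (pres_refl R _)).
Qed.

Lemma pres_eq_invl u : pres_eq R (word_inv u ++ u) [::].
Proof. by have := pres_eq_invr (word_inv u); rewrite word_invK. Qed.

Lemma presented_mulA : associative presented_mul.
Proof.
move=> a b c; rewrite -[a]reprK -[b]reprK -[c]reprK.
move: (repr a) (repr b) (repr c) => u v w.
by rewrite (presented_mulE v w) (presented_mulE u v) !presented_mulE catA.
Qed.

Lemma presented_mul1g : left_id presented_one presented_mul.
Proof. by move=> a; rewrite -[a]reprK presented_mulE. Qed.

Lemma presented_mulg1 : right_id presented_one presented_mul.
Proof. by move=> a; rewrite -[a]reprK presented_mulE cats0. Qed.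

Lemma presented_mulVg : left_inverse presented_one presented_inv presented_mul.
Proof.
move=> a; rewrite -[a in presented_mul _ a]reprK presented_mulE.
exact/pi_presentedP/pres_eq_invl.
Qed.

Lemma presented_mulgV : right_inverse presented_one presented_inv presented_mul.
Proof.
move=> a; rewrite -[a in presented_mul a _]reprK presented_mulE.
exact/pi_presentedP/pres_eq_invr.
Qed.

HB.instance Definition _ := isGroup.Build presented
  presented_mulA presented_mul1g presented_mulg1 presented_mulVg presented_mulgV.

Lemma pi_word_prod (I : Type) (r : seq I) (h : I -> X) :
  \prod_(i <- r) presented_gen (h i) = \pi_presented [seq (h i, false) | i <- r].
Proof.
elim: r => [|i r IHr]; first by rewrite big_nil.
by rewrite big_cons IHr; exact: presented_mulE.
Qed.

Section UniversalProperty.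
Variables (G : groupType) (f : X -> G).

Definition word_eval (u : word X) : G :=
  \prod_(l <- u) (if l.2 then (f l.1)^-1 else f l.1).

Hypothesis fR : forall u v, R u v -> word_eval u = word_eval v.

Lemma pres_eq_eval u v : pres_eq R u v -> word_eval u = word_eval v.
Proof.
elim=> // [u1 u2 u3 _ -> _ ->//|x b|u1 u2 v1 v2 _ eu _ ev].
  by rewrite /word_eval !big_cons big_nil mulg1; case: b;
    rewrite /= ?mulVg ?mulgV.
by rewrite /word_eval !big_cat; congr (_ * _).
Qed.

Lemma presented_universal : exists phi : {multiplicative presented -> G},
  (forall x, phi (presented_gen x) = f x) /\
  forall psi : {multiplicative presented -> G},
    (forall x, psi (presented_gen x) = f x) -> psi =1 phi.
Proof.
pose phi (a : presented) := word_eval (repr a).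
have phiE u : phi (\pi_presented u) = word_eval u.
  exact/pres_eq_eval/pres_eq_repr.
have phiM : {morph phi : a b / a * b}.
  move=> a b; rewrite -[a]reprK -[b]reprK.
  by rewrite [_ * _]presented_mulE !phiE /word_eval big_cat.
pose mphi := isMultiplicative.Build presented G phi phiM.
pose Phi : {multiplicative presented -> G} := HB.pack phi mphi.
exists Phi; split=> [x|psi psif].
  by rewrite [LHS]phiE /word_eval big_cons big_nil mulg1.
have psi1 : psi 1 = 1 by apply: (mulgI (psi 1)); rewrite -gmulfM !mulg1.
move=> a; rewrite -[a]reprK [RHS]phiE.
elim: (repr a) => [|[x b] u IHu]; first by rewrite psi1 /word_eval big_nil.
rewrite -cat1s -presented_mulE [LHS]gmulfM IHu.
rewrite /word_eval big_cons; congr (_ * _); case: b => /=; last exact: psif.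
apply: (mulgI (f x)); rewrite mulgV -[f x]psif -gmulfM -psi1; congr (psi _).
by rewrite [LHS]presented_mulE; apply/pi_presentedP/(pres_cancel R x false).
Qed.

End UniversalProperty.
End Presentation.

Section Subgroups.
Variable G : groupType.
Implicit Types A H : set G.

Definition is_subgroup H :=
  H 1 /\ forall x y, H x -> H y -> H (x / y).

Definition is_normal_subgroup H :=
  is_subgroup H /\ forall x g, H x -> H (x ^ g).

Definition generated_subgroup A : set G := smallest is_subgroup A.

Definition normal_closure A : set G := smallest is_normal_subgroup A.

Definition finitely_generated : Prop :=
  exists2 A : set G, finite_set A & generated_subgroup A = [set: G].

Definition powers (x : G) : set G :=
  [set y | exists n : nat, y = x ^+ n \/ y = x ^- n].

Lemma normal_closure_group_closed A :
  group_closed [pred x | x \in normal_closure A].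
Proof.
split=> [|x y]; rewrite !inE.
  by move=> H [[[H1 _] _] _].
move=> Ax Ay H HA; have [[[_ HF] _] _] := HA.
exact: HF (Ax _ HA) (Ay _ HA).
Qed.

End Subgroups.

(* None encodes the entry oo. *)
Definition ge2_or_infty (k : option nat) : bool :=
  if k is Some m then 2 <= m else true.

Definition dvdn_infty (d : nat) (k : option nat) : bool :=
  if k is Some m then d %| m else true.

Section JGroups.
Variables (p : nat) (K : p.-tuple (option nat)).

(* rotation 0 is s_1 ... s_p and rotation i is s_{i+1} ... s_p s_1 ... s_i *)
Definition J_rotation (i : nat) : word 'I_p :=
  [seq (j, false) | j <- rot i (enum 'I_p)].

Definition J_rel (u v : word 'I_p) : Prop :=
  (exists i j : 'I_p, u = J_rotation i /\ v = J_rotation j) \/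
  (exists (i : 'I_p) (k : nat),
     [/\ tnth K i = Some k, u = nseq k (i, false) & v = [::]]).

Definition J : groupType := presented J_rel.

Definition J_gen (i : 'I_p) : J := presented_gen J_rel i.

Lemma J_gen_rotation (i j : 'I_p) :
  \prod_(l <- rot i (enum 'I_p)) J_gen l =
  \prod_(l <- rot j (enum 'I_p)) J_gen l.
Proof.
rewrite !(pi_word_prod J_rel _ id).
by apply/pi_presentedP/pres_rel; left; exists i, j.
Qed.

Lemma J_gen_order (i : 'I_p) (k : nat) : tnth K i = Some k -> J_gen i ^+ k = 1.
Proof.
move=> Ki; have -> : J_gen i ^+ k = \prod_(l <- nseq k i) J_gen l.
  by elim: k {Ki} => [|k IHk]; rewrite ?big_nil // expgS IHk big_cons.
rewrite (pi_word_prod J_rel _ id) map_nseq.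
by apply/pi_presentedP/pres_rel; right; exists i, k.
Qed.

Variable K' : p.-tuple nat.

Definition genJ_set : set J :=
  normal_closure [set J_gen i ^+ tnth K' i | i in [set: 'I_p]].

Definition genJ : Type := {x : J | x \in genJ_set}.

HB.instance Definition _ := SubChoice.on genJ.
HB.instance Definition _ := SubChoice_isSubGroup.Build J _ genJ
  (normal_closure_group_closed _).

Definition genJ_reflections : set genJ :=
  [set t | t <> 1 /\ exists (i : 'I_p) (g y : J),
     powers (J_gen i ^+ tnth K' i) y /\ val t = y ^ g].

Definition genJ_params : bool :=
  [&& 0 < p, all ge2_or_infty K, all (fun k' => 0 < k') K' &
      [forall i, dvdn_infty (tnth K' i) (tnth K i)]].

Definition reduced_params : bool :=
  (count (fun k' => k' != 1%N) K' <= 2) && pairwise coprime K'.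

End JGroups.

Arguments genJ_set {p} K K'.
Arguments genJ_reflections {p} K K'.

Definition reflection_isomorphic (p q : nat)
    (K : p.-tuple (option nat)) (K' : p.-tuple nat)
    (L : q.-tuple (option nat)) (L' : q.-tuple nat) : Prop :=
  exists f : {multiplicative genJ K K' -> genJ L L'},
    bijective f /\
    f @` genJ_reflections K K' = genJ_reflections L L'.

(* Main.v *)
(** The central element z = s_1 ... s_p makes J(K) a central extension of the
    orbifold group P(K) = < s_i | s_i^k_i, s_1 ... s_p > of a sphere, and
    J(K;K') is the kernel of J(K) -> J(K').  Coverings of the sphere branched
    over the cone points therefore produce reflection isomorphisms between
    generalized J-groups: if a degree n covering of the sphere by the sphere is
    branched over the points of K', and L lists the resulting cone points, the
    loops around them embed J(L) into J(K), with product z^n.  Injectivity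
    is seen on a monomial action of J(K), induced from J(L) with an n-th
    root of its central element adjoined.
    The cyclic covering of degree d branched over two points divides two
    entries of K' by a common divisor d and repeats all others d times.  It
    settles the case of at most two nontrivial entries and, together with one
    covering with five sheets for (2,3,5), all spherical triples.
    In the remaining cases P(K') is infinite, by a Riemann-Hurwitz count of
    cocycles.  If k_i <> k'_i for some i, then pushing mass to infinity along a
    ray of the Cayley graph of P(K') gives an action of J(K) on P(K') x Z/m in
    which J(K;K') acts by finitely supported translations that together
    move every point of P(K'), so J(K;K') is not finitely generated; and if
    K = K' it is trivial. *)
Require Import Defs.
From HB Require Import structures.
From mathcomp Require Import all_boot all_order all_algebra all_field.
From mathcomp Require Import boolp classical_sets functions cardinality.
From mathcomp Require Import zify ring.

Set Implicit Arguments.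
Unset Strict Implicit.
Unset Printing Implicit Defensive.

Local Open Scope classical_set_scope.
Local Open Scope group_scope.

(** * Group-theoretic preliminaries and frames *)

(** The spherical chain follows the finite rotation groups. The triple (2,3,5) belongs to A_5, which
    is perfect, so no cyclic covering can start its reduction; the five sheets are the cosets of
    A_4, the group of (2,3,3). The adjoined root is forced by the form of the action: an element of
    J(L) is to act on the base sheet by right multiplication, while z acts on all sheets by one
    scalar, whose n-th power must be the central element of J(L). J(L) itself need not contain such
    a root. Injectivity alone is not enough. The reflections of J(K;K') are conjugates under all of
    J(K), whereas those of J(L;L') are conjugates under J(L) only, so each covering also needs a
    proof that the lifted classes are permuted by J(K). Central factors do not matter there, since
    they act trivially by conjugation. The Riemann-Hurwitz count uses that s_i has order exactly
    k'_i in P(K'). This fails for some pairs, but three entries above 1 leave enough freedom to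
    realize the orders in PGL_2 over the complex numbers. *)

Notation ghom := UMagmaMorphism.type.

(* Complete for identities that hold in free groups. *)
Ltac gsimp := rewrite ?conjgE ?invgM ?invgK -?mulgA
  ?(mulKg, mulVKg, mulgV, mulVg, mulg1, mul1g, invg1, invgK).

Record sym (T : Type) := Sym {
  sym_fun :> T -> T;
  sym_inv : T -> T;
  symK : cancel sym_fun sym_inv;
  symVK : cancel sym_inv sym_fun }.

Section SymmetricGroup.
Variable T : Type.
Implicit Types f g : sym T.

Lemma symP f g : f =1 g -> f = g.
Proof.
case: f g => [f f' fK f'K] [g g' gK g'K] /= /funext fg; subst g.
have e : f' = g' by apply: funext => x; rewrite -{2}[x]f'K gK.
by subst g'; rewrite (Prop_irrelevance fK gK) (Prop_irrelevance f'K g'K).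
Qed.

Definition sym1 : sym T := @Sym T id id (fun _ => erefl) (fun _ => erefl).
Definition symV f : sym T := Sym (@symVK T f) (@symK T f).
(* Composition in diagrammatic order, so that words act from left to right. *)
Definition symM f g : sym T :=
  Sym (can_comp (@symK T g) (@symK T f)) (can_comp (@symVK T f) (@symVK T g)).

HB.instance Definition _ := gen_eqMixin (sym T).
HB.instance Definition _ := gen_choiceMixin (sym T).

Lemma symMA : associative symM. Proof. by move=> f g h; apply: symP. Qed.
Lemma sym1M : left_id sym1 symM. Proof. by move=> f; apply: symP. Qed.
Lemma symM1 : right_id sym1 symM. Proof. by move=> f; apply: symP. Qed.
Lemma symVM : left_inverse sym1 symV symM.
Proof. by move=> f; apply: symP => x /=; rewrite symVK. Qed.
Lemma symMV : right_inverse sym1 symV symM.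
Proof. by move=> f; apply: symP => x /=; rewrite symK. Qed.

HB.instance Definition _ :=
  isGroup.Build (sym T) symMA sym1M symM1 symVM symMV.

Lemma symME f g x : (f * g) x = g (f x). Proof. by []. Qed.
(** [f ^+ n] commutes with [f ^+ j], so it is trivial as soon as it fixes one point on each orbit of
    [f]. *)
Lemma sym_exp_eq1 f n :
  (forall x, exists j, (f ^+ n) ((f ^+ j) x) = (f ^+ j) x) -> f ^+ n = 1.
Proof.
move=> H; apply: symP => x; have [j Hj] := H x.
apply: (can_inj (@symK T (f ^+ j))).
by rewrite -Hj -!symME -!expgnDr addnC.
Qed.

End SymmetricGroup.

Section GroupLemmas.
Variable G : groupType.
Implicit Types x y z : G.

Lemma subgroupP (S : set G) : is_subgroup S ->
  [/\ S 1, forall x, S x -> S x^-1 & forall x y, S x -> S y -> S (x * y)].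
Proof.
move=> [S1 SF]; have SV x : S x -> S x^-1 by move=> Sx; rewrite -div1g; apply: SF.
by split=> // x y Sx Sy; rewrite -[y]invgK; apply/SF/SV.
Qed.

Lemma is_subgroupM (S : set G) : S 1 -> (forall x, S x -> S x^-1) ->
  (forall x y, S x -> S y -> S (x * y)) -> is_subgroup S.
Proof. by move=> S1 SV SM; split=> // x y Sx Sy; apply/SM/SV. Qed.

Lemma commuteVl x y : commute x y -> commute x^-1 y.
Proof. by move=> /commute_sym/commuteV/commute_sym. Qed.

(** A prefix A commutes with the whole product A B, and cancelling A in A (A B) = (A B) A gives A B
    = B A. This lets [frame] replace the equality of all rotations by commutation with the
    product. *)
Lemma prodg_rot (s : seq G) n : {in s, forall x, commute x (\prod_(y <- s) y)} ->
  \prod_(y <- rot n s) y = \prod_(y <- s) y.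
Proof.
move=> H; rewrite /rot big_cat /=.
have : commute (\prod_(y <- take n s) y) (\prod_(y <- s) y).
  apply: commute_sym; rewrite [X in commute _ X]big_seq; apply: commute_prod => x.
  by move=> /mem_take/H/commute_sym.
have -> : \prod_(y <- s) y = \prod_(y <- take n s) y * \prod_(y <- drop n s) y.
  by rewrite -big_cat cat_take_drop.
set A := \prod_(_ <- take _ _) _; set B := \prod_(_ <- drop _ _) _ => AB.
by apply: (mulgI A); rewrite AB mulgA.
Qed.

End GroupLemmas.

Lemma presented_ind (X : choiceType) (R : word X -> word X -> Prop)
    (P : presented R -> Prop) :
  P 1 -> (forall x g, P g -> P (presented_gen R x * g)) ->
  (forall x g, P g -> P ((presented_gen R x)^-1 * g)) -> forall g, P g.
Proof.
move=> P1 Pg PV g; rewrite -[g]reprK; elim: (repr g) => [//|[x b] u IHu].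
rewrite -cat1s -presented_mulE; case: b; last exact: Pg.
suff -> : \pi_(presented R)%qT [:: (x, true)] = (presented_gen R x)^-1 by exact: PV.
apply: (mulgI (presented_gen R x)); rewrite mulgV.
by rewrite [LHS]presented_mulE; apply/pi_presentedP/(pres_cancel R x false).
Qed.

Lemma multiplicative_hom (G H : groupType) (f : {multiplicative G -> H}) :
  exists g : ghom G H, g =1 f.
Proof.
have f1 : f 1 = 1 by apply: (mulgI (f 1)); rewrite -gmulfM !mulg1.
pose m := Multiplicative_isUMagmaMorphism.Build G H f f1.
by exists (HB.pack (f : G -> H) (Multiplicative.on f) m : ghom G H).
Qed.

Lemma morph_hom (G H : groupType) (f : G -> H) : {morph f : x y / x * y} ->
  exists g : ghom G H, g =1 f.
Proof.
move=> fM; pose m := isMultiplicative.Build G H f fM.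
pose F : {multiplicative G -> H} := HB.pack f m.
exact: (multiplicative_hom F).
Qed.

Lemma homM (G H : groupType) (f : ghom G H) x y : f (x * y) = f x * f y.
Proof. exact: gmulfM. Qed.

Lemma homV (G H : groupType) (f : ghom G H) x : f x^-1 = (f x)^-1.
Proof. exact: gmulfV. Qed.

(* The generator s_i of J(K) is labelled by the pair (k_i, k'_i). *)
Definition label : Type := (option nat * nat)%type.

Section Frames.
Variable G : groupType.
Implicit Types (D : seq (label * G)) (x y g : G).

Definition pow_ok (k : option nat) (x : G) : Prop :=
  if k is Some m then x ^+ m = 1 else True.

Definition lprod D : G := \prod_(t <- D) t.2.

(* The relations of J(K), for a labelled family of elements of any group. *)
Definition frame D : Prop :=
  forall t, t \in D -> pow_ok t.1.1 t.2 /\ commute t.2 (lprod D).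

Lemma lprod_cat D1 D2 : lprod (D1 ++ D2) = lprod D1 * lprod D2.
Proof. exact: big_cat. Qed.
Lemma lprod_cons t D : lprod (t :: D) = t.2 * lprod D.
Proof. exact: big_cons. Qed.
Lemma lprod_nil : lprod [::] = 1. Proof. exact: big_nil. Qed.

Lemma pow_ok_conj k x y : pow_ok k x -> pow_ok k (x ^ y).
Proof. by case: k => //= m; rewrite -conjXg => ->; rewrite conj1g. Qed.

Definition fconj D g : seq (label * G) := [seq (t.1, t.2 ^ g) | t <- D].

Lemma lprod_conj D g : lprod (fconj D g) = lprod D ^ g.
Proof. by rewrite /lprod big_map conjg_prod. Qed.

Lemma fst_fconj D g : map fst (fconj D g) = map fst D.
Proof. by rewrite -map_comp. Qed.

(* The reflections of a generalized J-group, inside J(K). *)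
Definition refl D (y : G) : Prop :=
  y <> 1 /\ exists2 t, t \in D &
    exists g x, powers (t.2 ^+ t.1.2) x /\ y = x ^ g.

Lemma powers_conj x y g : powers x y -> powers (x ^ g) (y ^ g).
Proof.
move=> [n [->|->]]; exists n; [left|right]; first by rewrite conjXg.
by rewrite conjVg conjXg.
Qed.

End Frames.

Definition fmap (G H : groupType) (f : G -> H) (D : seq (label * G)) :=
  [seq (t.1, f t.2) | t <- D].

Lemma fst_fmap (G H : groupType) (f : G -> H) D :
  map fst (fmap f D) = map fst D.
Proof. by rewrite -map_comp. Qed.

Lemma fmap_cat (G H : groupType) (f : G -> H) D1 D2 :
  fmap f (D1 ++ D2) = fmap f D1 ++ fmap f D2.
Proof. exact: map_cat. Qed.

Lemma lprod_fmap (G H : groupType) (f : ghom G H) D :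
  lprod (fmap f D) = f (lprod D).
Proof. by rewrite /lprod big_map gmulf_prod. Qed.

Lemma powers_hom (G H : groupType) (f : ghom G H) x y :
  powers x y -> powers (f x) (f y).
Proof.
move=> [n [->|->]]; exists n; [left; exact: gmulfXn|right].
by rewrite gmulfV gmulfXn.
Qed.

Section PresentedFrame.
Variables (KK : seq label) (R : word 'I_(size KK) -> word 'I_(size KK) -> Prop).

Definition gens : seq (label * presented R) :=
  [seq (tnth (in_tuple KK) i, presented_gen R i) | i <- enum 'I_(size KK)].

Lemma fst_gens : map fst gens = KK.
Proof. by rewrite -map_comp (map_tnth_enum (in_tuple KK)). Qed.

Lemma gens_ind (P : presented R -> Prop) :
  P 1 -> (forall t g, t \in gens -> P g -> P (t.2 * g)) ->
  (forall t g, t \in gens -> P g -> P (t.2^-1 * g)) -> forall g, P g.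
Proof.
move=> P1 PM PV; apply: presented_ind => // i g Pg.
  by apply: (PM (tnth (in_tuple KK) i, presented_gen R i)) => //;
    apply: map_f; rewrite mem_enum.
by apply: (PV (tnth (in_tuple KK) i, presented_gen R i)) => //;
  apply: map_f; rewrite mem_enum.
Qed.

Lemma gens_subgroup (S : set (presented R)) : is_subgroup S ->
  (forall t, t \in gens -> S t.2) -> forall g, S g.
Proof.
move=> /subgroupP[S1 SV SM] St; apply: gens_ind => // t g tD Sg.
  by apply: SM => //; apply: St.
by apply: SM => //; apply/SV/St.
Qed.

Section Hom.
Variables (G : groupType) (D : seq (label * G)).
Hypothesis DK : map fst D = KK.

Definition frame_val (i : 'I_(size KK)) : G := (nth (None, 0, 1) D i).2.

Lemma frame_val_enum :
  [seq frame_val i | i <- enum 'I_(size KK)] = [seq t.2 | t <- D].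
Proof.
have sD : size D = size KK by rewrite -DK size_map.
apply: (@eq_from_nth _ 1); first by rewrite !size_map -enumT size_enum_ord sD.
move=> i; rewrite size_map size_enum_ord => ip.
rewrite (nth_map (Ordinal ip)) ?size_enum_ord // (nth_map (None, 0, 1)) ?sD //.
by rewrite /frame_val (nth_ord_enum _ (Ordinal ip)).
Qed.

Lemma frame_val_in (i : 'I_(size KK)) : (tnth (in_tuple KK) i, frame_val i) \in D.
Proof.
have iD : (i < size D)%N by rewrite -(size_map fst) DK.
rewrite (_ : (_, _) = nth (None, 0, 1) D i) ?mem_nth //.
rewrite [RHS]surjective_pairing (tnth_nth (None, 0)) /=; congr pair.
by rewrite -(nth_map _ (None, 0) fst iD) DK.
Qed.

Lemma eval_pos (s : seq 'I_(size KK)) :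
  word_eval frame_val [seq (j, false) | j <- s] = \prod_(y <- [seq frame_val j | j <- s]) y.
Proof. by rewrite /word_eval !big_map. Qed.

Lemma eval_nseq k i : word_eval frame_val (nseq k (i, false)) = frame_val i ^+ k.
Proof. by rewrite /word_eval big_nseq /= iter_mulg_1. Qed.

Lemma gens_hom :
  (forall u v, R u v -> word_eval frame_val u = word_eval frame_val v) ->
  exists f : ghom (presented R) G, fmap f gens = D.
Proof.
move=> rel; have [phi [phiE _]] := presented_universal rel.
have [f fE] := multiplicative_hom phi; exists f.
have sD : size D = size KK by rewrite -DK size_map.
apply: (@eq_from_nth _ (None, 0, 1)); first by rewrite !size_map -enumT size_enum_ord sD.
move=> i; rewrite !size_map -enumT size_enum_ord => ip.
have ip' : (i < size (enum 'I_(size KK)))%N by rewrite size_enum_ord.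
rewrite /fmap /gens -map_comp (nth_map (Ordinal ip)) //=.
rewrite (nth_ord_enum _ (Ordinal ip)) fE phiE /frame_val /= (tnth_nth (None, 0)) /=.
have -> : nth (None, 0) KK i = (nth (None, 0, 1) D i).1 by rewrite -DK (nth_map (None, 0, 1)) ?sD.
by rewrite -surjective_pairing.
Qed.

End Hom.
End PresentedFrame.

(** * The group J(K) as the universal frame, and its normal subgroup generated by reflections *)

Section CanonicalFrame.
Variable KK : seq label.
Definition KT : (size KK).-tuple (option nat) := map_tuple fst (in_tuple KK).
Definition KT' : (size KK).-tuple nat := map_tuple snd (in_tuple KK).
Definition JJ : groupType := J KT.
Definition JD : seq (label * JJ) := gens (J_rel KT).

Lemma fst_JD : map fst JD = KK. Proof. exact: fst_gens. Qed.

Lemma lprod_JD : lprod JD = \prod_(l <- enum 'I_(size KK)) J_gen KT l.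
Proof. by rewrite /lprod big_map. Qed.

Lemma JD_frame : frame JD.
Proof.
move=> t /mapP[i _ ->] /=; split.
  rewrite /pow_ok; case E: (tnth _ _).1 => [m|//].
  by apply: J_gen_order; rewrite tnth_map.
rewrite lprod_JD; have p0 : 0 < size KK by apply: leq_ltn_trans (ltn_ord i).
(* The bound is not strict: rotation by [i.+1] is needed below, and for the last generator it is the
   full turn, which is not among the relations. *)
have rotE n : n <= size KK -> \prod_(l <- rot n (enum 'I_(size KK))) J_gen KT l =
    \prod_(l <- enum 'I_(size KK)) J_gen KT l.
  rewrite leq_eqVlt => /predU1P[->|ni].
    by rewrite rot_oversize // size_enum_ord.
  by have := @J_gen_rotation _ KT (Ordinal ni) (Ordinal p0); rewrite rot0.
have si : (i < size (enum 'I_(size KK)))%N by rewrite size_enum_ord.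
(* Two consecutive rotations read [s X] and [X s] for the i-th generator s; both equal z, so s
   commutes with z. *)
have E1 := rotE i (ltnW (ltn_ord i)); have E2 := rotE i.+1 (ltn_ord i).
move: E1 E2; rewrite {1 2}/rot (drop_nth i) // nth_ord_enum.
rewrite (take_nth i) // nth_ord_enum -cats1 catA.
rewrite big_cat big_cons /= => E1.
rewrite !big_cat big_seq1 /= => E2.
by rewrite /commute -{1}E2 -E1 !mulgA.
Qed.

Lemma JJ_ind (P : JJ -> Prop) :
  P 1 -> (forall t g, t \in JD -> P g -> P (t.2 * g)) ->
  (forall t g, t \in JD -> P g -> P (t.2^-1 * g)) -> forall g, P g.
Proof. exact: gens_ind. Qed.

Lemma JJ_subgroup (S : set JJ) : is_subgroup S ->
  (forall t, t \in JD -> S t.2) -> forall g, S g.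
Proof. exact: gens_subgroup. Qed.

Lemma JJ_hom (G : groupType) (D : seq (label * G)) :
  frame D -> map fst D = KK -> exists f : ghom JJ G, fmap f JD = D.
Proof.
move=> fD DK; apply: gens_hom => // u v [[i [j [-> ->]]]|[i [k [Ki -> ->]]]].
  rewrite !eval_pos !map_rot !frame_val_enum // !prodg_rot // => _ /mapP[t tD ->].
  - by rewrite big_map; apply: (fD _ tD).2.
  - by rewrite big_map; apply: (fD _ tD).2.
have [] := fD _ (frame_val_in DK i).
by rewrite eval_nseq /word_eval big_nil /= -(tnth_map fst) -/KT Ki.
Qed.

Lemma genJ_reflectionsE (x : genJ KT KT') :
  genJ_reflections KT KT' x <-> refl JD (val x).
Proof.
split=> [[x1 [i [g [y [py xy]]]]]|[x1 [_ /mapP[i _ ->] [g [y [/= py xy]]]]]]; split.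
- by move=> e; apply: x1; apply: val_inj; rewrite e.
- exists (tnth (in_tuple KK) i, J_gen KT i); first by apply: map_f; rewrite mem_enum.
  by exists g, y; rewrite /= -(tnth_map snd (in_tuple KK)).
- by move=> e; apply: x1; rewrite e.
- by exists i, g, y; rewrite tnth_map.
Qed.

(* The generalized J-group of KK, as a subset of J(K). *)
Definition NJ : set JJ := genJ_set KT KT'.

Lemma NJ_normal : is_normal_subgroup NJ.
Proof.
split=> [|x g Nx H HA]; last by have [[_ HN] _] := HA; exact: HN _ _ (Nx _ HA).
split=> [H [[[H1 _] _] _]//|x y Nx Ny H HA]; have [[[_ HF] _] _] := HA.
exact: HF (Nx _ HA) (Ny _ HA).
Qed.

Lemma NJ_subgroup : is_subgroup NJ. Proof. by case: NJ_normal. Qed.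

Lemma NJ_gen t : t \in JD -> NJ (t.2 ^+ t.1.2).
Proof.
move=> /mapP[i _ ->] H [_]; apply.
by exists i => //=; rewrite tnth_map.
Qed.

Lemma refl_NJ y : refl JD y -> NJ y.
Proof.
move=> [_ [t tD [g [x [px ->]]]]]; have [NS NC] := NJ_normal; apply: NC.
have [N1 NV NM] := subgroupP NS; have Nt := NJ_gen tD.
have NX n : NJ ((t.2 ^+ t.1.2) ^+ n) by elim: n => // n IHn; rewrite expgS; apply: NM.
by case: px => n [->|->] //; apply: NV.
Qed.

Lemma NJ_sub (S : set JJ) : is_normal_subgroup S ->
  (forall t, t \in JD -> S (t.2 ^+ t.1.2)) -> NJ `<=` S.
Proof.
move=> Sn St; apply: smallest_sub => // _ [i _ <-].
suff : S ((tnth (in_tuple KK) i, J_gen KT i).2 ^+ (tnth (in_tuple KK) i, J_gen KT i).1.2).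
  by rewrite /= tnth_map.
by apply: St; apply: map_f; rewrite mem_enum.
Qed.

(** Reflections are closed under conjugation, so they generate [NJ] already as a subgroup. [S'] is
    the normal core of [S]. *)
Lemma NJ_refl_ind (S : set JJ) : is_subgroup S ->
  refl JD `<=` S -> NJ `<=` S.
Proof.
move=> SS RS; pose S' : set JJ := [set x | forall g, S (x ^ g)].
suff : NJ `<=` S' by move=> NS x /NS/(_ 1); rewrite conjg1.
have [S1 SV SM] := subgroupP SS.
apply: NJ_sub => [|t tD g].
  split=> [|x g Sx h]; last by rewrite -conjgM; apply: Sx.
  apply: is_subgroupM => [g|x Sx g|x y Sx Sy g]; first by rewrite conj1g.
  - by rewrite conjVg; apply: SV.
  - by rewrite conjMg; apply: SM.
have [->|/eqP y1] := eqVneq ((t.2 ^+ t.1.2) ^ g) 1; first exact: S1.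
apply: RS; split=> //; exists t => //; exists g, (t.2 ^+ t.1.2); split=> //.
by exists 1%N; left.
Qed.

End CanonicalFrame.

(** * Reflection isomorphisms induced by injective homomorphisms *)

Definition RI (KK LL : seq label) : Prop :=
  reflection_isomorphic (KT KK) (KT' KK) (KT LL) (KT' LL).

Lemma reflection_isomorphic_trans p q r
    (K : p.-tuple (option nat)) (K' : p.-tuple nat)
    (L : q.-tuple (option nat)) (L' : q.-tuple nat)
    (M : r.-tuple (option nat)) (M' : r.-tuple nat) :
  reflection_isomorphic K K' L L' -> reflection_isomorphic L L' M M' ->
  reflection_isomorphic K K' M M'.
Proof.
move=> [f [fb fR]] [g [gb gR]].
have [h hE] : exists h : ghom (genJ K K') (genJ M M'), h =1 g \o f.
  by apply: morph_hom => x y /=; rewrite !gmulfM.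
exists h; rewrite (_ : (h : _ -> _) = g \o f); last exact: funext.
split; first exact: bij_comp.
by rewrite -image_comp fR.
Qed.

Lemma RI_trans KK LL MM : RI KK LL -> RI LL MM -> RI KK MM.
Proof. exact: reflection_isomorphic_trans. Qed.

Lemma genJ_valP KK (x : genJ (KT KK) (KT' KK)) : NJ (val x).
Proof. exact: set_mem (valP x). Qed.

Definition to_genJ KK (x : JJ KK) (Nx : NJ x) : genJ (KT KK) (KT' KK) :=
  exist (fun x => x \in genJ_set (KT KK) (KT' KK)) x (mem_set Nx).

Lemma RI_hom KK LL (f : ghom (JJ LL) (JJ KK)) : injective f ->
  (forall y, refl (JD LL) y -> refl (JD KK) (f y)) ->
  (forall y, refl (JD KK) y -> exists2 x, refl (JD LL) x & f x = y) ->
  RI KK LL.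
Proof.
move=> finj fR fS.
have fN x : NJ x -> NJ (f x).
  move: x; apply: NJ_refl_ind => [|x /fR/refl_NJ//].
  have [N1 NV NM] := subgroupP (NJ_subgroup KK).
  apply: is_subgroupM => [|x|x y] /=; rewrite ?gmulf1 ?gmulfV ?gmulfM //.
  - exact: NV.
  - exact: NM.
have Nf y : NJ y -> exists2 x, NJ x & f x = y.
  have [N1 NV NM] := subgroupP (NJ_subgroup LL).
  move: y; apply: (@NJ_refl_ind KK [set y | exists2 x, NJ x & f x = y]) => [|y /fS[x /refl_NJ Nx <-]].
    apply: is_subgroupM => [|_ [x Nx <-]|_ _ [x Nx <-] [y Ny <-]] /=.
    - by exists 1; rewrite ?gmulf1.
    - by exists x^-1; rewrite ?gmulfV //; apply: NV.
    - by exists (x * y); rewrite ?gmulfM //; apply: NM.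
  by exists x.
pose GK := genJ (KT KK) (KT' KK); pose GL := genJ (KT LL) (KT' LL).
have gex (y : GK) : exists x : GL, f (val x) = val y.
  have [x Nx fx] := Nf _ (genJ_valP y).
  by exists (to_genJ Nx).
have [g gE] := choice gex.
have [h hE] : exists h : ghom GK GL, h =1 g.
  apply: morph_hom => x y; apply: val_inj; apply: finj.
  by rewrite gE [val (_ * _)]valM [val (g x * _)]valM gmulfM !gE.
exists h; rewrite (_ : (h : _ -> _) = g); last exact: funext.
split.
  exists (fun x : GL => to_genJ (fN _ (genJ_valP x))) => x.
    by apply: val_inj; rewrite /= gE.
  by apply: val_inj; apply: finj; rewrite gE.
apply/seteqP; split=> [_ [x /genJ_reflectionsE Rx <-]|x /genJ_reflectionsE/fR Rx].
  apply/genJ_reflectionsE; have [y Ry fy] := fS _ Rx.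
  by rewrite (_ : val (g x) = y) //; apply: finj; rewrite gE.
exists (to_genJ (fN _ (genJ_valP x))).
  exact/genJ_reflectionsE.
by apply: val_inj; apply: finj; rewrite gE.
Qed.

Lemma fg_iso (G H : groupType) (f : {multiplicative G -> H}) :
  bijective f -> finitely_generated G -> finitely_generated H.
Proof.
move=> [g fK gK] [A Afin AG]; have [f' fE] := multiplicative_hom f.
exists (f' @` A); first exact: finite_image.
apply/seteqP; split=> // y _ S [SS AS].
have [S1 SV SM] := subgroupP SS.
suff : [set: G] `<=` f' @^-1` S by move=> /(_ (g y) I) /=; rewrite fE gK.
rewrite -AG; apply: smallest_sub => [|x Ax]; last by apply: AS; exists x.
apply: is_subgroupM => [|x|x z] /=; rewrite ?gmulf1 ?gmulfV ?gmulfM //.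
- exact: SV.
- exact: SM.
Qed.

Lemma RI_fg KK LL : RI KK LL -> finitely_generated (genJ (KT KK) (KT' KK)) ->
  finitely_generated (genJ (KT LL) (KT' LL)).
Proof. by move=> [f [fb _]]; apply: fg_iso fb. Qed.

(** Every reflection is conjugate to a power of some [t.2 ^+ t.1.2], so these elements alone need to
    be matched. The second condition ranges over all [g] in J(K), because the conjugating elements
    need not lie in the image of [f]. *)
Lemma RI_classes KK LL (f : ghom (JJ LL) (JJ KK)) : injective f ->
  (forall t, t \in JD LL -> exists2 u, u \in JD KK &
     exists g, f (t.2 ^+ t.1.2) = (u.2 ^+ u.1.2) ^ g) ->
  (forall u g, u \in JD KK -> u.2 ^+ u.1.2 <> 1 -> exists2 t, t \in JD LL &
     exists h, (u.2 ^+ u.1.2) ^ g = f ((t.2 ^+ t.1.2) ^ h)) ->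
  RI KK LL.
Proof.
move=> finj f1 f2; apply: (RI_hom finj) => y [y1 [t tD [g [x [px yE]]]]].
  split; first by move=> fy; apply: y1; apply: finj; rewrite gmulf1.
  have [u uD [h E]] := f1 _ tD; exists u => //.
  exists (h * f g), (f x ^ h^-1); split.
    rewrite -[u.2 ^+ _](conjgK h) -E.
    exact/powers_conj/powers_hom.
  by rewrite yE conjgM conjgKV gmulfJ.
have t1 : t.2 ^+ t.1.2 <> 1.
  move=> t1; apply: y1; rewrite yE; case: px => n.
  by rewrite t1 expg1n invg1; case=> ->; rewrite conj1g.
have [u uD [h E]] := f2 _ g tD t1.
have [n yn] := powers_conj g px; rewrite -yE E in yn.
(* The preimage must take the same sign of exponent as [y], which is only known as a disjunction. *)
exists ((if `[< y = f ((u.2 ^+ u.1.2) ^ h) ^+ n >] then (u.2 ^+ u.1.2) ^+ n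
   else (u.2 ^+ u.1.2) ^- n) ^ h); last first.
  case: ifPn => [/asboolP ->|/asboolPn yN]; first by rewrite !gmulfJ gmulfXn conjXg.
  by case: yn => [/yN//|->]; rewrite !gmulfJ gmulfV gmulfXn conjVg conjXg.
split.
  move=> e; apply: y1; case: ifPn e => [/asboolP ->|/asboolPn yN].
    by rewrite -gmulfXn -conjXg => ->; rewrite gmulf1.
  case: yn => [/yN//|->]; rewrite -gmulfXn -gmulfV -conjXg -conjVg => ->.
  by rewrite gmulf1.
exists u => //; exists h; eexists; split; last by [].
by exists n; case: ifP; [left|right].
Qed.

(** * Reordering and dropping generators *)

Lemma labels_cat (T : Type) (D : seq (label * T)) A B : map fst D = A ++ B ->
  exists D1 D2, [/\ D = D1 ++ D2, map fst D1 = A & map fst D2 = B].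
Proof.
move=> E; exists (take (size A) D), (drop (size A) D).
by rewrite cat_take_drop !map_take !map_drop E take_size_cat // drop_size_cat.
Qed.

Lemma labels_cons (T : Type) (D : seq (label * T)) l B : map fst D = l :: B ->
  exists x D2, D = (l, x) :: D2 /\ map fst D2 = B.
Proof. by case: D => [//|[l' x] D] [-> <-]; exists x, D. Qed.

Lemma labels_flatten (T : eqType) n (D : seq (label * T)) A :
  map fst D = flatten (nseq n A) -> exists Ds : seq (seq (label * T)),
    [/\ D = flatten Ds, size Ds = n & {in Ds, forall E, map fst E = A}].
Proof.
elim: n D => [|n IHn] D /=; first by case: D => // _; exists [::].
move=> /labels_cat[D1 [D2 [-> D1A /IHn[Ds [-> <- H]]]]].
by exists (D1 :: Ds); split=> // E; rewrite in_cons => /predU1P[->|/H].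
Qed.

Lemma frame_central (G : groupType) (D : seq (label * G)) :
  (forall g, commute g (lprod D)) ->
  (forall t, t \in D -> pow_ok t.1.1 t.2) -> frame D.
Proof. by move=> zD pD t tD; split; [apply: pD|apply: zD]. Qed.

Lemma JD_central KK (g : JJ KK) : commute g (lprod (JD KK)).
Proof.
move: g; apply: (@JJ_subgroup KK [set g | commute g (lprod (JD KK))]).
  apply: is_subgroupM => [|x /=|x y /= xz yz].
  - exact/commute_sym/commute1.
  - exact: commuteVl.
  - by apply/commute_sym/commuteM; apply: commute_sym.
by move=> t tD; have [] := JD_frame tD.
Qed.

Lemma JD_pow KK t : t \in JD KK -> pow_ok t.1.1 t.2.
Proof. by move=> /JD_frame[]. Qed.

Lemma JD_label KK t : t \in JD KK -> t.1 \in KK.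
Proof. by move=> tD; have := map_f fst tD; rewrite fst_JD. Qed.

Lemma JJ_cancel KK (G : groupType) (f : ghom (JJ KK) G) (g : ghom G (JJ KK)) :
  fmap g (fmap f (JD KK)) = JD KK -> cancel f g.
Proof.
move=> gf; have E t : t \in JD KK -> g (f t.2) = t.2.
  move=> tD; have : fmap g (fmap f (JD KK)) = fmap id (JD KK).
    by rewrite gf /fmap -{1}[JD KK]map_id; apply: eq_map; case.
  by rewrite /fmap -map_comp => /eq_in_map/(_ t tD)[].
apply: JJ_ind => [|t x tD gx|t x tD gx]; first by rewrite !gmulf1.
  by rewrite !gmulfM gx E.
by rewrite !gmulfM !gmulfV gx E.
Qed.

Lemma mem_fmap (G H : groupType) (f : G -> H) D t :
  t \in D -> (t.1, f t.2) \in fmap f D.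
Proof. exact: map_f. Qed.

Lemma RI_iso KK LL (f : ghom (JJ LL) (JJ KK)) (g : ghom (JJ KK) (JJ LL)) :
  cancel f g -> cancel g f ->
  (forall t, t \in fmap f (JD LL) -> exists2 u, u \in JD KK &
     exists h, t = (u.1, u.2 ^ h)) ->
  (forall u, u \in JD KK -> exists2 t, t \in fmap f (JD LL) &
     exists h, u = (t.1, t.2 ^ h)) ->
  RI KK LL.
Proof.
move=> fK gK f1 f2; apply: (RI_classes (can_inj fK)) => [t tD|u h uD _].
  have [u uD [h [E1 E2]]] := f1 _ (mem_fmap f tD); exists u => //; exists h.
  by rewrite gmulfXn E1 E2 conjXg.
have [_ /mapP[t tD ->] [x ->]] := f2 _ uD; exists t => //=.
by exists (g (x * h)); rewrite gmulfJ gmulfXn gK conjgM !conjXg.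
Qed.

Lemma fconjK (G : groupType) (D : seq (label * G)) x : fconj (fconj D x) x^-1 = D.
Proof. by rewrite /fconj -map_comp map_id_in // => -[l y] _ /=; rewrite conjgK. Qed.

Lemma fconjKV (G : groupType) (D : seq (label * G)) x : fconj (fconj D x^-1) x = D.
Proof. by rewrite -{2}[x]invgK fconjK. Qed.

Lemma fmap_conj (G H : groupType) (f : ghom G H) D x :
  fmap f (fconj D x) = fconj (fmap f D) (f x).
Proof. by rewrite /fmap /fconj -!map_comp; apply: eq_map => t /=; rewrite gmulfJ. Qed.

Lemma fconj_pow (G : groupType) (D : seq (label * G)) g :
  (forall t, t \in D -> pow_ok t.1.1 t.2) ->
  forall t, t \in fconj D g -> pow_ok t.1.1 t.2.
Proof. by move=> pD t /mapP[u /pD pu ->]; apply: pow_ok_conj. Qed.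

Lemma size_fst (T U : Type) (D : seq (label * T)) (E : seq (label * U)) : map fst D = map fst E -> size D = size E.
Proof. by move=> DE; rewrite -(size_map fst D) DE size_map. Qed.

(* A Hurwitz move: [a A = (a A a^-1) a]. *)
Lemma RI_move C A x B : RI (C ++ x :: A ++ B) (C ++ A ++ x :: B).
Proof.
set KK := _ ++ x :: _; set LL := _ ++ A ++ _.
have := fst_JD KK; have := fst_JD LL.
move=> /labels_cat[C2 [D2 [eL C2K /labels_cat[A2 [E2 [eD2 A2K]]]]]].
move=> /labels_cons[b [B2 [eE2 B2K]]]; rewrite {}eD2 {}eE2 in eL.
move=> /labels_cat[C1 [D1 [eK C1K /labels_cons[a [E1 [eD1 ]]]]]].
move=> /labels_cat[A1 [B1 [eE1 A1K B1K]]]; rewrite {}eD1 {}eE1 in eK.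
have pK := @JD_pow KK; have pL := @JD_pow LL.
have [f fE] : exists f : ghom (JJ LL) (JJ KK),
    fmap f (JD LL) = C1 ++ fconj A1 a^-1 ++ (x, a) :: B1.
  apply: JJ_hom; last by rewrite !map_cat /= fst_fconj C1K A1K B1K.
  apply: frame_central => [g|t].
    rewrite !lprod_cat lprod_conj lprod_cons /=.
    suff -> : lprod C1 * (lprod A1 ^ a^-1 * (a * lprod B1)) = lprod (JD KK).
      exact: JD_central.
    by rewrite eK lprod_cat lprod_cons lprod_cat; gsimp.
  rewrite mem_cat => /orP[tC|]; first by apply: pK; rewrite eK mem_cat tC.
  rewrite mem_cat => /orP[|tB]; last first.
    by apply: pK; rewrite eK mem_cat in_cons mem_cat; move: tB; rewrite in_cons;
      case/orP => ->; rewrite ?orbT.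
  apply: fconj_pow => u uA; apply: pK.
  by rewrite eK mem_cat in_cons mem_cat uA !orbT.
have [g gE] : exists g : ghom (JJ KK) (JJ LL),
    fmap g (JD KK) = C2 ++ (x, b) :: fconj A2 b ++ B2.
  apply: JJ_hom; last by rewrite !map_cat /= map_cat fst_fconj C2K A2K B2K.
  apply: frame_central => [h|t].
    rewrite lprod_cat lprod_cons lprod_cat lprod_conj /=.
    suff -> : lprod C2 * (b * (lprod A2 ^ b * lprod B2)) = lprod (JD LL).
      exact: JD_central.
    by rewrite eL !lprod_cat lprod_cons; gsimp.
  rewrite mem_cat in_cons mem_cat => /or4P[tC|/eqP->|tA|tB].
  - by apply: pL; rewrite eL mem_cat tC.
  - by apply: (pL (x, b)); rewrite eL !mem_cat in_cons eqxx !orbT.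
  - move: t tA; apply: fconj_pow => u uA; apply: pL.
    by rewrite eL !mem_cat uA !orbT.
  - by apply: pL; rewrite eL !mem_cat in_cons tB !orbT.
have s1 : size C1 = size C2 by apply: size_fst; rewrite C1K.
have s2 : size A1 = size A2 by apply: size_fst; rewrite A1K.
have : fmap f (JD LL) = fmap f (JD LL) by [].
rewrite {1}eL fE !fmap_cat /= => /eqP.
rewrite eqseq_cat ?size_map // => /andP[/eqP fC].
rewrite eqseq_cat ?size_map // => /andP[/eqP fA /eqP[fb fB]].
have : fmap g (JD KK) = fmap g (JD KK) by [].
rewrite {1}eK gE fmap_cat /= fmap_cat => /eqP.
rewrite eqseq_cat ?size_map // => /andP[/eqP gC /eqP[ga /eqP]].
rewrite eqseq_cat ?size_map // => /andP[/eqP gA /eqP gB].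
apply: (@RI_iso KK LL f g).
- apply: JJ_cancel; rewrite fE !fmap_cat /= fmap_conj gC gA gB gmulfV ga fconjK.
  by rewrite -eL.
- apply: JJ_cancel; rewrite gE fmap_cat /= fmap_cat fmap_conj fC fA fB fb fconjKV.
  by rewrite -eK.
- rewrite fE eK => t; rewrite !mem_cat in_cons => /or4P[tC|/mapP[u uA ->]|/eqP->|tB].
  + exists t; first by rewrite mem_cat tC.
    by exists 1; rewrite conjg1; case: t tC.
  + exists u; first by rewrite mem_cat in_cons mem_cat uA !orbT.
    by exists a^-1.
  + exists (x, a); first by rewrite mem_cat in_cons eqxx !orbT.
    by exists 1; rewrite conjg1.
  + exists t; first by rewrite mem_cat in_cons mem_cat tB !orbT.
    by exists 1; rewrite conjg1; case: t tB.
- rewrite fE eK => t; rewrite mem_cat in_cons mem_cat => /or4P[tC|/eqP->|tA|tB].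
  + exists t; first by rewrite mem_cat tC.
    by exists 1; rewrite conjg1; case: t tC.
  + exists (x, a); first by rewrite !mem_cat in_cons eqxx !orbT.
    by exists 1; rewrite conjg1.
  + exists (t.1, t.2 ^ a^-1).
      by rewrite !mem_cat (map_f (fun t => (t.1, t.2 ^ a^-1))) ?orbT.
    by exists a; rewrite /= conjgKV; case: t tA.
  + exists t; first by rewrite !mem_cat in_cons tB !orbT.
    by exists 1; rewrite conjg1; case: t tB.
Qed.

Lemma RI_refl KK : RI KK KK.
Proof.
have [f fE] : exists f : ghom (JJ KK) (JJ KK), f =1 id by exact: morph_hom.
have fD : fmap f (JD KK) = JD KK.
  by rewrite /fmap map_id_in // => -[l x] _ /=; rewrite fE.
apply: (@RI_iso _ _ f f); try by [move=> x; rewrite !fE].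
  by rewrite fD => t tD; exists t => //; exists 1; rewrite conjg1; case: t tD.
by rewrite fD => t tD; exists t => //; exists 1; rewrite conjg1; case: t tD.
Qed.

Lemma RI_perm KK LL : perm_eq KK LL -> RI KK LL.
Proof.
suff H (C s t : seq label) : perm_eq s t -> RI (C ++ s) (C ++ t) by apply: (H [::]).
elim: s t C => [|x s IHs] t C.
  by move=> /perm_size/esym/size0nil ->; apply: RI_refl.
move=> /[dup] /perm_mem/(_ x); rewrite mem_head => /esym/splitPr[A B].
rewrite perm_sym -[x :: B]cat1s perm_catCA /= perm_cons perm_sym => /(IHs _ (C ++ [:: x])).
by rewrite -!catA => /RI_trans; apply; apply: RI_move.
Qed.

Lemma RI_drop k' B : RI ((Some 1%N, k') :: B) B.
Proof.
set x := (Some 1%N, k'); set KK := x :: B.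
have /labels_cons[a [B1 [eK B1K]]] := fst_JD KK.
have pK := @JD_pow KK; have pL := @JD_pow B.
have a1 : a = 1.
  by have /= := pK (x, a); rewrite eK mem_head expg1; apply.
have [f fE] : exists f : ghom (JJ B) (JJ KK), fmap f (JD B) = B1.
  apply: JJ_hom => //; apply: frame_central => [g|t tB]; last first.
    by apply: pK; rewrite eK in_cons tB orbT.
  by have := JD_central g; rewrite eK lprod_cons /= a1 mul1g.
have [g gE] : exists g : ghom (JJ KK) (JJ B), fmap g (JD KK) = (x, 1) :: JD B.
  apply: JJ_hom; last by rewrite /= fst_JD.
  apply: frame_central => [h|t].
    by rewrite lprod_cons mul1g; apply: JD_central.
  by rewrite in_cons => /predU1P[->|/pL].
have [_ gB] : (x, g a) = (x, 1) /\ fmap g B1 = JD B.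
  by move: gE; rewrite eK /= => -[-> ->].
have fK : cancel f g by apply: JJ_cancel; rewrite fE gB.
have gK : cancel g f.
  by apply: JJ_cancel; rewrite gE /= fE gmulf1 eK a1.
apply: (RI_classes (can_inj fK)) => [t tD|u h].
  exists (t.1, f t.2); last by exists 1; rewrite conjg1 gmulfXn.
  by rewrite eK in_cons -fE mem_fmap ?orbT.
rewrite eK in_cons => /predU1P[->|]; first by rewrite /= a1 expg1n.
rewrite -fE => /mapP[t tD ->] _; exists t => //.
by exists (g h); rewrite gmulfJ gmulfXn gK.
Qed.

(** With k_i = k'_i the elements that normally generate [NJ] are all 1. Such groups are trivial and
    have no reflections, whatever the number of generators. *)
Lemma RI_trivial KK LL :
  {in KK, forall l, l.1 = Some l.2} -> {in LL, forall l, l.1 = Some l.2} ->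
  RI KK LL.
Proof.
have triv MM : {in MM, forall l : label, l.1 = Some l.2} ->
    forall t, t \in JD MM -> t.2 ^+ t.1.2 = 1.
  move=> MS t tM; have := JD_pow tM.
  by rewrite MS //; apply: JD_label.
have NJ1 MM : {in MM, forall l : label, l.1 = Some l.2} -> NJ (KK:=MM) `<=` [set 1].
  move=> /triv M1; apply: NJ_sub => // ; split=> [|_ g ->]; last by rewrite /= conj1g.
  by split=> // _ _ -> ->; rewrite divg1.
move=> KS LS; have all1 (x y : genJ (KT LL) (KT' LL)) : x = y.
  by apply: val_inj; rewrite (NJ1 _ LS _ (genJ_valP x)) (NJ1 _ LS _ (genJ_valP y)).
have all1' (x y : genJ (KT KK) (KT' KK)) : x = y.
  by apply: val_inj; rewrite (NJ1 _ KS _ (genJ_valP x)) (NJ1 _ KS _ (genJ_valP y)).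
have [f _] : exists f : ghom (genJ (KT KK) (KT' KK)) (genJ (KT LL) (KT' LL)), f =1 fun=> 1.
  by apply: morph_hom => x y; rewrite mulg1.
exists f; split; first by exists (fun=> 1).
apply/seteqP; split=> [y [x Rx _]|x Rx].
  by case: Rx => x1; case: x1; apply: all1'.
by case: Rx => x1; case: x1; apply: all1.
Qed.

(** * Monomial permutations *)

Section Monomial.
Variables (X : Type) (G : groupType).

(** A monomial matrix with permutation [p] and entries [h], acting from the right on row vectors
    with a single entry g at position x. The points of [X] are the sheets of a covering. *)
Definition mono_fun (p : X -> X) (h : X -> G) (y : X * G) : X * G :=
  (p y.1, y.2 * h y.1).

Lemma mono_funK p q h : cancel p q ->
  cancel (mono_fun p h) (mono_fun q (fun x => (h (q x))^-1)).
Proof. by move=> pK [x g]; rewrite /mono_fun /= pK mulgK. Qed.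

Lemma mono_funVK p q h : cancel q p ->
  cancel (mono_fun q (fun x => (h (q x))^-1)) (mono_fun p h).
Proof. by move=> qK [x g]; rewrite /mono_fun /= qK mulgVK. Qed.

Definition mono p q (pK : cancel p q) (qK : cancel q p) h : sym (X * G) :=
  Sym (mono_funK h pK) (mono_funVK h qK).

Definition rmul (h : X -> G) : sym (X * G) :=
  @mono id id (fun=> erefl) (fun=> erefl) h.

Lemma rmulE h x g : rmul h (x, g) = (x, g * h x). Proof. by []. Qed.

Lemma rmulM h k : rmul h * rmul k = rmul (fun x => h x * k x).
Proof. by apply: symP => -[x g]; rewrite symME !rmulE mulgA. Qed.

Lemma rmul1 : rmul (fun _ => 1) = 1.
Proof. by apply: symP => -[x g]; rewrite rmulE mulg1. Qed.

Lemma rmulX h n : rmul h ^+ n = rmul (fun x => h x ^+ n).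
Proof.
elim: n => [|n IHn]; first by rewrite expg0 -rmul1.
by rewrite expgS IHn rmulM; congr rmul; apply: funext => x; rewrite expgS.
Qed.

Lemma rmul_prod (I : Type) (r : seq I) (F : I -> X -> G) :
  \prod_(i <- r) rmul (F i) = rmul (fun x => \prod_(i <- r) F i x).
Proof.
elim: r => [|i r IHr].
  by rewrite big_nil -rmul1; congr rmul; apply: funext => x; rewrite big_nil.
rewrite big_cons IHr rmulM; congr rmul.
by apply: funext => x; rewrite big_cons.
Qed.

Lemma mono_commute p q (pK : cancel p q) (qK : cancel q p) h c :
  (forall x, commute c (h x)) -> commute (mono pK qK h) (rmul (fun _ => c)).
Proof.
move=> ch; apply: symP => -[x g]; rewrite !symME /= /mono_fun /=.
by rewrite -!mulgA ch.
Qed.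

Definition d0 : label * G := ((None, 0), 1).

(* The tail of a frame acting fibrewise: over x it acts through the frame D x. *)
Definition stack (T : seq label) (D : X -> seq (label * G)) :
    seq (label * sym (X * G)) :=
  [seq (nth d0.1 T i, rmul (fun x => (nth d0 (D x) i).2)) | i <- iota 0 (size T)].

Lemma fst_stack T D : map fst (stack T D) = T.
Proof. by rewrite -map_comp; exact: mkseq_nth. Qed.

Lemma lprod_stack T D : (forall x, map fst (D x) = T) ->
  lprod (stack T D) = rmul (fun x => lprod (D x)).
Proof.
move=> DT; rewrite /lprod big_map rmul_prod; congr rmul; apply: funext => x.
by rewrite (big_nth d0) -(DT x) size_map /index_iota subn0.
Qed.

Lemma mem_stack T D t : (forall x, map fst (D x) = T) -> t \in stack T D ->
  exists h, t.2 = rmul h /\ forall x, (t.1, h x) \in D x.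
Proof.
move=> DT /mapP[i]; rewrite mem_iota /= => iT ->; eexists; split=> // x /=.
have iD : i < size (D x) by rewrite -(size_map fst) DT.
rewrite -(DT x) (nth_map d0) // -surjective_pairing; exact: mem_nth.
Qed.

End Monomial.

Arguments d0 {G}.

Section Carry.
Variables (n : nat) (G : groupType) (c : G).

(** An odometer: the factor [c] is paid only at the wrap-around, so that the full turn is the scalar
    [c] while shorter turns from sheet 0 are free of factors. *)
Definition carry : sym ('I_n.+1 * G) :=
  mono (@ordSK n.+1) (@ord_predK n.+1) (fun x => if x == ord_max then c else 1).

Lemma carryE x g :
  carry (x, g) = (ordS x, g * (if x == ord_max then c else 1)).
Proof. by []. Qed.

Lemma iter_ordS (j : nat) (i : 'I_n.+1) : val (iter j (@ordS n.+1) i) = (i + j) %% n.+1.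
Proof.
elim: j => [|j IHj]; first by rewrite addn0 modn_small.
by rewrite iterS /= IHj -addn1 modnDml addn1 addnS.
Qed.

Lemma carryX j g : (j <= n)%N -> (carry ^+ j) (ord0, g) = (inord j, g).
Proof.
elim: j => [|j IHj] jn; first by congr pair; apply: val_inj; rewrite /= inordK.
rewrite expgSr symME IHj ?(ltnW jn) // carryE.
rewrite ifN ?mulg1; last first.
  by apply/eqP => /(congr1 val); rewrite /= inordK ?(ltnW jn)//; lia.
congr pair; apply: val_inj; rewrite /= !inordK ?modn_small //; lia.
Qed.

Lemma carry0 g : (carry ^+ n.+1) (ord0, g) = (ord0, g * c).
Proof.
rewrite expgSr symME carryX // carryE ifT.
  by congr pair; apply: val_inj; rewrite /= inordK // modnn.
by apply/eqP/val_inj; rewrite /= inordK.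
Qed.

Lemma carryX_ord (x : 'I_n.+1) g : (carry ^+ x) (ord0, g) = (x, g).
Proof. by rewrite carryX -1?ltnS // inord_val. Qed.

Lemma carry_full : carry ^+ n.+1 = rmul (fun _ => c).
Proof.
apply: symP => -[x g].
by rewrite -[in LHS]carryX_ord -!symME -expgnDr addnC expgnDr symME carry0 carryX_ord rmulE.
Qed.

End Carry.

(** Embed [G] as scalar monomial matrices on d sheets; the odometer is a d-th root of the scalar
    [c], and it commutes with all scalars because [c] is central. *)
Lemma central_root (G : groupType) (c : G) d : (forall g, commute g c) -> (0 < d)%N ->
  exists (H : groupType) (i : ghom G H) (z : H),
    [/\ injective i, forall g, commute z (i g) & z ^+ d = i c].
Proof.
move=> cC; case: d => // n _; exists (sym ('I_n.+1 * G)).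
have [i iE] : exists i : ghom G (sym ('I_n.+1 * G)), i =1 fun g => rmul (fun _ => g).
  by apply: morph_hom => x y; rewrite rmulM.
exists i, (carry n c); split=> [x y|g|]; last by rewrite carry_full iE.
  by rewrite !iE => /(congr1 (fun f : sym _ => f (ord0, 1))); rewrite !rmulE !mul1g => -[].
by rewrite iE; apply: mono_commute => x; case: ifP => _ //; apply: commute1.
Qed.

(** Through [th], the image of [f] preserves the fibre over [x0] and acts there by right
    multiplication through the injective [i], so [f] has trivial kernel. *)
Lemma cover_inj KK LL (X : Type) (G : groupType) (x0 : X)
    (f : ghom (JJ LL) (JJ KK)) (th : ghom (JJ KK) (sym (X * G))) (i : ghom (JJ LL) G) :
  injective i ->
  (forall t g, t \in JD LL -> th (f t.2) (x0, g) = (x0, g * i t.2)) ->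
  injective f.
Proof.
move=> iinj thE.
have E x : forall g, th (f x) (x0, g) = (x0, g * i x).
  move: x; apply: (@JJ_subgroup LL [set x | forall g, th (f x) (x0, g) = (x0, g * i x)]).
    apply: is_subgroupM => [g|x xE g|x y xE yE g] /=.
    - by rewrite !gmulf1 mulg1.
    - rewrite !gmulfV; apply: (can_inj (@symK _ (th (f x)))).
      by rewrite -symME mulVg xE mulgVK.
    - by rewrite !gmulfM symME xE yE mulgA.
  by move=> t tD g; apply: thE.
apply: gmulf_inj => x fx; apply: iinj; have := E x 1.
by rewrite fx !gmulf1 mul1g => -[].
Qed.

Definition omul (d : nat) (k : option nat) := omap (muln d) k.

(** * Cyclic coverings *)

Lemma lprod_flatten (G : groupType) (I : Type) (s : seq I) (F : I -> seq (label * G)) :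
  lprod (flatten [seq F x | x <- s]) = \prod_(x <- s) lprod (F x).
Proof.
elim: s => [|x s IHs] /=; first by rewrite lprod_nil big_nil.
by rewrite lprod_cat IHs big_cons.
Qed.

(** With w ^ (s ^- x) = s^x w s^-x the product telescopes. It multiplies the lifts of a loop w to
    the d sheets that s permutes cyclically. *)
Lemma prod_conj_pow (G : groupType) (w s : G) d :
  \prod_(0 <= x < d) w ^ (s ^- x) = (w * s) ^+ d * s ^- d.
Proof.
elim: d => [|d IHd]; first by rewrite big_nil expg0 invg1 mulg1.
by rewrite big_nat_recr //= IHd [(w * s) ^+ d.+1]expgSr [s ^+ d.+1]expgSr; gsimp.
Qed.

Lemma labels_blocks (T : eqType) n (D : seq (label * T)) A :
  map fst D = flatten (nseq n A) -> exists F : nat -> seq (label * T),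
    D = flatten [seq F x | x <- iota 0 n] /\
    forall x, (x < n)%N -> map fst (F x) = A.
Proof.
move=> /labels_flatten[Ds [-> <- H]]; exists (nth [::] Ds).
by split=> [|x xn]; [rewrite -/(mkseq _ _) mkseq_nth|apply/H/mem_nth].
Qed.

Lemma eq_blocks (T : eqType) n (F H : nat -> seq T) :
  (forall x, (x < n)%N -> size (F x) = size (H x)) ->
  flatten [seq F x | x <- iota 0 n] = flatten [seq H x | x <- iota 0 n] ->
  forall x, (x < n)%N -> F x = H x.
Proof.
move=> sFH E x xn.
have : [seq F x | x <- iota 0 n] = [seq H x | x <- iota 0 n].
  apply: eq_from_flatten_shape => //; rewrite /shape -!map_comp.
  by apply/eq_in_map => y; rewrite mem_iota => /andP[_ yn]; apply: sFH.
by move=> /eq_in_map/(_ x); rewrite mem_iota; apply.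
Qed.

Lemma mem_blocks (T : eqType) n (F : nat -> seq T) t :
  t \in flatten [seq F x | x <- iota 0 n] -> exists2 x, (x < n)%N & t \in F x.
Proof. by move=> /flatten_mapP[x]; rewrite mem_iota => xn tx; exists x. Qed.

Lemma blocks_mem (T : eqType) n (F : nat -> seq T) x t :
  (x < n)%N -> t \in F x -> t \in flatten [seq F x | x <- iota 0 n].
Proof. by move=> xn tx; apply/flatten_mapP; exists x => //; rewrite mem_iota. Qed.

Lemma pow_ok_omul (G : groupType) d k (x : G) :
  pow_ok (omul d k) x <-> pow_ok k (x ^+ d).
Proof. by case: k => //= m; rewrite expgnA. Qed.

(** Conjugation by [s ^- x] transports the action on sheet x to sheet 0, without any factor since
    the odometer does not wrap on the way. The lift of a tail generator to sheet x thus acts on the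
    base fibre as [cover_inj] demands. *)
Lemma stack_act n KK (H G : groupType) T (T1 : seq (label * JJ KK))
    (Dx : seq (label * H)) (Di : 'I_n.+1 -> seq (label * G)) x (xn : (x < n.+1)%N)
    (f : ghom H (JJ KK)) (i : ghom H G) (th : ghom (JJ KK) (sym ('I_n.+1 * G))) s c g t :
  th s = carry n c -> fmap th T1 = stack T Di -> size T1 = size T ->
  Di (Ordinal xn) = fmap i Dx -> fmap f Dx = fconj T1 (s ^- x) -> t \in Dx ->
  th (f t.2) (ord0, g) = (ord0, g * i t.2).
Proof.
move=> thsE thT sT DiE fD tx.
pose r := index t Dx; have rD : (r < size Dx)%N by rewrite index_mem.
have sD : size Dx = size T1 by rewrite -(size_map (fun t => (t.1, f t.2))) [map _ _]fD size_map.
have E1 : f t.2 = (nth d0 T1 r).2 ^ (s ^- x).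
  have := congr1 (fun s => (nth d0 s r).2) fD.
  by rewrite (nth_map d0) // (nth_map d0) -?sD //= nth_index.
have E2 : th (nth d0 T1 r).2 = rmul (fun y => (nth d0 (Di y) r).2).
  have := congr1 (fun s => (nth d0 s r).2) thT.
  rewrite (nth_map d0) -?sD //= => ->.
  by rewrite /stack (nth_map 0%N) ?size_iota -?sT -?sD //= nth_iota -?sT -?sD.
rewrite E1 gmulfJ gmulfV gmulfXn thsE conjgE invgK E2 !symME.
have E h : (carry n c ^+ x) (ord0, h) = (Ordinal xn, h).
  exact: (carryX_ord c (Ordinal xn)).
by rewrite E rmulE DiE (nth_map d0) // nth_index // -E -symME mulgV.
Qed.

(** Above the two branch points the loops are [s1 ^+ d] and [s2 ^+ d], whence the divided labels;
    each other point has one lift per sheet, whence d copies of [T]. *)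
Lemma RI_cyclic k1 k2 a b d (T : seq label) : (0 < d)%N ->
  RI ((omul d k1, (d * a)%N) :: (omul d k2, (d * b)%N) :: T)
     ((k1, a) :: (k2, b) :: flatten (nseq d T)).
Proof.
move=> d_gt0; have [n dE] : exists n, d = n.+1 by exists d.-1; rewrite prednK.
set KK := _ :: _ :: T; set LL := _ :: _ :: flatten _.
have /labels_cons[s1 [D1 [eK /labels_cons[s2 [T1 [eD1 T1K]]]]]] := fst_JD KK.
rewrite {}eD1 in eK.
have /labels_cons[t1 [D2 [eL /labels_cons[t2 [D3 [eD2]]]]]] := fst_JD LL.
move=> /labels_blocks[D [eD3 DT]]; rewrite {}eD2 {}eD3 in eL.
have pK := @JD_pow KK; have pL := @JD_pow LL.
have zC := @JD_central KK; have zC' := @JD_central LL.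
set z := lprod (JD KK) in zC; set z' := lprod (JD LL) in zC'.
pose W := lprod T1; pose w x := lprod (D x).
have zE : z = s1 * (s2 * W) by rewrite /z eK !lprod_cons.
have z'E : z' = t1 * (t2 * \prod_(0 <= x < d) w x).
  by rewrite /z' eL !lprod_cons lprod_flatten /index_iota subn0.
have WE : W = s2^-1 * s1^-1 * z by rewrite zE; gsimp.
have s1K : pow_ok k1 (s1 ^+ d).
  by apply/pow_ok_omul; apply: (pK (omul d k1, d * a, s1)%N); rewrite eK mem_head.
have s2K : pow_ok k2 (s2 ^+ d).
  by apply/pow_ok_omul; apply: (pK (omul d k2, d * b, s2)%N); rewrite eK !in_cons eqxx orbT.
have TK t : t \in T1 -> t \in JD KK by rewrite eK !in_cons => ->; rewrite !orbT.
(* Conjugating the copies of [T1] by [s1 ^- x] makes their product telescope to a power of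
   [W * s1 = s2^-1 * z], which cancels the d-th powers of [s1] and [s2]. *)
have [f fE] : exists f : ghom (JJ LL) (JJ KK), fmap f (JD LL) =
    (k1, a, s1 ^+ d) :: (k2, b, s2 ^+ d) ::
    flatten [seq fconj T1 (s1 ^- x) | x <- iota 0 d].
  apply: JJ_hom; last first.
    rewrite /= map_flatten -map_comp; congr [:: _, _ & flatten _].
    rewrite (eq_map (g := fun=> T)); last by move=> x; rewrite /= fst_fconj.
    by elim: (d) 0%N => //= m IHm i; rewrite IHm.
  apply: frame_central => [g|t]; last first.
    rewrite !in_cons => /or3P[/eqP->//|/eqP->//|/mem_blocks[x _]].
    by apply: fconj_pow => u uT; apply/pK/TK.
  rewrite !lprod_cons lprod_flatten.
  under eq_bigr => x _ do rewrite lprod_conj -/W.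
  have := prod_conj_pow W s1 d; rewrite /index_iota subn0 => -> /=.
  suff -> : s1 ^+ d * (s2 ^+ d * ((W * s1) ^+ d / s1 ^+ d)) = z ^+ d.
    exact: commuteX.
  have -> : W * s1 = s2^-1 * z by rewrite WE -!mulgA -zC mulKg.
  rewrite expgMn // expVgn !mulgA mulgK -mulgA.
  rewrite (_ : z ^+ d / s1 ^+ d = s1 ^- d * z ^+ d).
    by rewrite mulgA mulgV mul1g.
  by apply/commuteV/commute_sym/commuteX/zC.
have [ft1 ft2 fD] : [/\ f t1 = s1 ^+ d, f t2 = s2 ^+ d &
    forall x, (x < d)%N -> fmap f (D x) = fconj T1 (s1 ^- x)].
  move: fE; rewrite eL => -[-> ->]; rewrite [fmap f (flatten _)]map_flatten -map_comp => fE.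
  split=> //; apply: eq_blocks fE => x xd.
  by rewrite !size_map; apply: size_fst; rewrite DT.
have fw x : (x < d)%N -> f (w x) = W ^ (s1 ^- x).
  by move=> xd; rewrite /w -lprod_fmap fD // lprod_conj.
have finj : injective f.
  have [G [i [ze [iinj zeC zeE]]]] := central_root zC' d_gt0.
  pose Di (x : 'I_n.+1) := fmap i (D x).
  have DiT x : map fst (Di x) = T by rewrite fst_fmap DT // dE.
  pose S1 := carry n (i t1).
  pose Z : sym ('I_n.+1 * G) := rmul (fun=> ze).
  pose Wp := rmul (fun x : 'I_n.+1 => i (w x)).
  (* Once [S1], [Wp] and [Z] represent [s1], [W] and [z], the product relation forces [s2] to act as
     [rho^-1]. *)
  pose rho := Wp * Z^-1 * S1.
  have ZS1 : commute S1 Z.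
    by apply: mono_commute => x; case: ifP => _; [apply: zeC|apply: commute1].
  have ZWp : commute Wp Z by apply: mono_commute => x; apply: zeC.
  have rhoE x g : rho (x, g) =
      (ordS x, g * i (w x) * ze^-1 * (if x == ord_max then i t1 else 1)).
    by rewrite /rho !symME.
  have rho_ord j y : ((rho ^+ j) y).1 = iter j (@ordS n.+1) y.1.
    elim: j => // j IHj; rewrite expgSr symME iterS -IHj.
    by case: ((rho ^+ j) y) => x g; rewrite rhoE.
  have zeX j h : commute (ze ^- j) (i h).
    by apply/commuteVl/commute_sym/commuteX/commute_sym/zeC.
  have rhoX j g : (j <= n)%N -> (rho ^+ j) (ord0, g) =
      (inord j, g * i (\prod_(0 <= x < j) w x) * ze ^- j).
    elim: j => [|j IHj] jn.
      rewrite expg0 big_nil gmulf1 invg1 !mulg1.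
      by congr pair; apply: val_inj; rewrite /= inordK.
    rewrite expgSr symME IHj ?(ltnW jn) // rhoE ifN; last first.
      by apply/eqP => /(congr1 val); rewrite /= inordK ?(ltnW jn)//; lia.
    congr pair; first by apply: val_inj; rewrite /= !inordK ?modn_small //; lia.
    rewrite mulg1 big_nat_recr //= gmulfM expgS invgM inordK; last by lia.
    by rewrite -!mulgA; congr (_ * (_ * _)); rewrite mulgA zeX !mulgA.
  (* One turn collects all [w x], then [ze ^- d] and [i t1]. Since [ze ^+ d = i z'], the product
     formula [z'E] leaves only the inverse of [t2]; this is where the root is used. *)
  have rho0 g : (rho ^+ d) (ord0, g) = (ord0, g * (i t2)^-1).
    rewrite dE expgSr symME rhoX // rhoE ifT; last first.
      by apply/eqP/val_inj; rewrite /= inordK.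
    congr pair; first by apply: val_inj; rewrite /= inordK // modnn.
    rewrite inordK // -!mulgA; congr (_ * _); rewrite !mulgA.
    rewrite -[_ * i (w n)]mulgA zeX mulgA -homM -big_nat_recr //= -dE.
    rewrite -[_ / ze]mulgA -invgM -expgS -dE zeE -!homV -!homM.
    by congr (i _); rewrite z'E; gsimp.
  have [th thE] : exists th : ghom (JJ KK) (sym ('I_n.+1 * G)), fmap th (JD KK) =
      (omul d k1, (d * a)%N, S1) :: (omul d k2, (d * b)%N, rho^-1) :: stack T Di.
    apply: JJ_hom; last by rewrite /= fst_stack.
    have prodE : S1 * (rho^-1 * lprod (stack T Di)) = Z.
      rewrite lprod_stack // (_ : rmul _ = Wp); last first.
        by congr rmul; apply: funext => x; rewrite lprod_fmap.
      by rewrite /rho; gsimp.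
    move=> t; rewrite !in_cons !lprod_cons /= prodE => /or3P[/eqP->|/eqP->|tT] /=.
    - split=> //; apply/pow_ok_omul; rewrite dE carry_full.
      have /pL : (k1, a, t1) \in JD LL by rewrite eL mem_head.
      case: (k1) => //= m t1m; rewrite rmulX -rmul1; congr rmul.
      by apply: funext => x; rewrite -gmulfXn t1m gmulf1.
    - split; last first.
        apply: commuteVl; apply: commute_sym; do ![apply: commuteM].
        + exact: commute_sym.
        + exact/commuteV/commute_refl.
        + exact: commute_sym.
      have /pL : (k2, b, t2) \in JD LL by rewrite eL !in_cons eqxx orbT.
      case: (k2) => //= m t2m; rewrite expVgn; apply/eqP; rewrite invg_eq1; apply/eqP.
      (* The full turn of [rho] is known on sheet 0 only; [d - x] steps lead there from sheet x. *)
      apply: sym_exp_eq1 => -[x g]; exists (d - x)%N.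
      have := rho_ord (d - x)%N (x, g); case: ((rho ^+ (d - x)) (x, g)) => y h /= ->.
      have -> : iter (d - x) (@ordS n.+1) x = ord0.
        apply: val_inj; rewrite iter_ordS dE subnKC ?modnn //; exact: ltnW.
      have H q : (rho ^+ (d * q)) (ord0, h) = (ord0, h * (i t2) ^- q).
        elim: q => [|q IHq]; first by rewrite muln0 !expg0 invg1 mulg1.
        by rewrite mulnS addnC expgnDr symME IHq rho0 -mulgA -invgM -expgS.
      by rewrite H -gmulfXn t2m gmulf1 invg1 mulg1.
    - have [h [-> hD]] := mem_stack DiT tT; split; last first.
        apply: mono_commute => x; have /mapP[u _ [_ ->]] := hD x; exact: zeC.
      case E: t.1.1 => [m|//] /=; rewrite rmulX -rmul1; congr rmul; apply: funext => x.
      have /mapP[u uD [tu ->]] := hD x; rewrite -gmulfXn.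
      have /pL : u \in JD LL.
        by rewrite eL !in_cons (@blocks_mem _ _ _ x) ?orbT // dE.
      by rewrite -tu E /= => ->; rewrite gmulf1.
  have [th1 th2 thT] : [/\ th s1 = S1, th s2 = rho^-1 & fmap th T1 = stack T Di].
    by move: thE; rewrite eK => -[-> -> ->].
  apply: (cover_inj (x0 := ord0) (th := th) iinj) => t g; rewrite eL !in_cons.
  case/or3P => [/eqP->|/eqP->|] /=.
  - by rewrite ft1 gmulfXn th1 dE carry0.
  - rewrite ft2 gmulfXn th2 expVgn.
    have := rho0 (g * i t2); rewrite mulgK => <-.
    by rewrite -symME mulgV.
  - move=> /mem_blocks[x xd tx]; have xn : (x < n.+1)%N by rewrite -dE.
    apply: (stack_act (xn := xn) g th1 thT) tx => //; last exact: fD.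
    by rewrite -T1K size_map.
have tL1 : (k1, a, t1) \in JD LL by rewrite eL mem_head.
have tL2 : (k2, b, t2) \in JD LL by rewrite eL !in_cons eqxx orbT.
have tLD x t : (x < d)%N -> t \in D x -> t \in JD LL.
  by move=> xd tx; rewrite eL !in_cons (blocks_mem xd tx) !orbT.
have blockP x t : (x < d)%N -> t \in D x ->
    exists2 u, u \in T1 & t.1 = u.1 /\ f t.2 = u.2 ^ (s1 ^- x).
  move=> xd /(mem_fmap f); rewrite fD // => /mapP[u uT [t1u t2u]].
  by exists u.
have blockPV x u : (x < d)%N -> u \in T1 ->
    exists2 t, t \in D x & t.1 = u.1 /\ f t.2 = u.2 ^ (s1 ^- x).
  move=> xd uT; have : (u.1, u.2 ^ (s1 ^- x)) \in fmap f (D x).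
    by rewrite fD // (map_f (fun t => (t.1, t.2 ^ (s1 ^- x)))).
  by move=> /mapP[t tD [-> ->]]; exists t.
apply: (RI_classes finj) => [t|].
  rewrite eL !in_cons => /or3P[/eqP->|/eqP->|/mem_blocks[x xd /(blockP _ _ xd)]] /=.
  - exists (omul d k1, (d * a)%N, s1); first by rewrite eK mem_head.
    by exists 1; rewrite conjg1 gmulfXn ft1 /= expgnA.
  - exists (omul d k2, (d * b)%N, s2); first by rewrite eK !in_cons eqxx orbT.
    by exists 1; rewrite conjg1 gmulfXn ft2 /= expgnA.
  - move=> [u /TK uK [tu1 tu2]]; exists u => //; exists (s1 ^- x).
    by rewrite gmulfXn tu1 tu2 conjXg.
(* [s1^-1] normalizes the image of [f], permuting the classes of reflections. *)
have norm t : t \in JD LL -> exists2 t', t' \in JD LL & t'.1.2 = t.1.2 /\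
    exists h, (f t.2) ^ s1^-1 = f (t'.2 ^ h).
  rewrite {1}eL !in_cons => /or3P[/eqP->|/eqP->|/mem_blocks[x xd tx]] /=.
  - exists (k1, a, t1) => //; split=> //; exists 1; rewrite conjg1 ft1.
    by rewrite conjXg; congr (_ ^+ _); gsimp.
  (* As [s1^-1 = s2 * W * z^-1], conjugation by [s1^-1] acts on powers of [s2] as conjugation by
     [W], and [W = f (w 0)]. *)
  - exists (k2, b, t2) => //; split=> //; exists (w 0%N).
    rewrite gmulfJ fw // ft2 expg0 invg1 conjg1 WE.
    rewrite !conjgM [(s2 ^+ d) ^ s2^-1](_ : _ = s2 ^+ d); last first.
      by rewrite conjXg; congr (_ ^+ _); gsimp.
    by rewrite [RHS]conjgE zC mulKg.
  - have [u uT [tu1 tu2]] := blockP _ _ xd tx.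
    have [xd'|] := ltnP x.+1 d.
      have [t' t'D [tu1' tu2']] := blockPV _ _ xd' uT.
      exists t'; first exact: tLD t'D.
      split; first by rewrite tu1' tu1.
      by exists 1; rewrite conjg1 tu2 tu2' -conjgM -invgM -expgS.
    (* The last sheet wraps around to sheet 0, and the full turn [s1 ^+ d = f t1] is absorbed as a
       conjugation inside the image. *)
    rewrite leq_eqVlt ltnNge xd orbF => /eqP dx.
    have [t' t'D [tu1' tu2']] := blockPV _ _ d_gt0 uT.
    exists t'; first exact: tLD t'D.
    split; first by rewrite tu1' tu1.
    exists t1^-1; rewrite gmulfJ gmulfV ft1 tu2 tu2' expg0 invg1 conjg1.
    by rewrite -conjgM -invgM -expgS dx.
(* [Cls] collects the lifted classes, and [P g] says that conjugation by [g] preserves them. It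
   remains to verify [P] on all of J(K). *)
pose Cls y := exists2 t, t \in JD LL & exists h, y = f ((t.2 ^+ t.1.2) ^ h).
pose P g := forall y, Cls y -> Cls (y ^ g).
have PM g h : P g -> P h -> P (g * h) by move=> Pg Ph y /Pg/Ph; rewrite conjgM.
have Pf h : P (f h).
  move=> _ [t tL [h' ->]]; exists t => //; exists (h' * h).
  by rewrite conjgM [RHS]gmulfJ.
have Pz g : (forall x, commute x g) -> P g.
  by move=> gC y; rewrite conjgE gC mulKg.
have PV : P s1^-1.
  have normH h : exists h', (f h) ^ s1^-1 = f h'.
    move: h; apply: (@JJ_subgroup LL [set h | exists h', (f h) ^ s1^-1 = f h']).
      apply: is_subgroupM => [|h [h' E]|h k [h' E] [k' E']] /=.
      - by exists 1; rewrite !gmulf1 conj1g.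
      - by exists h'^-1; rewrite !gmulfV conjVg E.
      - by exists (h' * k'); rewrite !gmulfM conjMg E E'.
    by move=> t /norm[t' _ [_ [h E]]]; exists (t'.2 ^ h).
  move=> _ [t tL [h ->]]; have [h' hE] := normH h.
  have [t' tL' [tt' [k E]]] := norm _ tL.
  exists t' => //; exists (k * h').
  by rewrite gmulfJ conjJg hE gmulfXn !conjXg E -tt' [RHS]gmulfXn conjgM [in RHS]gmulfJ.
have PX k : P (s1^-1 ^+ k).
  by elim: k => [|k IHk]; [apply: Pz => x; apply: commute1|rewrite expgS; apply: PM].
have P1 : P s1.
  (* [norm] treats [s1^-1] only; its inverse is recovered from [s1 ^+ d = f t1] with d = n + 1. *)
  rewrite (_ : s1 = f t1 * s1^-1 ^+ n); first exact: PM.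
  by rewrite ft1 dE expgS expVgn mulgK.
have Pall g : P g.
  suff : P g /\ P g^-1 by case.
  move: g; apply: (@JJ_subgroup KK [set g | P g /\ P g^-1]).
    apply: is_subgroupM => [|x [Px PVx]|x y [Px PVx] [Py PVy]] /=.
    - by rewrite invg1; split; apply: Pz => x; apply: commute1.
    - by rewrite invgK.
    - by rewrite invgM; split; apply: (PM).
  have WT : W = f (w 0%N) by rewrite fw // expg0 invg1 conjg1.
  move=> t; rewrite eK !in_cons => /or3P[/eqP->//|/eqP->|tT] /=.
    rewrite (_ : s2 = s1^-1 * (z * W^-1)); last by rewrite zE; gsimp.
    have PZV : P z^-1 by apply: Pz => x; exact: commuteV.
    rewrite !invgM !invgK WT -gmulfV; split.
      by apply: (PM) => //; apply: (PM) => //; apply: Pz.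
    by apply: (PM) => //; apply: (PM).
  have [t' t'D [_]] := blockPV _ _ d_gt0 tT; rewrite expg0 invg1 conjg1 => <-.
  by rewrite -gmulfV.
move=> u g uK _; suff : Cls (u.2 ^+ u.1.2) by move=> /(Pall g)[t tL [h E]]; exists t => //; exists h.
move: uK; rewrite eK !in_cons => /or3P[/eqP->|/eqP->|uT] /=.
- by exists (k1, a, t1) => //; exists 1; rewrite conjg1 gmulfXn ft1 expgnA.
- by exists (k2, b, t2) => //; exists 1; rewrite conjg1 gmulfXn ft2 expgnA.
- have [t tD [t1u]] := blockPV _ _ d_gt0 uT; rewrite expg0 invg1 conjg1 => t2u.
  exists t; first exact: tLD tD.
  by exists 1; rewrite conjg1 gmulfXn t1u t2u.
Qed.

(** * The five-sheeted covering of the (2,3,5) orbifold *)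

Definition five_swap (x : 'I_5) : 'I_5 :=
  match val x with
  | 0 => @Ordinal 5 1 isT | 1 => @Ordinal 5 0 isT
  | 2 => @Ordinal 5 3 isT | 3 => @Ordinal 5 2 isT
  | _ => @Ordinal 5 4 isT
  end.

Lemma five_swapK : involutive five_swap.
Proof. by move=> [[|[|[|[|[|]]]]] //= p]; apply: val_inj. Qed.

(** Each cycle of a, b or c on the five sheets contributes at its least sheet x, raised to its
    length and conjugated by [a ^- x]; [W] contributes on every sheet. After [W] is eliminated, the
    rest cancels as in a free group with z central. *)
Lemma five_prod (G : groupType) (a b c W z : G) :
  (forall g, commute g z) -> z = a * (b * (c * W)) ->
  a ^+ 5 * (b ^+ 2 * (c * (W * ((c ^+ 3) ^ a^-1 * (W ^ a^-1 *
    ((b ^+ 2) ^ (a ^- 2) * (c ^ (a ^- 2) * (W ^ (a ^- 2) * (W ^ (a ^- 3) *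
    (b ^ (a ^- 4) * W ^ (a ^- 4))))))))))) = z ^+ 5.
Proof.
move=> zC zE; have -> : W = c^-1 * b^-1 * a^-1 * z by rewrite zE; gsimp.
have zm x g : x * (z * g) = z * (x * g) by rewrite !mulgA zC.
pose zr := (zm a, zm b, zm c, zm a^-1, zm b^-1, zm c^-1,
            zC a, zC b, zC c, zC a^-1, zC b^-1, zC c^-1).
rewrite !expgS !expg0 !mulg1; gsimp.
by do ![rewrite !zr | gsimp].
Qed.

Lemma right_mul_pow (X : Type) (G : groupType) (s : sym (X * G)) k m x u :
  (forall g, (s ^+ k) (x, g) = (x, g * u)) -> u ^+ m = 1 ->
  forall g, (s ^+ (k * m)) (x, g) = (x, g).
Proof.
move=> H um g; suff -> : (s ^+ (k * m)) (x, g) = (x, g * u ^+ m) by rewrite um mulg1.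
elim: m {um} => [|m IHm]; first by rewrite muln0 !expg0 mulg1.
by rewrite mulnS addnC expgnDr symME IHm H -mulgA -expgSr.
Qed.

Lemma right_mul_inv (X : Type) (G : groupType) (s : sym (X * G)) x u :
  (forall g, s (x, g) = (x, g * u^-1)) -> forall g, s^-1 (x, g) = (x, g * u).
Proof.
by move=> H g; have := H (g * u); rewrite mulgK => <-; rewrite -symME mulgV.
Qed.

(* The five-sheeted cover of the (2,3,5) orbifold given by the action of A_5 on
   five points, where [a] is the cycle (0 1 2 3 4), [b] is (0 1)(2 3) and [c] is
   (1 4 3); the blocks T of the cover are indexed by the sheets. *)
Lemma RI_five ka kb kc (T : seq label) :
  RI ((omul 5 ka, 5%N) :: (omul 2 kb, 2%N) :: (omul 3 kc, 3%N) :: T)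
     ((ka, 1%N) :: (kb, 1%N) :: (omul 3 kc, 3%N) :: T ++ (kc, 1%N) :: T ++
      (kb, 1%N) :: (omul 3 kc, 3%N) :: T ++ T ++ (omul 2 kb, 2%N) :: T).
Proof.
set KK := _ :: _ :: _ :: T; set LL := _ :: _ :: _ :: (T ++ _).
have /labels_cons[a [E [eK /labels_cons[b [F [eE]]]]]] := fst_JD KK.
move=> /labels_cons[c [T1 [eF T1K]]]; rewrite {}eE {}eF {E F} in eK.
have /labels_cons[ta [E1 [eL /labels_cons[tb0 [E2 [eE1]]]]]] := fst_JD LL.
rewrite {}eE1 {E1} in eL.
move=> /labels_cons[tc0 [E1 [eE2]]]; rewrite {}eE2 {E2} in eL.
move=> /labels_cat[D0 [E2 [eE1 D0T]]]; rewrite {}eE1 {E1} in eL.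
move=> /labels_cons[tc1 [E1 [eE2]]]; rewrite {}eE2 {E2} in eL.
move=> /labels_cat[D1 [E2 [eE1 D1T]]]; rewrite {}eE1 {E1} in eL.
move=> /labels_cons[tb2 [E1 [eE2]]]; rewrite {}eE2 {E2} in eL.
move=> /labels_cons[tc2 [E2 [eE1]]]; rewrite {}eE1 {E1} in eL.
move=> /labels_cat[D2 [E1 [eE2 D2T]]]; rewrite {}eE2 {E2} in eL.
move=> /labels_cat[D3 [E2 [eE1 D3T]]]; rewrite {}eE1 {E1} in eL.
move=> /labels_cons[tb4 [D4 [eE2 D4T]]]; rewrite {}eE2 {E2} in eL.
have pK := @JD_pow KK; have pL := @JD_pow LL.
have zC := @JD_central KK; have zC' := @JD_central LL.
set z := lprod (JD KK) in zC; set z' := lprod (JD LL) in zC'.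
pose W := lprod T1.
have zE : z = a * (b * (c * W)) by rewrite /z eK !lprod_cons.
have [aK bK cK] : [/\ (omul 5 ka, 5%N, a) \in JD KK, (omul 2 kb, 2%N, b) \in JD KK
    & (omul 3 kc, 3%N, c) \in JD KK].
  by rewrite eK !in_cons !eqxx !orbT.
have TK t : t \in T1 -> t \in JD KK by rewrite eK !in_cons => ->; rewrite !orbT.
pose DF : seq (label * JJ KK) :=
  (ka, 1%N, a ^+ 5) :: (kb, 1%N, b ^+ 2) :: (omul 3 kc, 3%N, c) :: T1 ++
  (kc, 1%N, (c ^+ 3) ^ a^-1) :: fconj T1 a^-1 ++
  (kb, 1%N, (b ^+ 2) ^ (a ^- 2)) :: (omul 3 kc, 3%N, c ^ (a ^- 2)) ::
  fconj T1 (a ^- 2) ++ fconj T1 (a ^- 3) ++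
  (omul 2 kb, 2%N, b ^ (a ^- 4)) :: fconj T1 (a ^- 4).
have [f fE] : exists f : ghom (JJ LL) (JJ KK), fmap f (JD LL) = DF.
  apply: JJ_hom; last first.
    by rewrite /DF !(map_cons, map_cat) !fst_fconj T1K.
  have pT : forall t, t \in T1 -> pow_ok t.1.1 t.2 by move=> t /TK/pK.
  apply: frame_central => [g|t].
    rewrite !(lprod_cons, lprod_cat) !lprod_conj /= -/W.
    by rewrite (five_prod zC zE); apply: commuteX.
  have pTc g : t \in fconj T1 g -> pow_ok t.1.1 t.2 by apply: fconj_pow.
  have a5 := pK _ aK; have b2 := pK _ bK; have c3 := pK _ cK.
  rewrite !(in_cons, mem_cat).
  do ![case/orP; first by [move=> /eqP-> /=; rewrite -?conjXg; try apply: pow_ok_conj;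
        rewrite //; apply/pow_ok_omul | apply: pT | apply: pTc]].
  exact: pTc.
have sD (G H : groupType) (A : seq (label * G)) (B : seq (label * H)) :
    map fst A = T -> map fst B = T -> size A = size B.
  by move=> AT BT; apply: size_fst; rewrite AT.
pose fm := fmap f; have sfm A : size (fm A) = size A by rewrite size_map.
have sfc A g : size (fconj A g : seq (label * JJ KK)) = size A by rewrite size_map.
move: fE; rewrite eL /fmap !(map_cons, map_cat) -!/(fmap f _) -!/(fm _) /=.
case=> fta ftb0 ftc0 /eqP; rewrite eqseq_cat ?sfm; last exact: sD.
move=> /andP[/eqP fD0 /eqP[ftc1 /eqP]]; rewrite eqseq_cat ?sfm ?sfc; last exact: sD.
move=> /andP[/eqP fD1 /eqP[ftb2 ftc2 /eqP]]; rewrite eqseq_cat ?sfm ?sfc; last exact: sD.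
move=> /andP[/eqP fD2 /eqP/eqP]; rewrite eqseq_cat ?sfm ?sfc; last exact: sD.
move=> /andP[/eqP fD3 /eqP[ftb4 fD4]].
pose D x := nth [::] [:: D0; D1; D2; D3; D4] x.
have DT x : (x < 5)%N -> map fst (D x) = T by case: x => [|[|[|[|[|]]]]].
have fD x : (x < 5)%N -> fmap f (D x) = fconj T1 (a ^- x).
  case: x => [|[|[|[|[|]]]]] //= _; rewrite /D /= -/(fm _).
  by rewrite fD0 expg0 invg1 /fconj -[LHS]map_id; apply: eq_map => -[l x]; rewrite conjg1.
pose w x := lprod (D x).
have fw x : (x < 5)%N -> f (w x) = W ^ (a ^- x).
  by move=> x5; rewrite /w -lprod_fmap fD // lprod_conj.
have [taL tb0L tc0L tc1L] : [/\ (ka, 1%N, ta) \in JD LL, (kb, 1%N, tb0) \in JD LL,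
    (omul 3 kc, 3%N, tc0) \in JD LL & (kc, 1%N, tc1) \in JD LL].
  by rewrite eL !(in_cons, mem_cat) !eqxx !orbT.
have [tb2L tc2L tb4L] : [/\ (kb, 1%N, tb2) \in JD LL, (omul 3 kc, 3%N, tc2) \in JD LL &
    (omul 2 kb, 2%N, tb4) \in JD LL].
  by rewrite eL !(in_cons, mem_cat) !eqxx !orbT.
have DL x t : (x < 5)%N -> t \in D x -> t \in JD LL.
  rewrite eL !(in_cons, mem_cat).
  by case: x => [|[|[|[|[|]]]]] //= _ tx; rewrite /D /= in tx; rewrite tx !orbT.
have LLP t : t \in JD LL ->
    t \in [:: (ka, 1%N, ta); (kb, 1%N, tb0); (omul 3 kc, 3%N, tc0); (kc, 1%N, tc1);
      (kb, 1%N, tb2); (omul 3 kc, 3%N, tc2); (omul 2 kb, 2%N, tb4)] \/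
    exists2 x, (x < 5)%N & t \in D x.
  rewrite eL !(in_cons, mem_cat).
  case/orP => [->|]; first by left; rewrite ?orbT.
  case/orP => [->|]; first by left; rewrite ?orbT.
  case/orP => [->|]; first by left; rewrite ?orbT.
  case/orP => [tD|]; first by right; exists 0%N.
  case/orP => [->|]; first by left; rewrite ?orbT.
  case/orP => [tD|]; first by right; exists 1%N.
  case/orP => [->|]; first by left; rewrite ?orbT.
  case/orP => [->|]; first by left; rewrite ?orbT.
  case/orP => [tD|]; first by right; exists 2%N.
  case/orP => [tD|]; first by right; exists 3%N.
  case/orP => [->|]; first by left; rewrite ?orbT.
  by move=> tD; right; exists 4%N.
have finj : injective f.
  have [G [i [ze [iinj zeC zeE]]]] := central_root zC' (isT : (0 < 5)%N).
  pose Di (x : 'I_5) := fmap i (D x).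
  have DiT x : map fst (Di x) = T by rewrite fst_fmap DT.
  pose Sa := carry 4 (i ta).
  pose hb (x : 'I_5) : G := match val x with
    | 0 => i (tb0 * tc0 * w 0%N) * ze^-1 | 1 => i (w 0%N)^-1 * i tc0^-1 * ze
    | 2 => i (tb2 * tc2 * w 2%N) * ze^-1 | 3 => i (w 2%N)^-1 * i tc2^-1 * ze
    | _ => i tb4 end.
  pose Sb := mono five_swapK five_swapK hb.
  pose Z : sym ('I_5 * G) := rmul (fun=> ze).
  pose Wp := rmul (fun x : 'I_5 => i (w x)).
  have [rho rhoD] : exists rho, rho = Wp * Z^-1 * Sa * Sb by eexists.
  have zi h g : ze^-1 * (i h * g) = i h * (ze^-1 * g).
    by rewrite !mulgA; congr (_ * _); apply: commuteVl.
  have ziV h g : ze^-1 * ((i h)^-1 * g) = (i h)^-1 * (ze^-1 * g) by rewrite -homV zi.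
  pose o k (k5 : (k < 5)%N) := Ordinal k5.
  have rhoE x g : rho (x, g) = (five_swap (ordS x), g * i (w x) * ze^-1 *
      (if x == ord_max then i ta else 1) * hb (ordS x)) by rewrite rhoD !symME.
  have r0 g : rho (o 0%N isT, g) = (o 0%N isT, g * (i tc0)^-1).
    rewrite rhoE /hb /=; congr pair.
    by rewrite !homV; gsimp; rewrite !ziV mulVg; gsimp.
  have r2 g : rho (o 2%N isT, g) = (o 2%N isT, g * (i tc2)^-1).
    rewrite rhoE /hb /=; congr pair.
    by rewrite !homV; gsimp; rewrite !ziV mulVg; gsimp.
  have r1 g : rho (o 1%N isT, g) =
      (o 3%N isT, g * i (w 1%N) * ze^-1 * (i (tb2 * tc2 * w 2%N) * ze^-1)).
    by rewrite rhoE /hb /=; rewrite mulg1.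
  have r3 g : rho (o 3%N isT, g) = (o 4%N isT, g * i (w 3%N) * ze^-1 * i tb4).
    by rewrite rhoE /hb /=; rewrite mulg1.
  have r4 g : rho (o 4%N isT, g) =
      (o 1%N isT, g * i (w 4%N) * ze^-1 * i ta * (i (tb0 * tc0 * w 0%N) * ze^-1)).
    by rewrite rhoE /hb /=.
  have z'E : z' = ta * (tb0 * (tc0 * (w 0%N * (tc1 * (w 1%N * (tb2 * (tc2 * (w 2%N *
      (w 3%N * (tb4 * w 4%N)))))))))).
    by rewrite /z' eL !(lprod_cons, lprod_cat).
  have rho3 g : (rho ^+ 3) (o 1%N isT, g) = (o 1%N isT, g * (i tc1)^-1).
    rewrite !expgS expg0 mulg1 !symME r1 r3 r4; congr pair.
    rewrite -!mulgA !zi; congr (_ * _); rewrite !mulgA -!homM -!mulgA.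
    have -> : ze^-1 * (ze^-1 * (ze^-1 * (ze^-1 * ze^-1))) = i z'^-1.
      by rewrite homV -zeE -expVgn.
    rewrite -homM -homV; congr (i _).
    set v := ta * (tb0 * (tc0 * w 0%N)).
    have tc1E : tc1 * (w 1%N * (tb2 * (tc2 * (w 2%N * (w 3%N * (tb4 * (w 4%N * v))))))) = z'.
      apply: (mulgI v); rewrite (zC' v); rewrite [in RHS]z'E /v.
      by gsimp.
    by rewrite -tc1E /v; gsimp.
  have Sb0 g : (Sb ^+ 2) (o 0%N isT, g) = (o 0%N isT, g * i tb0).
    rewrite expg2 symME /Sb /= /mono_fun /hb /=; congr pair.
    by rewrite -!mulgA !zi mulVg mulg1 -!homM; congr (_ * i _); gsimp.
  have Sb2 g : (Sb ^+ 2) (o 2%N isT, g) = (o 2%N isT, g * i tb2).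
    rewrite expg2 symME /Sb /= /mono_fun /hb /=; congr pair.
    by rewrite -!mulgA !zi mulVg mulg1 -!homM; congr (_ * i _); gsimp.
  have Sb4 g : Sb (o 4%N isT, g) = (o 4%N isT, g * i tb4) by [].
  have Sb1 g : exists h, Sb (o 1%N isT, g) = (o 0%N isT, h) by eexists.
  have Sb3 g : exists h, Sb (o 3%N isT, g) = (o 2%N isT, h) by eexists.
  have ipow k l x : ((k, l), x) \in JD LL -> forall m, k = Some m -> (i x) ^+ m = 1.
    by move=> /pL + m km; rewrite km /= -gmulfXn => ->; rewrite gmulf1.
  have five_case (Q : 'I_5 -> Prop) : Q (o 0%N isT) -> Q (o 1%N isT) -> Q (o 2%N isT) ->
      Q (o 3%N isT) -> Q (o 4%N isT) -> forall x, Q x.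
    move=> Q0 Q1 Q2 Q3 Q4 [[|[|[|[|[|//]]]]] p]; [move: Q0|move: Q1|move: Q2|move: Q3|move: Q4];
    by congr (Q _); apply: val_inj.
  have [th thE] : exists th : ghom (JJ KK) (sym ('I_5 * G)), fmap th (JD KK) =
      (omul 5 ka, 5%N, Sa) :: (omul 2 kb, 2%N, Sb) :: (omul 3 kc, 3%N, rho^-1) :: stack T Di.
    apply: JJ_hom; last by rewrite /= fst_stack.
    have ZSa : commute Sa Z.
      by apply: mono_commute => x; case: ifP => _; [apply: zeC|apply: commute1].
    have ZSb : commute Sb Z.
      apply: mono_commute; apply: five_case; rewrite /hb /=;
      by do ?[apply: commuteM]; rewrite -?homV; first [exact: zeC | exact: commuteV | exact: commute_refl].
    have ZWp : commute Wp Z by apply: mono_commute => x; apply: zeC.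
    have prodE : Sa * (Sb * (rho^-1 * lprod (stack T Di))) = Z.
      rewrite lprod_stack // (_ : rmul _ = Wp); last first.
        by congr rmul; apply: funext => x; rewrite lprod_fmap.
      by rewrite rhoD; gsimp.
    move=> t; rewrite !in_cons !lprod_cons /= prodE => /or4P[/eqP->|/eqP->|/eqP->|tT] /=.
    - split=> //; apply/pow_ok_omul; rewrite carry_full.
      case E: ka taL => [m|//] /ipow/(_ m erefl) /= tam.
      by rewrite rmulX -rmul1; congr rmul; apply: funext => x.
    - split=> //; case E: kb (tb0L) (tb2L) (tb4L) => [m|//].
      move=> /ipow/(_ m erefl) p0 /ipow/(_ m erefl) p2 /ipow/(_ (2 * m)%N erefl) p4 /=.
      apply: sym_exp_eq1 => -[x g]; move: x g; apply: five_case => g.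
      + by exists 0%N; apply: (right_mul_pow Sb0 p0).
      + by exists 1%N; rewrite expg1; have [h ->] := Sb1 g; apply: (right_mul_pow Sb0 p0).
      + by exists 0%N; apply: (right_mul_pow Sb2 p2).
      + by exists 1%N; rewrite expg1; have [h ->] := Sb3 g; apply: (right_mul_pow Sb2 p2).
      + exists 0%N; rewrite -[(2 * m)%N]mul1n; exact: (@right_mul_pow _ _ Sb 1 _ _ _ Sb4 p4).
    - split; last first.
        apply: commuteVl; rewrite rhoD; apply: commute_sym; do ![apply: commuteM].
        + exact: commute_sym.
        + exact/commuteV/commute_refl.
        + exact: commute_sym.
        + exact: commute_sym.
      case E: kc (tc0L) (tc1L) (tc2L) => [m|//].
      move=> /ipow/(_ (3 * m)%N erefl) p0 /ipow/(_ m erefl) p1 /ipow/(_ (3 * m)%N erefl) p2 /=.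
      rewrite expVgn; apply/eqP; rewrite invg_eq1; apply/eqP.
      apply: sym_exp_eq1 => -[x g]; move: x g; apply: five_case => g.
      + exists 0%N; rewrite -[(3 * m)%N]mul1n; apply: (@right_mul_pow _ _ rho 1 _ _ _ r0).
        by rewrite expVgn p0 invg1.
      + exists 0%N; apply: (right_mul_pow rho3).
        by rewrite expVgn p1 invg1.
      + exists 0%N; rewrite -[(3 * m)%N]mul1n; apply: (@right_mul_pow _ _ rho 1 _ _ _ r2).
        by rewrite expVgn p2 invg1.
      + exists 2%N; rewrite expg2 !symME r3 r4; apply: (right_mul_pow rho3).
        by rewrite expVgn p1 invg1.
      + exists 1%N; rewrite expg1 r4; apply: (right_mul_pow rho3).
        by rewrite expVgn p1 invg1.
    - have [h [-> hD]] := mem_stack DiT tT; split; last first.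
        apply: mono_commute => x; have /mapP[u _ [_ ->]] := hD x; exact: zeC.
      case E: t.1.1 => [m|//] /=; rewrite rmulX -rmul1; congr rmul; apply: funext => x.
      have /mapP[u uD [tu ->]] := hD x; rewrite -gmulfXn.
      have /pL : u \in JD LL by apply: DL uD.
      by rewrite -tu E /= => ->; rewrite gmulf1.
  have [tha thb thc thT] : [/\ th a = Sa, th b = Sb, th c = rho^-1 & fmap th T1 = stack T Di].
    by move: thE; rewrite eK => -[-> -> -> ->].
  have Ex x (x5 : (x < 5)%N) h : (Sa ^+ x) (ord0, h) = (o x x5, h).
    exact: (carryX_ord (i ta) (o x x5)).
  have thJ u x (x5 : (x < 5)%N) v : (forall g, th u (o x x5, g) = (o x x5, g * v)) ->
      forall g, th (u ^ (a ^- x)) (ord0, g) = (ord0, g * v).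
    move=> H g; rewrite gmulfJ gmulfV gmulfXn tha conjgE invgK !symME.
    by rewrite (Ex x x5) H -(Ex x x5) -symME mulgV.
  apply: (cover_inj (x0 := ord0) (th := th) iinj) => t g /LLP[|[x x5 tx]]; last first.
    apply: (stack_act (xn := x5) g tha thT) tx => //; last exact: fD.
    by rewrite -T1K size_map.
  have E0 : ord0 = o 0%N isT by exact: val_inj.
  rewrite !in_cons in_nil orbF.
  case/orP => [/eqP->/=|]; first by rewrite fta gmulfXn tha carry0.
  case/orP => [/eqP->/=|]; first by rewrite ftb0 gmulfXn thb E0 Sb0.
  case/orP => [/eqP->/=|]; first by rewrite ftc0 thc E0 (right_mul_inv r0).
  case/orP => [/eqP->/=|].
    rewrite ftc1; apply: (thJ _ 1%N isT) => h.
    by rewrite gmulfXn thc expVgn (right_mul_inv rho3).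
  case/orP => [/eqP->/=|].
    by rewrite ftb2; apply: (thJ _ 2 isT) => h; rewrite gmulfXn thb Sb2.
  case/orP => [/eqP->/=|/eqP->/=].
    by rewrite ftc2; apply: (thJ _ 2 isT) => h; rewrite thc (right_mul_inv r2).
  by rewrite ftb4; apply: (thJ _ 4 isT) => h; rewrite thb Sb4.
have blockP x t : (x < 5)%N -> t \in D x ->
    exists2 u, u \in T1 & t.1 = u.1 /\ f t.2 = u.2 ^ (a ^- x).
  move=> x5 /(mem_fmap f); rewrite fD // => /mapP[u uT [t1u t2u]].
  by exists u.
have blockPV x u : (x < 5)%N -> u \in T1 ->
    exists2 t, t \in D x & t.1 = u.1 /\ f t.2 = u.2 ^ (a ^- x).
  move=> x5 uT; have : (u.1, u.2 ^ (a ^- x)) \in fmap f (D x).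
    by rewrite fD // (map_f (fun t => (t.1, t.2 ^ (a ^- x)))).
  by move=> /mapP[t tD [-> ->]]; exists t.
apply: (RI_classes finj) => [t /LLP[|[x x5 /(blockP _ _ x5)[u uT [tu1 tu2]]]]|].
- rewrite !in_cons in_nil orbF.
  do 6?[case/orP]; move=> /eqP-> /=; rewrite gmulfXn.
  + by exists (omul 5 ka, 5%N, a) => //; exists 1; rewrite conjg1 fta.
  + by exists (omul 2 kb, 2%N, b) => //; exists 1; rewrite conjg1 ftb0.
  + by exists (omul 3 kc, 3%N, c) => //; exists 1; rewrite conjg1 ftc0.
  + by exists (omul 3 kc, 3%N, c) => //; exists a^-1; rewrite ftc1.
  + by exists (omul 2 kb, 2%N, b) => //; exists (a ^- 2); rewrite ftb2.
  + by exists (omul 3 kc, 3%N, c) => //; exists (a ^- 2); rewrite ftc2 conjXg.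
  + by exists (omul 2 kb, 2%N, b) => //; exists (a ^- 4); rewrite ftb4 conjXg.
- exists u; first exact: TK.
  by exists (a ^- x); rewrite gmulfXn tu1 tu2 conjXg.
(* [s] sends the coset of the sheet [x] to that of the sheet [x']. *)
pose moves s x x' := exists y h, (forall g, commute g y) /\
  s * a ^- x = a ^- x' * (y * f h).
have mv1 x : moves 1 x x.
  by exists 1, 1; split=> [g|]; [apply: commute1|rewrite gmulf1 !mulg1 mul1g].
have mvz x : moves z x x by exists z, 1; split=> //; rewrite gmulf1 mulg1 -zC.
have mvM s s' x x' x'' : moves s' x x' -> moves s x' x'' -> moves (s * s') x x''.
  move=> [y [h [yC E]]] [y' [h' [yC' E']]]; exists (y' * y), (h' * h); split.
    by move=> g; apply: commuteM.
  by rewrite -mulgA E mulgA E' -!mulgA gmulfM; congr (_ * (_ * _)); rewrite !mulgA yC.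
have mvV s x x' : moves s x x' -> moves s^-1 x' x.
  move=> [y [h [yC E]]]; exists y^-1, h^-1; split; first by move=> g; apply: commuteV.
  apply: (mulgI s); rewrite mulVKg mulgA E gmulfV.
  by rewrite -(commuteV (yC (f h)^-1)); gsimp.
have mvf x s h : s ^ (a ^- x) = f h -> moves s x x.
  move=> E; exists 1, h; split=> [g|]; first exact: commute1.
  by rewrite mul1g -E conjgE invgK; gsimp.
have mva x : (x < 4)%N -> moves a^-1 x x.+1.
  move=> _; exists 1, 1; split=> [g|]; first exact: commute1.
  by rewrite gmulf1 !mulg1 expgSr invgM.
have mva4 : moves a^-1 4%N 0%N.
  exists 1, ta^-1; split=> [g|]; first exact: commute1.
  by rewrite gmulfV fta expg0 invg1 !mul1g -invgM -expgSr.
have mvW x : (x < 5)%N -> moves W x x by move=> x5; apply: (mvf x _ (w x)); rewrite fw.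
have mvt t x : t \in T1 -> (x < 5)%N -> moves t.2 x x.
  by move=> tT x5; have [u _ [_ E]] := blockPV _ _ x5 tT; apply: mvf (esym E).
(* Where c fixes a sheet, so does [a * b], which is [(c * W)^-1] up to z; hence b moves that sheet
   as [a^-1] does. *)
have mvab x h : (x < 5)%N -> c ^ (a ^- x) = f h -> moves (a * b) x x.
  move=> x5 E; rewrite (_ : a * b = z * (W^-1 * c^-1)); last by rewrite zE; gsimp.
  apply: (mvM _ _ _ _ _ _ (mvz x)); apply: (mvM _ _ x x); last exact/mvV/mvW.
  by apply: mvV; apply: mvf E.
have mvb0 : moves b 0%N 1%N.
  rewrite -[b](mulKg a); apply: (mvM _ _ _ _ _ _ (mva 0%N isT)); apply: (mvab 0%N tc0 isT).
  by rewrite expg0 invg1 conjg1.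
have mvb2 : moves b 2%N 3%N.
  by rewrite -[b](mulKg a); apply: (mvM _ _ _ _ _ _ (mva 2%N isT)); apply: (mvab 2 tc2 isT).
have mvbb : b = b ^+ 2 * b^-1 by rewrite expg2 mulgK.
have mvb1 : moves b 1%N 0%N.
  rewrite mvbb; apply: (mvM _ _ 1%N 0%N); first exact: mvV.
  by apply: (mvf _ _ tb0); rewrite expg0 invg1 conjg1.
have mvb3 : moves b 3%N 2%N.
  by rewrite mvbb; apply: (mvM _ _ 3 2)%N; [apply: mvV | apply: (mvf _ _ tb2)].
have mvb4 : moves b 4%N 4%N by apply: (mvf _ _ tb4).
have cE : c = b^-1 * (a^-1 * (z * W^-1)) by rewrite zE; gsimp.
have mvzW x : (x < 5)%N -> moves (z * W^-1) x x.
  by move=> x5; apply: (mvM _ _ _ _ _ _ (mvz x)); apply: (mvV); apply: (mvW).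
have mvc3 : moves c 3%N 4%N.
  rewrite cE; apply: (mvM _ _ 3 4)%N; last exact: mvV.
  by apply: (mvM _ _ 3 3)%N; [apply: mvzW | apply: mva].
have mvc4 : moves c 4%N 1%N.
  rewrite cE; apply: (mvM _ _ 4 0)%N; last exact: mvV.
  by apply: (mvM _ _ 4 4)%N; [apply: mvzW | ].
pose E s := forall x, (x < 5)%N -> exists2 x', (x' < 5)%N & moves s x x'.
have EM s s' : E s -> E s' -> E (s * s').
  move=> Es Es' x /Es'[x' x5' H']; have [x'' x5'' H''] := Es _ x5'.
  by exists x'' => //; apply: mvM H' H''.
have Ebb : E b /\ E b^-1.
  split=> -[|[|[|[|[|//]]]]] _.
  - by exists 1%N. - by exists 0%N. - by exists 3%N. - by exists 2%N. - by exists 4%N.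
  - by exists 1%N => //; apply: mvV. - by exists 0%N => //; apply: mvV.
  - by exists 3%N => //; apply: mvV. - by exists 2%N => //; apply: mvV.
  - by exists 4%N => //; apply: mvV.
have Eaa : E a /\ E a^-1.
  split=> -[|[|[|[|[|//]]]]] _.
  - by exists 4%N => //; rewrite -[a]invgK; apply: mvV.
  - by exists 0%N => //; rewrite -[a]invgK; apply/mvV/mva.
  - by exists 1%N => //; rewrite -[a]invgK; apply/mvV/mva.
  - by exists 2%N => //; rewrite -[a]invgK; apply/mvV/mva.
  - by exists 3%N => //; rewrite -[a]invgK; apply/mvV/mva.
  - by exists 1%N => //; apply: mva.
  - by exists 2%N => //; apply: mva.
  - by exists 3%N => //; apply: mva.
  - by exists 4%N => //; apply: mva.
  - by exists 0%N.
have Efix s : (forall x, (x < 5)%N -> moves s x x) -> E s /\ E s^-1.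
  by move=> H; split=> x x5; exists x => //; [|apply: mvV]; apply: H.
have Eall g : E g.
  suff : E g /\ E g^-1 by case.
  move: g; apply: (@JJ_subgroup KK [set g | E g /\ E g^-1]).
    apply: is_subgroupM => [|x [Ex EVx]|x y [Ex EVx] [Ey EVy]] /=.
    - exact: Efix.
    - by rewrite invgK.
    - by rewrite invgM; split; apply: (EM).
  move=> t; rewrite eK !in_cons => /or4P[/eqP->//|/eqP->//|/eqP->|tT] /=; last first.
    by apply: Efix => x x5; apply: mvt.
  have [EzW EzWV] : E (z * W^-1) /\ E (z * W^-1)^-1 by apply: Efix => x; apply: mvzW.
  have [Ea EaV] := Eaa; have [Eb EbV] := Ebb.
  rewrite cE; split; first by do 2?[apply: (EM)].
  by rewrite [(b^-1 * _)^-1]invgM [(a^-1 * _)^-1]invgM !invgK; do 2?[apply: (EM)].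
pose Cls y := exists2 t, t \in JD LL & exists h, y = f ((t.2 ^+ t.1.2) ^ h).
have ClsJ y h : Cls y -> Cls (y ^ f h).
  move=> [t tL [k ->]]; exists t => //; exists (k * h).
  by rewrite conjgM [RHS]gmulfJ.
(* Since [b ^+ 2] commutes with b and [c ^+ 3] with c, one lift per cycle of b or c accounts for all
   sheets of that cycle. *)
have Cmv y s x x' : commute y s -> moves s x x' -> Cls (y ^ (a ^- x')) -> Cls (y ^ (a ^- x)).
  move=> ys [r [h [rC E']]] /(ClsJ _ h).
  suff -> : y ^ (a ^- x) = (y ^ (a ^- x')) ^ f h by [].
  have sy : y ^ s = y by rewrite conjgE ys mulKg.
  rewrite -[in LHS]sy -conjgM E' mulgA !conjgM; congr (_ ^ _).
  by rewrite [LHS]conjgE rC mulKg.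
suff H u x : u \in JD KK -> (x < 5)%N -> Cls ((u.2 ^+ u.1.2) ^ (a ^- x)).
  move=> u g uK _; have [x x5 [y [h [yC]]]] := Eall g 0%N isT.
  rewrite expg0 invg1 mulg1 => ->.
  have /(ClsJ _ h)[t tL [k Ek]] := H u x uK x5; exists t => //; exists k; rewrite -Ek.
  by rewrite !conjgM; congr (_ ^ _); rewrite [LHS]conjgE yC mulKg.
have [a5 b2 c3] : [/\ commute (a ^+ 5) a, commute (b ^+ 2) b & commute (c ^+ 3) c].
  by split; apply/commute_sym/commuteX/commute_refl.
have C0 y : Cls y -> Cls (y ^ (a ^- 0%N)) by rewrite expg0 invg1 conjg1.
rewrite eK !in_cons => /or4P[/eqP->|/eqP->|/eqP->|uT] /=; last 1 first.
- move=> x5; have [t tD [t1u t2u]] := blockPV _ _ x5 uT.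
  exists t; first exact: DL tD.
  by exists 1; rewrite conjg1 gmulfXn t1u t2u conjXg.
- move=> _; rewrite conjgE invgK mulgA -expgnDr addnC expgnDr mulgK.
  by exists (ka, 1%N, ta) => //; exists 1; rewrite conjg1 fta.
- have Cb0 : Cls (b ^+ 2 ^ a ^- 0).
    by apply: C0; exists (kb, 1%N, tb0) => //; exists 1; rewrite conjg1 ftb0.
  have Cb2 : Cls (b ^+ 2 ^ a ^- 2).
    by exists (kb, 1%N, tb2) => //; exists 1; rewrite conjg1 ftb2.
  case: x => [|[|[|[|[|//]]]]] _ //; first exact: Cmv b2 mvb1 Cb0.
    exact: Cmv b2 mvb3 Cb2.
  by exists (omul 2 kb, 2%N, tb4) => //; exists 1; rewrite conjg1 gmulfXn ftb4 conjXg.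
- have Cc1 : Cls (c ^+ 3 ^ a ^- 1).
    by exists (kc, 1%N, tc1) => //; exists 1; rewrite conjg1 ftc1.
  have Cc4 : Cls (c ^+ 3 ^ a ^- 4) by exact: Cmv c3 mvc4 Cc1.
  case: x => [|[|[|[|[|//]]]]] _ //.
  - by apply: C0; exists (omul 3 kc, 3%N, tc0) => //; exists 1; rewrite conjg1 gmulfXn ftc0.
  - by exists (omul 3 kc, 3%N, tc2) => //; exists 1; rewrite conjg1 gmulfXn ftc2 conjXg.
  - exact: Cmv c3 mvc3 Cc4.
Qed.

(** * Exact orders in polygon groups *)

Import GRing.Theory Num.Theory.
Local Open Scope ring_scope.

Section ConjugationAction.
Variable R : unitRingType.
Implicit Types A B : R.

Lemma conj_symK A : A \is a GRing.unit ->
  cancel (fun B => A^-1 * B * A) (fun B => A * B * A^-1).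
Proof. by move=> uA B; rewrite -[A^-1 * B * A]mulrA mulVKr // mulrK. Qed.

Lemma conj_symVK A : A \is a GRing.unit ->
  cancel (fun B => A * B * A^-1) (fun B => A^-1 * B * A).
Proof. by move=> uA B; rewrite -[A * B * _]mulrA mulKr // divrK. Qed.

(** Inner automorphisms of the matrix ring model PGL_2, because scalar matrices act trivially.
    Non-units are sent to 1 to make the map total. *)
Definition conj_sym A : sym R :=
  if @idP (A \is a GRing.unit) is ReflectT uA
  then Sym (conj_symK uA) (conj_symVK uA) else 1%g.

Lemma conj_symE A B : A \is a GRing.unit -> conj_sym A B = A^-1 * B * A.
Proof. by move=> uA; rewrite /conj_sym; case: {-}_ / idP. Qed.

Lemma conj_symM A B : A \is a GRing.unit -> B \is a GRing.unit ->
  (conj_sym A * conj_sym B)%g = conj_sym (A * B).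
Proof.
move=> uA uB; apply: symP => C; rewrite symME !conj_symE ?unitrMl //.
by rewrite invrM // !mulrA.
Qed.

Lemma conj_symX A n : A \is a GRing.unit -> (conj_sym A ^+ n)%g = conj_sym (A ^+ n).
Proof.
move=> uA; elim: n => [|n IHn].
  by apply: symP => B; rewrite conj_symE ?expr0 ?unitr1 // invr1 mul1r mulr1.
by rewrite expgS IHn conj_symM ?unitrX // exprS.
Qed.

Lemma conj_sym_eq1 A : A \is a GRing.unit ->
  (conj_sym A = 1%g) <-> (forall B, B * A = A * B).
Proof.
move=> uA; split=> [A1 B|cA]; last first.
  by apply: symP => B; rewrite conj_symE // -mulrA cA mulKr.
have : conj_sym A B = B by rewrite A1.
by rewrite conj_symE // -mulrA => E; rewrite -[in RHS]E mulVKr.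
Qed.

End ConjugationAction.

Lemma conj_symZ (F : fieldType) (R : unitAlgType F) (c : F) (A : R) :
  c != 0 -> A \is a GRing.unit -> conj_sym (c *: A) = conj_sym A.
Proof.
move=> c0 uA; have uc : c \is a GRing.unit by rewrite unitfE.
apply: symP => B; rewrite !conj_symE ?scaler_unit // invrZ //.
by rewrite -scalerAr -!scalerAl scalerA divff // scale1r.
Qed.

(** The quadratic equation gives A^n = 1 + ((z^n - 1) / (z - 1)) (A - 1). As [B] shows that A - 1 is
    not central, A^n is central only when the coefficient vanishes. *)
Lemma conj_sym_order (F : fieldType) (R : unitAlgType F) (z : F) (A B : R) n :
  z != 1 -> A \is a GRing.unit -> (A - 1) * (A - z%:A) = 0 ->
  B * (A - 1) != (A - 1) * B -> (conj_sym A ^+ n)%g = 1%g <-> z ^+ n = 1.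
Proof.
move=> z1 uA minA nsc; set u := A - 1.
have z1' : z - 1 != 0 by rewrite subr_eq0.
have uu : u * u = (z - 1) *: u.
  have E : u = (A - z%:A) + (z - 1)%:A by rewrite scalerBl scale1r addrA subrK.
  by rewrite {2}E mulrDr minA add0r mulr_algr.
have AX : A ^+ n = 1 + ((z ^+ n - 1) / (z - 1)) *: u.
  elim: n => [|n IHn]; first by rewrite !expr0 subrr mul0r scale0r addr0.
  rewrite exprSr IHn (_ : A = 1 + u); last by rewrite /u addrC subrK.
  rewrite mulrDl mul1r mulrDr mulr1 -scalerAl uu scalerA -addrA; congr (_ + _).
  rewrite -scalerDl -{1}[u]scale1r -scalerDl; congr (_ *: _).
  by rewrite exprSr; field.
rewrite conj_symX // conj_sym_eq1 ?unitrX // AX.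
split=> [/(_ B)|-> C]; last by rewrite subrr mul0r scale0r addr0 mulr1 mul1r.
set c := _ / _; rewrite mulrDr mulrDl mulr1 mul1r => /addrI /eqP.
rewrite -scalerAr -scalerAl -subr_eq0 -scalerBr scaler_eq0 subr_eq0 (negPf nsc) orbF.
by rewrite /c mulf_eq0 invr_eq0 (negPf z1') orbF subr_eq0 => /eqP.
Qed.

Section Mx2.
Variable F : fieldType.

Definition mx2 (a b c d : F) : 'M[F]_2 :=
  \matrix_(i < 2, j < 2) (if val i == 0%N then if val j == 0%N then a else b
                          else if val j == 0%N then c else d).

Lemma mx2M a b c d a' b' c' d' : mx2 a b c d * mx2 a' b' c' d' =
  mx2 (a * a' + b * c') (a * b' + b * d') (c * a' + d * c') (c * b' + d * d').
Proof.
apply/matrixP => i j; rewrite !mxE !big_ord_recl big_ord0 !mxE /= addr0.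
by case: (val i == 0%N); case: (val j == 0%N).
Qed.

Lemma mx2B a b c d a' b' c' d' : mx2 a b c d - mx2 a' b' c' d' =
  mx2 (a - a') (b - b') (c - c') (d - d').
Proof.
apply/matrixP => i j; rewrite !mxE.
by case: (val i == 0%N); case: (val j == 0%N).
Qed.

Lemma mx2Z x a b c d : x *: mx2 a b c d = mx2 (x * a) (x * b) (x * c) (x * d).
Proof.
apply/matrixP => i j; rewrite !mxE.
by case: (val i == 0%N); case: (val j == 0%N).
Qed.

Lemma mx2_1 : 1 = mx2 1 0 0 1.
Proof.
apply/matrixP => i j; rewrite !mxE.
by case: i j => [[|[|//]] p] [[|[|//]] q].
Qed.

Lemma mx2_0 : 0 = mx2 0 0 0 0.
Proof.
apply/matrixP => i j; rewrite !mxE.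
by case: (val i == 0%N); case: (val j == 0%N).
Qed.

Lemma mx2_inj a b c d a' b' c' d' : mx2 a b c d = mx2 a' b' c' d' ->
  [/\ a = a', b = b', c = c' & d = d'].
Proof.
move=> /matrixP E; have := (E 0 0, E 0 1, E 1 0, E 1 1).
by rewrite !mxE /= => -[[[-> ->] ->] ->].
Qed.

Lemma mx2_unit a b c d : a * d - b * c != 0 -> mx2 a b c d \is a GRing.unit.
Proof.
move=> D0; apply/unitrP.
exists ((a * d - b * c)^-1 *: mx2 d (- b) (- c) a).
by split; rewrite mx2Z mx2M mx2_1; congr mx2; field.
Qed.

End Mx2.

Lemma primitive_root_neq1 (F : fieldType) k (z : F) : (1 < k)%N ->
  k.-primitive_root z -> z != 1.
Proof. by move=> k1 zk; rewrite -[z]expr1 -(prim_order_dvd zk) dvdn1 gtn_eqF. Qed.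

(** The predecessor makes this total in [k]; at [k = 0] the root has order 1. *)
Definition zeta k : algC := sval (C_prim_root_exists (ltn0Sn k.-1)).

Lemma zeta_prim k : (0 < k)%N -> k.-primitive_root (zeta k).
Proof. by move=> k0; rewrite /zeta; case: C_prim_root_exists => z /=; rewrite prednK. Qed.

Lemma zeta_neq0 k : (0 < k)%N -> zeta k != 0.
Proof.
move=> k0; have zk := prim_expr_order (zeta_prim k0); apply/eqP => z0.
by have /eqP := zk; rewrite z0 expr0n gtn_eqF // eq_sym oner_eq0.
Qed.

(** In PGL_2 an element with eigenvalues 1 and [zeta k] that is not scalar has order k. The tail is
    made of diagonal matrices, the first two elements of an upper and a lower triangular one, and
    the third is determined by the product. *)
Lemma exact_orders (l1 l2 l3 : label) (T : seq label) :
  (1 < l1.2)%N -> (1 < l2.2)%N -> (1 < l3.2)%N -> {in T, forall l, (0 < l.2)%N} ->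
  exists (G : groupType) (D : seq (label * G)),
    [/\ map fst D = l1 :: l2 :: l3 :: T, lprod D = 1%g &
        forall t n, t \in D -> (t.2 ^+ n)%g = 1%g <-> (t.1.2 %| n)%N].
Proof.
case: l1 l2 l3 => [o1 k1] [o2 k2] [o3 k3] /= k1_gt1 k2_gt1 k3_gt1 T0.
have k1_gt0 := ltnW k1_gt1; have k2_gt0 := ltnW k2_gt1; have k3_gt0 := ltnW k3_gt1.
set z1 := zeta k1; set z2 := zeta k2; set z3 := zeta k3.
have z10 : z1 != 0 := zeta_neq0 k1_gt0.
have z20 : z2 != 0 := zeta_neq0 k2_gt0.
have z30 : z3 != 0 := zeta_neq0 k3_gt0.
pose dg z : 'M[algC]_2 := mx2 z 0 0 1.
have dgu z : z != 0 -> dg z \is a GRing.unit.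
  by move=> z0; apply: mx2_unit; rewrite mulr1 mulr0 subr0.
pose de := \prod_(l <- T) zeta l.2.
have de0 : de != 0 by rewrite /de big_seq prodf_seq_neq0; apply/allP => l lT; apply/implyP => _; apply/zeta_neq0/T0.
(* [mu] and [t] solve the equations for [M / mu] to have determinant [z3] and trace [1 + z3], that
   is, eigenvalues 1 and [z3]. The determinant of [M] is [de * z1 * z2] and its trace is
   [de * (z1 + t) + z2]. *)
pose mu := sqrtC (de * z1 * z2 / z3).
have mu2 : mu ^+ 2 = de * z1 * z2 / z3 by rewrite sqrtCK.
have mu0 : mu != 0.
  by rewrite -sqrf_eq0 mu2 !mulf_neq0 // invr_neq0.
pose t := (mu * (1 + z3) - z2) / de - z1.
pose A1 : 'M[algC]_2 := mx2 z1 1 0 1.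
pose A2 : 'M[algC]_2 := mx2 1 0 t z2.
have A1u : A1 \is a GRing.unit by apply: mx2_unit; rewrite mulr1 mulr0 subr0.
have A2u : A2 \is a GRing.unit by apply: mx2_unit; rewrite mul1r mul0r subr0.
pose M := dg de * A1 * A2.
have Mu : M \is a GRing.unit by rewrite !unitrMl // dgu.
pose N := mu^-1 *: M.
have Nu : N \is a GRing.unit by rewrite scaler_unit // unitfE invr_neq0.
have NM : conj_sym N = conj_sym M by apply: conj_symZ; rewrite ?invr_neq0.
have NE : N = mx2 (mu^-1 * (de * (z1 + t))) (mu^-1 * (de * z2)) (mu^-1 * t) (mu^-1 * z2).
  rewrite /N /M /dg /A1 /A2 !mx2M mx2Z; congr mx2; ring.
pose DT : seq (label * sym 'M[algC]_2) := [seq (l, conj_sym (dg (zeta l.2))) | l <- T].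
exists (sym 'M[algC]_2), ((o1, k1, conj_sym A1) :: (o2, k2, conj_sym A2) ::
  (o3, k3, (conj_sym M)^-1%g) :: DT); split.
- by rewrite /= /DT -map_comp map_id.
- rewrite !lprod_cons /=.
  have -> : lprod DT = conj_sym (dg de).
    rewrite /lprod /DT big_map /de; move: T0; elim: (T) => [|l s IHs] sP.
      rewrite !big_nil /dg -mx2_1; apply/esym/conj_sym_eq1; first exact: unitr1.
      by move=> B; rewrite mulr1 mul1r.
    rewrite !big_cons IHs; last by move=> x xs; apply: sP; rewrite in_cons xs orbT.
    rewrite conj_symM ?dgu // ?zeta_neq0 ?sP ?mem_head //.
      by rewrite /dg mx2M; congr (conj_sym (mx2 _ _ _ _)); ring.
    rewrite big_seq prodf_seq_neq0; apply/allP => x xs; apply/implyP => _.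
    by apply/zeta_neq0/sP; rewrite in_cons xs orbT.
  by rewrite /M -!conj_symM ?unitrMl ?dgu //; gsimp.
have ord k A B n : (1 < k)%N -> A \is a GRing.unit ->
    (A - 1) * (A - (zeta k)%:A) = 0 -> B * (A - 1) != (A - 1) * B ->
    (conj_sym (A : 'M[algC]_2) ^+ n)%g = 1%g <-> (k %| n)%N.
  move=> kgt1 uA minA nsc; rewrite (prim_order_dvd (zeta_prim (ltnW kgt1))).
  have := conj_sym_order n (primitive_root_neq1 kgt1 (zeta_prim (ltnW kgt1))) uA minA nsc.
  by move=> -[H1 H2]; split=> [/H1/eqP|/eqP/H2].
have nz k : (1 < k)%N -> zeta k - 1 != 0.
  by move=> kgt1; rewrite subr_eq0; apply: primitive_root_neq1 (zeta_prim (ltnW kgt1)).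
move=> u n; rewrite !in_cons => /or4P[/eqP->|/eqP->|/eqP->|/mapP[l lT ->]] /=.
- apply: (ord _ _ (mx2 1 0 0 0)) => //; rewrite mx2_1 ?mx2Z /A1 !mx2B !mx2M.
    by rewrite mx2_0; congr mx2; rewrite /z1; ring.
  by apply/eqP => /mx2_inj[_ /eqP + _ _]; rewrite !(mul1r, mul0r, mulr0, mulr1, subr0, addr0) oner_eq0.
- apply: (ord _ _ (mx2 0 1 0 0)) => //; rewrite mx2_1 ?mx2Z /A2 !mx2B !mx2M.
    by rewrite mx2_0; congr mx2; rewrite /z2; ring.
  apply/eqP => /mx2_inj[_ /eqP + _ _].
  by rewrite !(mul1r, mul0r, mulr0, mulr1, subr0, add0r, addr0, subrr) (negPf (nz _ k2_gt1)).
- rewrite expVgn -NM.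
  have [H1 H2] : (conj_sym N ^+ n)%g = 1%g <-> (k3 %| n)%N.
    move: NE; set p := _ * (de * (z1 + t)); set q := _ * (de * z2); set r := _ * t; set s := _ * z2.
    move=> NE; have sE : s = 1 + z3 - p by rewrite /s /p /t; field; rewrite de0.
    have qrE : q * r = p * (1 + z3 - p) - z3.
      rewrite -sE; apply/eqP; rewrite -subr_eq0; apply/eqP.
      have -> : q * r - (p * s - z3) = z3 - de * z1 * z2 / mu ^+ 2 by rewrite /q /r /p /s; field.
      by rewrite mu2; field; rewrite z10 z20 z30 de0.
    apply: (ord _ _ (mx2 1 0 0 0)) => //; rewrite NE mx2_1 ?mx2Z !mx2B !mx2M -/z3.
      rewrite mx2_0; congr mx2.
      - by rewrite !mulr1 subr0 mulr0 !subr0 qrE; ring.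
      - by rewrite sE; ring.
      - by rewrite sE; ring.
      - by rewrite sE !mulr0 !subr0 [r * q]mulrC qrE; ring.
    apply/eqP => /mx2_inj[_ /eqP + _ _].
    rewrite !(mul1r, mul0r, mulr0, mulr1, subr0, add0r, addr0, subrr).
    by rewrite !mulf_eq0 invr_eq0 (negPf mu0) (negPf de0) (negPf z20).
  split=> [/eqP|/H2->]; last exact: invg1.
  by rewrite invg_eq1 => /eqP.
- have := T0 l lT; rewrite leq_eqVlt => /predU1P[<-|l1].
    rewrite (_ : zeta 1 = 1); last by have /prim_expr_order := zeta_prim (ltn0Sn 0).
    rewrite /dg -mx2_1 dvd1n (_ : conj_sym 1 = 1%g) ?expg1n //.
    by apply/conj_sym_eq1 => [|B]; [exact: unitr1|rewrite mulr1 mul1r].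
  apply: (ord _ _ (mx2 0 1 0 0)) => //; first exact/dgu/zeta_neq0/ltnW.
    by rewrite mx2_1 mx2Z /dg !mx2B !mx2M mx2_0; congr mx2; ring.
  rewrite mx2_1 /dg !mx2B !mx2M; apply/eqP => /mx2_inj[_ /eqP + _ _].
  rewrite !(mul1r, mul0r, mulr0, mulr1, subr0, add0r, addr0, subrr) eq_sym.
  by rewrite (negPf (nz _ l1)).
Qed.

(** * Infinite polygon groups *)

Local Open Scope group_scope.

Section PolygonGroup.
Variable KK : seq label.

Definition P_rel (u v : word 'I_(size KK)) : Prop :=
  (u = [seq (j, false) | j <- enum 'I_(size KK)] /\ v = [::]) \/
  (exists i, u = nseq (tnth (in_tuple KK) i).2 (i, false) /\ v = [::]).

(* The quotient of J(K') by the central element, i.e. the orbifold fundamental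
   group of a sphere with cone points of orders K'. *)
Definition PP : groupType := presented P_rel.
Definition PD : seq (label * PP) := gens P_rel.

Lemma fst_PD : map fst PD = KK. Proof. exact: fst_gens. Qed.

Lemma size_PD : size PD = size KK. Proof. by rewrite -(size_map fst) fst_PD. Qed.

Lemma lprod_PD : lprod PD = 1.
Proof.
rewrite /lprod big_map (pi_word_prod P_rel _ id).
by apply/pi_presentedP/pres_rel; left.
Qed.

Lemma PD_pow t : t \in PD -> t.2 ^+ t.1.2 = 1.
Proof.
move=> /mapP[i _ ->] /=; set k := _.2.
have -> : presented_gen P_rel i ^+ k = \prod_(l <- nseq k i) presented_gen P_rel l.
  by rewrite big_nseq iter_mulg_1.
rewrite (pi_word_prod P_rel _ id) map_nseq.
by apply/pi_presentedP/pres_rel; right; exists i.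
Qed.

Lemma PP_hom (G : groupType) (D : seq (label * G)) :
  map fst D = KK -> lprod D = 1 -> (forall t, t \in D -> t.2 ^+ t.1.2 = 1) ->
  exists f : ghom PP G, fmap f PD = D.
Proof.
move=> DK D1 Dk; apply: gens_hom => // u v [[-> ->]|[i [-> ->]]].
  by rewrite eval_pos frame_val_enum // big_map [LHS]D1 /word_eval big_nil.
rewrite eval_nseq /word_eval big_nil.
exact: Dk _ (frame_val_in DK i).
Qed.

Definition pgen (i : nat) : PP := (nth (None, 0%N, 1) PD i).2.
Definition pord (i : nat) : nat := (nth (None, 0%N) KK i).2.
(** Reading the long relation from a vertex x of the Cayley graph, its i-th letter starts at
    [x * ppre i]. *)
Definition ppre (i : nat) : PP := \prod_(0 <= j < i) pgen j.

Lemma nth_PD i : (i < size KK)%N ->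
  nth (None, 0%N, 1) PD i = (nth (None, 0%N) KK i, pgen i).
Proof.
move=> iK; rewrite /pgen [LHS]surjective_pairing; congr pair.
by rewrite -fst_PD (nth_map (None, 0%N, 1)) ?size_PD.
Qed.

Lemma pgen_pow i : (i < size KK)%N -> pgen i ^+ pord i = 1.
Proof.
move=> iK; have := @PD_pow (nth (None, 0%N, 1) PD i).
by rewrite nth_PD //; apply; rewrite -nth_PD ?mem_nth ?size_PD.
Qed.

Lemma ppre_size : ppre (size KK) = 1.
Proof. by rewrite -size_PD -lprod_PD /lprod (big_nth (None, 0%N, 1)). Qed.

Lemma PP_subgroup (S : set PP) : is_subgroup S ->
  (forall i, (i < size KK)%N -> S (pgen i)) -> forall g, S g.
Proof.
move=> SS Sg; apply: gens_subgroup => // t /(nthP (None, 0%N, 1))[i].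
by rewrite size_PD => iK; rewrite nth_PD // => <-; apply: Sg.
Qed.

End PolygonGroup.

(** * Cocycles with values in functions on a group, and the Euler characteristic bound *)

Section Shift.
Variables (Q : groupType) (A : zmodType).

(** An element of the unrestricted wreath product of [A] by [Q]. For lifts of the generators of [Q],
    the relations turn into linear conditions on the functions [h]. *)
Definition shift_fun (g : Q) (h : Q -> A) (y : Q * A) : Q * A :=
  (y.1 * g, (y.2 + h y.1)%R).

Definition shift_inv (g : Q) (h : Q -> A) (y : Q * A) : Q * A :=
  (y.1 * g^-1, (y.2 - h (y.1 * g^-1)%g)%R).

Lemma shift_funK g h : cancel (shift_fun g h) (shift_inv g h).
Proof. by move=> [x c]; rewrite /shift_inv /= mulgK addrK. Qed.

Lemma shift_invK g h : cancel (shift_inv g h) (shift_fun g h).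
Proof. by move=> [x c]; rewrite /shift_fun /= mulgVK subrK. Qed.

Definition shift g h : sym (Q * A) := Sym (shift_funK g h) (shift_invK g h).

Lemma shiftE g h x c : shift g h (x, c) = (x * g, (c + h x)%R). Proof. by []. Qed.

Lemma shift1 : shift 1 (fun=> 0%R) = 1.
Proof. by apply: symP => -[x c]; rewrite shiftE mulg1 addr0. Qed.

Lemma shiftM g h g' h' :
  shift g h * shift g' h' = shift (g * g') (fun x => (h x + h' (x * g)%g)%R).
Proof. by apply: symP => -[x c]; rewrite symME !shiftE mulgA addrA. Qed.

Lemma shift_prod n (g : nat -> Q) (h : nat -> Q -> A) :
  \prod_(0 <= i < n) shift (g i) (h i) = shift (\prod_(0 <= i < n) g i)
    (fun x => (\sum_(0 <= i < n) h i (x * \prod_(0 <= j < i) g j)%g)%R).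
Proof.
elim: n => [|n IHn].
  rewrite !big_nil -shift1; congr shift; apply: funext => x.
  by rewrite big_nil.
rewrite big_nat_recr //= IHn shiftM [in RHS]big_nat_recr //=; congr shift.
by apply: funext => x; rewrite big_nat_recr.
Qed.

Lemma shiftX g h n : shift g h ^+ n =
  shift (g ^+ n) (fun x => (\sum_(0 <= j < n) h (x * g ^+ j)%g)%R).
Proof.
rewrite -[n in LHS](subn0 n) -prodg_const_nat shift_prod prodg_const_nat subn0.
congr shift; apply: funext => x; apply: eq_bigr => j _.
by rewrite prodg_const_nat subn0.
Qed.

End Shift.

Section Counting.
Local Open Scope ring_scope.
Variables (F : fieldType) (X I B : finType).
Variables (d : {ffun X -> F^o} -> {ffun I -> F^o}) (d_lin : linear d).
Variables (L : {ffun I -> F^o} -> {ffun B -> F^o}) (L_lin : linear L).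

HB.instance Definition _ := GRing.isLinear.Build F _ _ _ d d_lin.
HB.instance Definition _ := GRing.isLinear.Build F _ _ _ L L_lin.

(** Rank-nullity twice: ker L has dimension at least #|I| - #|B|, lies in the image of d, and this
    image has dimension below #|X| because the constants are killed. *)
Lemma ker_img_count (x0 : X) : d [ffun=> 1] = 0 ->
  (forall v, L v = 0 -> exists w, v = d w) -> (#|I| < #|B| + #|X|)%N.
Proof.
move=> d1 ex.
have dimE (T : finType) : \dim {: {ffun T -> F^o}} = #|T|.
  by rewrite dimvf; exact: muln1.
have := limg_ker_dim (linfun L) fullv; rewrite capfv dimE => <-.
have kL : (lker (linfun L) <= limg (linfun d))%VS.
  apply/subvP => v; rewrite memv_ker lfunE => /eqP/ex[w ->].
  by rewrite -[d w]lfunE memv_img ?memvf.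
have kd : (0 < \dim (lker (linfun d)))%N.
  rewrite lt0n dimv_eq0; apply/eqP => k0.
  have : [ffun=> 1] \in lker (linfun d) by rewrite memv_ker lfunE /= d1.
  rewrite k0 memv0 => /eqP/ffunP/(_ x0); rewrite !ffunE => /eqP.
  by rewrite oner_eq0.
have := limg_ker_dim (linfun d) fullv; rewrite capfv dimE => <-.
have := dimvS kL; have := dimvS (subvf (limg (linfun L))); rewrite dimE.
lia.
Qed.

End Counting.

Section ShiftFrame.
Variables (KK : seq label) (A : zmodType) (h : nat -> PP KK -> A).

Definition shiftD : seq (label * sym (PP KK * A)) :=
  [seq (nth (None, 0%N) KK i, shift (pgen KK i) (h i)) | i <- iota 0 (size KK)].

Lemma fst_shiftD : map fst shiftD = KK.
Proof. by rewrite -map_comp; exact: mkseq_nth. Qed.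

Lemma lprod_shiftD :
  (forall x, (\sum_(0 <= i < size KK) h i (x * ppre KK i)%g)%R = 0%R) -> lprod shiftD = 1.
Proof.
move=> H; rewrite /lprod big_map /=.
have -> : \prod_(j <- iota 0 (size KK)) shift (pgen KK j) (h j) =
    \prod_(0 <= j < size KK) shift (pgen KK j) (h j) by rewrite /index_iota subn0.
rewrite shift_prod [\prod_(0 <= i < _) _]ppre_size -shift1.
by congr shift; apply: funext => x; apply: H.
Qed.

Lemma mem_shiftD t : t \in shiftD -> exists2 i, (i < size KK)%N &
  t = (nth (None, 0%N) KK i, shift (pgen KK i) (h i)).
Proof. by move=> /mapP[i]; rewrite mem_iota => iK ->; exists i. Qed.

Lemma nth_shiftD i : (i < size KK)%N ->
  nth (None, 0%N, 1) shiftD i = (nth (None, 0%N) KK i, shift (pgen KK i) (h i)).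
Proof. by move=> iK; rewrite (nth_map 0%N) ?size_iota // nth_iota. Qed.

End ShiftFrame.

(* Riemann-Hurwitz by linear algebra: on a finite group PP every cocycle with
   values in the regular module is a coboundary, so a count of cocycles bounds
   the Euler characteristic from below. *)
Lemma PP_infinite KK :
  (forall i n, (i < size KK)%N -> pgen KK i ^+ n = 1 -> (pord KK i %| n)%N) ->
  (forall i, (i < size KK)%N -> (0 < pord KK i)%N) ->
  (forall n, (0 < n)%N ->
     (\sum_(i < size KK) n %/ pord KK i + 2 * n <= n * size KK)%N) ->
  ~ finite_set [set: PP KK].
Proof.
move=> Hord Hpos Hchi /finite_seqP[s sE].
have sP x : x \in s by have : [set: PP KK] x by []; rewrite sE.
pose X : finType := seq_sub s; pose mk x : X := SeqSub (sP x); set p := size KK.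
pose r (i : 'I_p) (x : X) : X := mk (val x * pgen KK i).
have rI i : injective (r i) by move=> x y [/mulIg]; apply: val_inj.
have iter_r i n x : val (iter n (r i) x) = val x * pgen KK i ^+ n.
  elim: n => [|n IHn]; first by rewrite expg0 mulg1.
  by rewrite iterS /= [ssval _]IHn expgSr mulgA.
pose I : finType := ('I_p * X)%type.
(* The norm of a cochain along generator i is constant on the orbits of right multiplication by it,
   so one condition per orbit suffices, imposed at its root. By [Hord] these orbits have full
   length, which bounds [#|B|]. *)
pose rt (y : I) := froot (r y.1) y.2 == y.2.
pose B : finType := ({y : I | rt y} + X)%type.
have cardB : (#|B| <= \sum_(i < p) #|X| %/ pord KK i + #|X|)%N.
  rewrite card_sum leq_add2r card_sig -sum1_card (eq_bigl rt) //.
  rewrite -(pair_big_dep xpredT (fun i x => rt (i, x)) (fun _ _ => 1%N)) /=.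
  apply: leq_sum => i _; rewrite sum1_card leq_divRL ?Hpos //.
  pose R := [set x : X | rt (i, x)]%SET.
  rewrite (eq_card (B := R)); last by move=> x; rewrite inE.
  pose fR (y : X * 'I_(pord KK i)) := iter y.2 (r i) y.1.
  have fRI : {in finset.setX R [set: 'I_(pord KK i)]%SET &, injective fR}.
    move=> [x j] [x' j']; rewrite !inE /= /rt /= !andbT => /eqP rx /eqP rx' E.
    have xx' : x = x'.
      rewrite -rx -rx'; apply/eqP; rewrite (root_connect (fconnect_sym (rI i))).
      apply: connect_trans (fconnect_iter _ j x) _; rewrite [iter _ _ _]E.
      by rewrite (fconnect_sym (rI i)); apply: fconnect_iter.
    subst x'; congr pair; apply: val_inj; move: E => /(congr1 val).
    rewrite /fR /= !iter_r => /mulgI E.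
    wlog jj' : j j' E / (j <= j')%N.
      move=> H; case: (leqP j j') => [/H->//|/ltnW/H->//].
    apply/eqP; rewrite eqn_leq jj' /= -subn_eq0.
    have : pgen KK i ^+ (j' - j) = 1 by rewrite expgnFr // E mulgV.
    move=> /(Hord _ _ (ltn_ord i)); case: (posnP (j' - j)%N) => [->//|j0 /(dvdn_leq j0)].
    by have := ltn_ord j'; lia.
  have := max_card (mem (fR @: finset.setX R [set: 'I_(pord KK i)])%SET).
  by rewrite card_in_imset // cardsX cardsT card_ord.
pose d (w : {ffun X -> rat^o}) : {ffun I -> rat^o} := [ffun y => (w (r y.1 y.2) - w y.2)%R].
pose Nv (v : {ffun I -> rat^o}) (y : I) : rat^o :=
  (\sum_(0 <= j < pord KK y.1) v (y.1, mk (val y.2 * pgen KK y.1 ^+ j)%g))%R.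
pose Tv (v : {ffun I -> rat^o}) (x : X) : rat^o :=
  (\sum_(i < p) v (i, mk (val x * ppre KK i)%g))%R.
pose L (v : {ffun I -> rat^o}) : {ffun B -> rat^o} :=
  [ffun b : B => match b with inl y => Nv v (val y) | inr x => Tv v x end].
have d_lin : linear d.
  move=> a u v; apply/ffunP => y; rewrite !ffunE scalerBr opprD addrACA //.
have L_lin : linear L.
  move=> a u v; apply/ffunP => -[y|x]; rewrite !ffunE /Nv /Tv scaler_sumr -big_split /=;
  by apply: eq_bigr => j _; rewrite !ffunE.
have := ker_img_count d_lin L_lin (mk 1).
suff H : (forall v, L v = 0%R -> exists w, v = d w).
  have -> : d [ffun=> 1%R] = 0%R by apply/ffunP => y; rewrite !ffunE subrr.
  move=> /(_ erefl H); rewrite card_prod card_ord.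
  have X0 : (0 < #|X|)%N by apply/card_gt0P; exists (mk 1).
  have := Hchi _ X0; have := cardB; rewrite -/p; lia.
move=> v /ffunP Lv.
pose h (i : nat) (x : PP KK) : rat^o := if insub i is Some j then v (j, mk x) else 0%R.
have hE (i : 'I_p) x : h i x = v (i, mk x) by rewrite /h valK.
have norm (i : 'I_p) x : (\sum_(0 <= j < pord KK i) h i (x * pgen KK i ^+ j)%g)%R = 0%R.
  pose N y := (\sum_(0 <= j < pord KK i) h i (y * pgen KK i ^+ j)%g)%R.
  have NS y : N (y * pgen KK i) = N y.
    rewrite /N -(prednK (Hpos i (ltn_ord i))) big_nat_recr //= big_nat_recl //=.
    rewrite addrC -mulgA -expgS prednK ?Hpos // pgen_pow // expg0; congr (_ + _)%R.
    by apply: eq_bigr => j _; rewrite -mulgA -expgS.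
  have NI n y : N (val (iter n (r i) y)) = N (val y).
    by elim: n => // n IHn; rewrite iterS /= NS.
  have := iter_findex (connect_root (frel (r i)) (mk x)) => E.
  rewrite -/(N x) -[x]/(val (mk x)) -(NI (findex (r i) (mk x) (froot (r i) (mk x)))) E.
  have rtx : rt (i, froot (r i) (mk x)).
    by rewrite /rt /= root_root //; exact: fconnect_sym.
  have := Lv (inl (exist (fun y => rt y) _ rtx)); rewrite !ffunE /= => E'; rewrite -[RHS]E' /N /Nv.
  by apply: eq_bigr => j _; rewrite hE.
have total x : (\sum_(0 <= i < p) h i (x * ppre KK i)%g)%R = 0%R.
  have := Lv (inr (mk x)); rewrite !ffunE /= => E; rewrite -[RHS]E /Tv big_mkord.
  by apply: eq_bigr => i _; rewrite hE.
have [th thE] : exists th : ghom (PP KK) (sym (PP KK * rat^o)), fmap th (PD KK) = shiftD h.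
  apply: PP_hom; [exact: fst_shiftD|exact: lprod_shiftD|].
  move=> t /mem_shiftD[i ip ->] /=; rewrite shiftX -/(pord KK i) pgen_pow // -shift1.
  by congr shift; apply: funext => x; apply: (norm (Ordinal ip)).
have thg i : (i < p)%N -> th (pgen KK i) = shift (pgen KK i) (h i).
  move=> ip; have := congr1 (fun D => (nth (None, 0%N, 1) D i).2) thE.
  by rewrite nth_shiftD // (nth_map (None, 0%N, 1)) ?size_PD.
have th1 q : forall y, (th q y).1 = y.1 * q.
  move: q; apply: (@PP_subgroup KK [set q | forall y, (th q y).1 = y.1 * q]).
    apply: is_subgroupM => [y|q H y|q q' H H' y] /=.
    - by rewrite gmulf1 mulg1.
    - by have := H (th q^-1 y); rewrite -symME -gmulfM mulVg gmulf1 => ->; rewrite mulgK.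
    - by rewrite gmulfM symME H' H mulgA.
  by move=> i ip [x c] /=; rewrite thg.
(* The potential at x is the value acquired by transporting 0 from 1 to x; it is independent of the
   path because [L v = 0] made [th] well defined on [PP]. *)
exists [ffun x : X => (th (val x) (1, 0%R)).2]; apply/ffunP => -[i x].
rewrite !ffunE /= gmulfM symME thg //.
have := th1 (val x) (1, 0%R); case: (th (val x) (1, 0%R)) => y c /= ->.
rewrite mul1g hE addrC addKr; congr (v (_, _)).
exact: val_inj.
Qed.

(** * Infinite generation *)

Section Ray.
Variables (Q : groupType) (E : seq Q).
Hypothesis E_gen : forall S : Q -> Prop,
  S 1 -> (forall g e, e \in E -> S g -> S (g * e)) -> forall g, S g.
Hypothesis Q_inf : ~ finite_set [set: Q].

Let ev (w : seq Q) : Q := \prod_(e <- w) e.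
Let wd (w : seq Q) : Prop := {subset w <= E}.
Let geod (w : seq Q) : Prop :=
  wd w /\ forall w', wd w' -> ev w' = ev w -> (size w <= size w')%N.

Let words n : seq (seq Q) := iter n (fun s => [seq e :: w | e <- E, w <- s]) [:: [::]].

Let words_in w : wd w -> w \in words (size w).
Proof.
elim: w => [|e w IHw] // we; apply: allpairs_f; first by apply: we; exact: mem_head.
by apply: IHw => x xw; apply: we; rewrite in_cons xw orbT.
Qed.

Let geod_ex g : exists2 w, geod w & ev w = g.
Proof.
have ex : exists n, `[< exists w, [/\ wd w, ev w = g & size w = n] >].
  suff [w ww wg] : exists2 w, wd w & ev w = g.
    by exists (size w); apply/asboolP; exists w.
  move: g; apply: E_gen => [|g e eE [w ww <-]]; first by exists [::]; rewrite // /ev big_nil.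
  exists (rcons w e); last by rewrite /ev -cats1 big_cat big_seq1.
  by move=> x; rewrite mem_rcons in_cons => /predU1P[->//|/ww].
case: (ex_minnP ex) => n /asboolP[w [ww wg wn]] min.
exists w => //; split=> // w' ww' E'; rewrite wn; apply: min; apply/asboolP.
by exists w'; rewrite E'.
Qed.

Let geod_prefix u v : geod (u ++ v) -> geod u.
Proof.
move=> [wuv min]; split=> [x xu|w ww E']; first by apply: wuv; rewrite mem_cat xu.
have := min (w ++ v); rewrite !size_cat leq_add2r; apply.
  by move=> x; rewrite mem_cat => /orP[/ww//|xv]; apply: wuv; rewrite mem_cat xv orbT.
by rewrite /ev !big_cat; congr (_ * _).
Qed.

(** The invariant of König's lemma: words that extend to arbitrarily long geodesics. *)
Let good w : Prop := forall m, exists2 u, (m <= size u)%N & geod (w ++ u).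

Let good_nil : good [::].
Proof.
move=> m; apply: contrapT => no; apply: Q_inf.
apply: (@sub_finite_set _ _ [set` [seq ev w | w <- flatten [seq words n | n <- iota 0 m]]]);
  last exact: finite_seq.
move=> g _ /=; have [w gw <-] := geod_ex g; apply: map_f.
apply/flatten_mapP; exists (size w); last by apply: words_in; case: gw.
rewrite mem_iota /= add0n ltnNge; apply/negP => mw; apply: no.
by exists w.
Qed.

Let good_step w : good w -> exists2 e, e \in E & good (rcons w e).
Proof.
move=> gw; apply: contrapT => no.
have bd (s : seq Q) : {subset s <= E} -> exists M, forall e u, e \in s ->
    geod (rcons w e ++ u) -> (size u < M)%N.
  elim: s => [|e s IHs] sE; first by exists 0%N.
  have [M HM] := IHs (fun x xs => sE x (mem_behead (s := e :: s) xs)).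
  have [m Hm] : exists m, forall u, geod (rcons w e ++ u) -> (size u < m)%N.
    apply: contrapT => nom; apply: no; exists e; first by apply: sE; exact: mem_head.
    move=> m; apply: contrapT => nou; apply: nom; exists m => u gu.
    by rewrite ltnNge; apply/negP => mu; apply: nou; exists u.
  exists (maxn m M) => f u; rewrite in_cons leq_max => /predU1P[->/Hm->//|fs /(HM _ _ fs)->].
  by rewrite orbT.
have [M HM] := bd E (fun x xE => xE).
have [[|e u] // Mu gu] := gw M.+1.
have eE : e \in E by case: gu => wu _; apply: wu; rewrite mem_cat mem_head orbT.
by have := HM e u eE; rewrite -cats1 -catA => /(_ gu); rewrite /= in Mu; lia.
Qed.

(** König's lemma yields an infinite word all of whose prefixes are geodesic. Prefixes of different
    lengths have different values, so the path is injective. *)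
Lemma ray : exists x : nat -> Q,
  [/\ injective x, x 0%N = 1 & forall n, exists2 e, e \in E & x n.+1 = x n * e].
Proof.
have ex w : exists e, good w -> e \in E /\ good (rcons w e).
  have [/good_step[e eE ge]|ng] := pselect (good w).
    by exists e.
  by exists 1 => /ng.
have [next nextP] := boolp.choice ex.
pose ws := fix ws n := if n is m.+1 then rcons (ws m) (next (ws m)) else [::].
have gws n : good (ws n).
  by elim: n => [|n /nextP[]] //; exact: good_nil.
have sws n : size (ws n) = n by elim: n => //= n IHn; rewrite size_rcons IHn.
have geo n : geod (ws n) by have [u _ /geod_prefix] := gws n 0%N.
exists (fun n => ev (ws n)); split=> [m n E'||n].
- apply/eqP; rewrite eqn_leq; have [wm Hm] := geo m; have [wn Hn] := geo n.
  by have := Hm _ wn (esym E'); have := Hn _ wm E'; rewrite !sws => -> ->.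
- by rewrite /ev big_nil.
- exists (next (ws n)); first by case: (nextP _ (gws n)).
  by rewrite /ev /= -cats1 big_cat big_seq1.
Qed.

End Ray.

(* An infinite finitely generated Cayley graph carries a flow with a single
   source: push everything to infinity along a ray. *)
Lemma point_flow (Q : groupType) (p : nat) (t : nat -> Q) (A : zmodType) (a : A) (y : Q) :
  (forall S : set Q, is_subgroup S -> (forall i, (i < p)%N -> S (t i)) -> forall g, S g) ->
  ~ finite_set [set: Q] ->
  exists u : nat -> Q -> A, forall x,
    (\sum_(i < p) (u i x - u i (x * t i)%g))%R = (if x == y then a else 0)%R.
Proof.
move=> tgen Qinf; pose E := [seq t i | i <- iota 0 p] ++ [seq (t i)^-1 | i <- iota 0 p].
have [S S1 SE g|z [zI z0 zS]] := @ray Q E _ Qinf.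
  pose S' : set Q := [set q | (forall g, S g -> S (g * q)) /\ (forall g, S g -> S (g * q^-1))].
  suff : S' g by move=> [/(_ 1 S1)]; rewrite mul1g.
  apply: tgen => [|i ip].
    apply: is_subgroupM => [|q [H H']|q r [H H'] [K K']].
    - by split=> h Sh; rewrite ?invg1 mulg1.
    - by split=> //; rewrite invgK.
    - split=> h Sh; first by rewrite mulgA; apply/K/H.
      by rewrite invgM mulgA; apply/H'/K'.
  have iI : i \in iota 0 p by rewrite mem_iota.
  split=> h; apply: SE; first by rewrite mem_cat (map_f t iI).
  by rewrite mem_cat (map_f (fun i => (t i)^-1) iI) orbT.
pose x n := y * z n.
have xI : injective x by move=> m n /mulgI/zI.
have ex n : exists c : 'I_p * bool,
    x n.+1 = x n * (if c.2 then (t c.1)^-1 else t c.1).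
  have [e + zE] := zS n.
  rewrite mem_cat => /orP[] /mapP[i]; rewrite mem_iota /= add0n => ip eE.
    by exists (Ordinal ip, false); rewrite /x zE eE mulgA.
  by exists (Ordinal ip, true); rewrite /x zE eE mulgA.
have [c cP] := boolp.choice ex.
(* Here [u i q] is the amount sent from q to q (t i)^-1. A step of the ray along an inverse
   generator counts [a] at its start [x n]; a step along [t i] runs against this direction and
   counts [- a] at its end, hence [x \o S]. Everything cancels except at the start of the ray. *)
pose al (s : nat -> Q) i b q : A := if `[< exists2 n, s n = q & c n = (i, b) >] then a else 0%R.
have alE (s : nat -> Q) q : injective s ->
    (\sum_(i < p) (al s i true q + al s i false q))%R =
    (if `[< exists n, s n = q >] then a else 0)%R.
  move=> sI; case: asboolP => [[n sn]|no].
    have alcn i b : al s i b q = if c n == (i, b) then a else 0%R.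
      rewrite /al; congr (if _ then _ else _); apply/asboolP/eqP => [[m sm <-]|cn].
        by congr c; apply: sI; rewrite sm sn.
      by exists n.
    rewrite (bigD1 (c n).1) //= big1 ?addr0 => [|i ne]; last first.
      rewrite !alcn !ifN ?addr0 //; apply/eqP => cn; rewrite cn eqxx // in ne.
    rewrite !alcn; case: (c n) => i b /=; rewrite !xpair_eqE eqxx /=.
    by case: b; rewrite /= ?addr0 ?add0r.
  rewrite big1 // => i _; rewrite /al !asboolF ?addr0 //.
  - by move=> [n sn _]; apply: no; exists n.
  - by move=> [n sn _]; apply: no; exists n.
exists (fun i q => if insub i is Some j then (al x j true q - al (x \o S) j false q)%R else 0%R).
move=> q; under eq_bigr => i _.
  rewrite valK.
  have -> : al x i true (q * t i) = al (x \o S) i true q.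
    rewrite /al; congr (if _ then _ else _); apply/asboolP/asboolP => -[n E1 E2]; exists n => //=.
      by rewrite cP E2 E1 mulgK.
    by move: E1; rewrite /= cP E2 /= => <-; rewrite mulgVK.
  have -> : al (x \o S) i false (q * t i) = al x i false q.
    rewrite /al; congr (if _ then _ else _); apply/asboolP/asboolP => -[n E1 E2]; exists n => //=.
      by move: E1; rewrite /= cP E2 => /mulIg.
    by rewrite cP E2 E1.
  rewrite opprB addrAC addrA addrAC -addrA -opprD [X in (_ - X)%R]addrC.
  over.
have xSI : injective (x \o S) by move=> m n /xI[].
rewrite sumrB !alE //; have x0 : x 0%N = y by rewrite /x z0 mulg1.
have [<-|ne] := eqVneq y q; last first.
  case: asboolP => [[[|n] xn]|no]; first by rewrite xn in x0; rewrite x0 eqxx in ne.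
    rewrite asboolT /=; last by exists n.
    by rewrite subrr.
  rewrite asboolF /=; last by move=> [n xn]; apply: no; exists n.+1.
  by rewrite subrr.
rewrite asboolT /=; last by exists 0%N.
rewrite asboolF /= ?subr0 //.
by move=> [n]; rewrite -x0 => /xI.
Qed.

Lemma sum_periodic (A : zmodType) (F : nat -> A) k q : (forall j, F (j + k)%N = F j) ->
  (\sum_(0 <= j < q * k) F j = (\sum_(0 <= j < k) F j) *+ q)%R.
Proof.
move=> Fk; elim: q => [|q IHq]; first by rewrite mul0n big_geq.
rewrite mulSn (@big_cat_nat _ _ _ k) ?leq_addr //= mulrS; congr (_ + _)%R.
rewrite -IHq -[X in index_iota X _]add0n big_addn addKn; exact: eq_bigr.
Qed.

Lemma exp_modn (G : groupType) (g : G) k n : g ^+ k = 1 -> (k %| n)%N -> g ^+ n = 1.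
Proof. by move=> gk /dvdnP[q ->]; rewrite mulnC expgnA gk expg1n. Qed.

Lemma genJ_not_fg KK i0 :
  (i0 < size KK)%N ->
  {in KK, forall l, dvdn_infty l.2 l.1 && (if l.1 is Some m then 0 < m else true)%N} ->
  (nth (None, 0%N) KK i0).1 <> Some (nth (None, 0%N) KK i0).2 ->
  (forall i n, (i < size KK)%N -> pgen KK i ^+ n = 1 -> (pord KK i %| n)%N) ->
  (forall i, (i < size KK)%N -> (0 < pord KK i)%N) ->
  (forall n, (0 < n)%N ->
     (\sum_(i < size KK) n %/ pord KK i + 2 * n <= n * size KK)%N) ->
  ~ finitely_generated (genJ (KT KK) (KT' KK)).
Proof.
move=> i0K KKv ne Hord Hpos Hchi; have Qinf := PP_infinite Hord Hpos Hchi.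
set Q := PP KK in Qinf; set p := size KK.
(* The modulus is k / k', which exceeds 1 because the two entries differ; for an infinite k any
   modulus above 1 serves, and 2 is taken. *)
have [q q1 qE] : exists2 q, (1 < q)%N & forall m,
    (nth (None, 0%N) KK i0).1 = Some m -> m = (q * pord KK i0)%N.
  have := KKv _ (mem_nth (None, 0%N) i0K); rewrite /pord in Hpos *.
  have := Hpos _ i0K; move: ne; case: (nth _ _ _) => [[m|] k] /= ne k0; last by exists 2%N.
  move=> /andP[km m0]; exists (m %/ k)%N => [|_ [<-]]; last by rewrite divnK.
  rewrite ltn_neqAle eq_sym divn_gt0 // dvdn_leq // andbT.
  by apply/eqP => E; apply: ne; rewrite -(divnK km) E mul1n.
pose A : zmodType := 'Z_q; pose a : A := 1%R.
have Aq (x : 'Z_q) : (x *+ q = 0)%R by rewrite -mulr_natr pchar_Zp ?mulr0.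
have a0 : a <> 0%R by apply/eqP; exact: oner_neq0.
(* The long relation evaluates [w i] at [x * ppre KK i]. In terms of [u], the letter i then becomes
   a step by the conjugate [t i], and these conjugates still generate. The source is
   [(ppre KK i0)^-1] because the correction in [h] sits where [x * ppre KK i0 = 1]. *)
pose t i : Q := pgen KK i ^ (ppre KK i)^-1.
have [S SS St g|u uE] := @point_flow Q p t A a (ppre KK i0)^-1 _ Qinf.
  have [S1 SV SM] := subgroupP SS.
  have preS i : (i <= p)%N -> S (ppre KK i).
    elim: i => [|i IHi] ip; first by rewrite /ppre big_geq.
    have -> : ppre KK i.+1 = t i * ppre KK i.
      by rewrite /ppre big_nat_recr //= /t; gsimp.
    by apply: SM; [apply: St|apply/IHi/ltnW].
  apply: (@PP_subgroup KK S SS) => i ip.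
  have -> : pgen KK i = (ppre KK i)^-1 * (t i * ppre KK i) by rewrite /t; gsimp.
  by apply: (SM); [apply: (SV); apply/preS/ltnW | apply: (SM); [apply: St | apply/preS/ltnW]].
pose w i x := u i (x * (ppre KK i)^-1).
(* The differences telescope in the norm of each generator, so only the point mass for [i0] affects
   the power relations, while the flow balances this mass in the long relation. *)
pose h i (x : Q) : A := (w i x - w i (x * pgen KK i)%g -
  (if (i == i0) && (x == 1%g) then a else 0))%R.
have total x : (\sum_(0 <= i < p) h i (x * ppre KK i)%g)%R = 0%R.
  rewrite big_mkord sumrB (eq_bigr (fun i : 'I_p => u i x - u i (x * t i)%g)%R); last first.
    by move=> i _; rewrite /w mulgK /t; congr (u _ _ - u _ _)%R; gsimp.
  rewrite uE (bigD1 (Ordinal i0K)) //= big1 ?addr0 => [|i ii0]; last first.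
    by rewrite ifN // negb_and; apply/orP; left; apply: contraNneq ii0 => E; apply/eqP/val_inj.
  by rewrite eqxx /= -mulg_eq1 subrr.
have normE i n x : pgen KK i ^+ n = 1 -> (\sum_(0 <= j < n) h i (x * pgen KK i ^+ j)%g =
    - \sum_(0 <= j < n) (if (i == i0) && (x * pgen KK i ^+ j == 1)%g then a else 0))%R.
  move=> gn; rewrite /h sumrB -[RHS]add0r; congr (_ - _)%R.
  rewrite (eq_bigr (fun j => - (w i (x * pgen KK i ^+ j.+1)%g - w i (x * pgen KK i ^+ j)%g))%R).
    by rewrite sumrN telescope_sumr // gn expg0 subrr oppr0.
  by move=> j _; rewrite opprB expgSr mulgA.
have normN i n x : i != i0 -> pgen KK i ^+ n = 1 ->
    (\sum_(0 <= j < n) h i (x * pgen KK i ^+ j)%g = 0)%R.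
  move=> ii0 gn; rewrite normE // big1 ?oppr0 // => j _.
  by rewrite (negPf ii0).
have [th thE] : exists th : ghom (JJ KK) (sym (Q * A)), fmap th (JD KK) = shiftD h.
  apply: JJ_hom; last exact: fst_shiftD.
  move=> _ /mem_shiftD[i ip ->] /=; rewrite lprod_shiftD //; split; last exact: commute1.
  have := KKv _ (mem_nth (None, 0%N) ip).
  case E: (nth _ _ _).1 => [m|//] /= /andP[km m0].
  have gm : pgen KK i ^+ m = 1 by apply: exp_modn km; apply: pgen_pow.
  rewrite shiftX gm -shift1; congr shift; apply: funext => x.
  have [ii0|] := eqVneq i i0; last by move=> ii0; apply: normN.
  (* The exponent k runs through the cyclic group of order k' exactly q times, which kills the mass
     in 'Z_q; the exponent k' alone does not. *)
  rewrite normE //; rewrite ii0 in E gm *; rewrite (qE m E) sum_periodic.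
    by rewrite [X in (- X)%R]Aq oppr0.
  by move=> j; rewrite expgnDr pgen_pow // mulg1.
have jn i : (i < p)%N -> exists2 g, (nth (None, 0%N) KK i, g) \in JD KK &
    th g = shift (pgen KK i) (h i).
  move=> ip; pose d := (None, 0%N, 1) : label * JJ KK.
  have iD : (i < size (JD KK))%N by rewrite -(size_map fst) fst_JD.
  exists (nth d (JD KK) i).2.
    have -> : (nth (None, 0%N) KK i, (nth d (JD KK) i).2) = nth d (JD KK) i.
      rewrite [RHS]surjective_pairing; congr pair.
      have := congr1 (fun s => nth (None, 0%N) s i) (fst_JD KK).
      by rewrite (nth_map d).
    exact: mem_nth.
  have := congr1 (fun D => (nth (None, 0%N, 1) D i).2) thE.
  by rewrite nth_shiftD // (nth_map d).
have JDP t' : t' \in JD KK -> exists2 i, (i < p)%N &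
    t'.1 = nth (None, 0%N) KK i /\ th t'.2 = shift (pgen KK i) (h i).
  move=> /(mem_fmap th); rewrite thE => /mem_shiftD[i ip [-> ->]].
  by exists i.
have thS g : exists r f, th g = shift r f.
  move: g; apply: (@JJ_subgroup KK [set g | exists r f, th g = shift r f]).
    apply: is_subgroupM => [|x [r [f E]]|x y [r [f E]] [r' [f' E']]] /=.
    - by exists 1, (fun=> 0%R); rewrite gmulf1 shift1.
    - exists r^-1, (fun x => - f (x * r^-1)%g)%R; rewrite gmulfV E.
      by apply: symP => -[z c].
    - by eexists; eexists; rewrite gmulfM E E' shiftM.
  by move=> t' /JDP[i _ [_ E]]; exists (pgen KK i), (h i).
have Qth r : exists g f, th g = shift r f.
  move: r; apply: (@PP_subgroup KK [set r | exists g f, th g = shift r f]).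
    apply: is_subgroupM => [|r [x [f E]]|r r' [x [f E]] [x' [f' E']]] /=.
    - by exists 1, (fun=> 0%R); rewrite gmulf1 shift1.
    - exists x^-1, (fun x => - f (x * r^-1)%g)%R; rewrite gmulfV E.
      by apply: symP => -[z c].
    - by exists (x * x'); eexists; rewrite gmulfM E E' shiftM.
  by move=> i /jn[g _ E]; exists g, (h i).
have conjS r f f' : shift 1 f ^ shift r f' = shift 1 (fun x => f (x * r^-1)%g).
  apply: symP => -[x c]; rewrite conjgE !symME shiftE.
  rewrite -[(shift r f')^-1 (x, c)]/(x * r^-1, (c - f' (x * r^-1)%g)%R) !shiftE.
  by rewrite mulg1 mulgVK mulg1 addrAC subrK.
(* The flow may have infinite support, but it has telescoped away in the norms, so the elements of
   [NJ] translate only finitely many fibres. *)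
pose N1 y := exists2 f, th y = shift 1 f & finite_set [set x | f x <> 0%R].
have NJ1 : NJ (KK := KK) `<=` N1.
  apply: NJ_sub => [|t' /JDP[i ip [lE E]]].
    split.
      apply: is_subgroupM => [|x [f E ff]|x y [f E ff] [f' E' ff']].
      - exists (fun=> 0%R); first by rewrite gmulf1 shift1.
        by rewrite (_ : [set _ | _] = set0) // predeqE.
      - exists (fun x => - f x)%R.
          rewrite gmulfV E; apply: symP => -[z c].
          rewrite -[(shift 1 f)^-1 (z, c)]/(z * 1^-1, (c - f (z * 1^-1)%g)%R) shiftE.
          by rewrite invg1 !mulg1.
        apply: sub_finite_set ff => z /= fz f0; apply: fz; by rewrite f0 oppr0.
      - exists (fun x => f x + f' x)%R.
          by rewrite gmulfM E E' shiftM mulg1; congr shift; apply: funext => z; rewrite mulg1.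
        apply: (sub_finite_set (B := [set x | f x <> 0%R] `|` [set x | f' x <> 0%R])).
          move=> z /= fz; apply: contrapT => /not_orP[/contrapT f0 /contrapT f0'].
          by apply: fz; rewrite f0 f0' addr0.
        by rewrite finite_setU.
    move=> x g [f E ff]; have [r [f' E']] := thS g.
    exists (fun x => f (x * r^-1)%g); first by rewrite gmulfJ E E' conjS.
    apply: (sub_finite_set (B := (fun z => z * r) @` [set x | f x <> 0%R])).
      by move=> z /= fz; exists (z * r^-1) => //; rewrite mulgVK.
    exact: finite_image.
  have tX : th (t'.2 ^+ t'.1.2) =
      shift 1 (fun x => (\sum_(0 <= j < pord KK i) h i (x * pgen KK i ^+ j)%g)%R).
    by rewrite gmulfXn E lE shiftX pgen_pow.
  apply: (ex_intro2 _ _ _ tX).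
  have [->|ii0] := eqVneq i i0; last first.
    apply: (sub_finite_set (B := set0)) => // x /= [].
    by apply: normN => //; apply: pgen_pow.
  apply: (sub_finite_set (B := [set` [seq pgen KK i0 ^- j | j <- iota 0 (pord KK i0)]]));
    last exact: finite_seq.
  move=> x /= nx; apply: contrapT => xn; apply: nx; rewrite normE; last exact: pgen_pow.
  rewrite big_nat big1 ?oppr0 // => j jk; rewrite ifN //; apply/negP => /andP[_ /eqP xj].
  apply: xn; apply/mapP; exists j; first by rewrite mem_iota.
  by apply: (mulIg (pgen KK i0 ^+ j)); rewrite xj mulVg.
(* Conjugating by an element above r carries the support to r. The value there is [- a]: exactness
   of the order leaves a single point mass in the sum. *)
have Nmove r : exists y, NJ y /\ forall f, th y = shift 1 f -> f r <> 0%R.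
  have [g0 g0D E0] := jn _ i0K; have [g [f' E']] := Qth r.
  exists ((g0 ^+ pord KK i0) ^ g); split.
    by have [_ NC] := NJ_normal KK; apply: NC; apply: (NJ_gen g0D).
  move=> f; rewrite gmulfJ gmulfXn E0 E' shiftX pgen_pow // conjS => /(congr1 (fun s : sym _ => (s (r, 0%R)).2)).
  rewrite !shiftE /= mulgV !add0r => <-; rewrite normE; last exact: pgen_pow.
  rewrite -(prednK (Hpos _ i0K)) big_nat_recl // expg0 mulg1 !eqxx /= big_nat big1 ?addr0.
    by move=> /eqP; rewrite oppr_eq0 => /eqP.
  move=> j jk; rewrite ifN // mul1g; apply/eqP => gj.
  have /dvdn_leq := Hord _ _ i0K gj; rewrite -(prednK (Hpos _ i0K)) => /(_ isT).
  lia.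
move=> [A0 A0fin A0gen].
pose supp (y : genJ (KT KK) (KT' KK)) : set Q :=
  [set x | exists c, (th (val y)) (x, c) <> (x, c)].
pose U := \bigcup_(y in A0) supp y.
have Ufin : finite_set U.
  apply: bigcup_finite => // y _; have [f E ff] := NJ1 _ (genJ_valP y).
  apply: sub_finite_set ff => x [c]; rewrite E shiftE mulg1 => H f0; apply: H.
  by rewrite f0 addr0.
pose S' : set (genJ (KT KK) (KT' KK)) :=
  [set y | forall x c, ~ U x -> th (val y) (x, c) = (x, c)].
have S'all y : S' y.
  have : [set: genJ (KT KK) (KT' KK)] y by [].
  rewrite -A0gen; apply.
  split=> [|x /= Ax z c nU]; last first.
    by apply: contrapT => H; apply: nU; exists x => //; exists c.
  apply: is_subgroupM => [x c _|x Hx z c nU|x z Hx Hz v c nU] /=.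
  - by rewrite gmulf1.
  - by rewrite gmulfV -{1}(Hx _ c nU) -symME mulgV.
  - by rewrite gmulfM symME Hx // Hz.
apply: Qinf; apply: (sub_finite_set _ Ufin) => r _; apply: contrapT => nU.
have [y [Ny]] := Nmove r; have [f E _] := NJ1 _ Ny; move=> /(_ f E); apply.
have := S'all (to_genJ Ny) r 0%R nU; rewrite /= E shiftE mulg1 add0r => -[].
by [].
Qed.

(** * Reduction of the spherical cases *)

Local Open Scope nat_scope.

(* Entries [Some 1] of K are allowed here; they arise in coverings and are
   dropped at the end. *)
Definition valid_label (l : label) : bool :=
  [&& (0 < l.2)%N, dvdn_infty l.2 l.1 & if l.1 is Some m then (0 < m)%N else true].

Definition reducible (KK : seq label) : Prop := exists LL,
  [/\ all valid_label LL, (count (fun l : label => l.2 != 1) LL <= 2)%N,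
      pairwise coprime (map snd LL) & RI KK LL].

Lemma reducible_RI KK LL : RI KK LL -> reducible LL -> reducible KK.
Proof. by move=> KL [MM [vM cM pM LM]]; exists MM; split=> //; apply: RI_trans KL LM. Qed.

Lemma reducible_perm KK LL : perm_eq KK LL -> reducible LL -> reducible KK.
Proof. by move=> /RI_perm/reducible_RI. Qed.

Lemma RI_drop_units KK : all valid_label KK ->
  RI KK [seq l <- KK | l.1 != Some 1].
Proof.
move=> vK; apply: (@RI_trans _ ([seq l <- KK | l.1 == Some 1] ++ [seq l <- KK | l.1 != Some 1])).
  apply: RI_perm; rewrite perm_sym; apply/permPl/perm_filterC.
have : all (fun l : label => l.1 == Some 1) [seq l <- KK | l.1 == Some 1] by exact: filter_all.
elim: (filter _ KK) => [_|[k k'] s IHs /= /andP[/eqP-> /IHs]]; first exact: RI_refl.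
by apply: RI_trans; apply: RI_drop.
Qed.

Lemma reducible_reduced_form KK : reducible KK -> exists (q : nat) (L : q.-tuple (option nat)) (L' : q.-tuple nat),
  [/\ genJ_params L L', reduced_params L' & reflection_isomorphic (KT KK) (KT' KK) L L'].
Proof.
move=> [LL [vL cL pL KL]]; pose MM := [seq l <- LL | l.1 != Some 1].
have KM : RI KK MM by apply: RI_trans KL (RI_drop_units vL).
(* Parameters must be non-empty, so an empty list is replaced by the single label (2, 2), whose
   generalized J-group is also trivial. *)
have [M0|Mn0] := eqVneq MM [::].
  exists (size [:: (Some 2, 2)]), (KT [:: (Some 2, 2)]), (KT' [:: (Some 2, 2)]); split.
  - by apply/and4P; split=> //; apply/forallP => i; rewrite !tnth_map (tnth_nth (None, 0)) /=;
       case: i => [[|//] ?].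
  - by [].
  - rewrite M0 in KM; suff : RI KK [:: (Some 2, 2)] by []; apply: (RI_trans KM).
    by apply: (RI_trivial (LL := [:: (Some 2, 2)])) => // l; rewrite inE => /eqP->.
exists (size MM), (KT MM), (KT' MM); split=> //; last first.
  apply/andP; split; last first.
    apply: subseq_pairwise pL; exact: map_subseq (filter_subseq _ _).
  rewrite /= count_map; apply: leq_trans cL.
  by rewrite count_filter; apply: sub_count => l /= /andP[].
have MP l : l \in MM -> valid_label l /\ l.1 != Some 1.
  by rewrite mem_filter => /andP[-> /(allP vL)->].
apply/and4P; split.
- by rewrite lt0n size_eq0.
- apply/allP => k /mapP[l /MP[/and3P[_ _ l1] l2] ->]; move: l1 l2.
  by case: l.1 => [[|[|m]]|].
- by apply/allP => k /mapP[l /MP[/and3P[l0 _ _] _] ->].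
- apply/forallP => i; rewrite !tnth_map.
  by have /MP[/and3P[]] := mem_tnth i (in_tuple MM).
Qed.

Lemma split_label d (l : label) : valid_label l -> (0 < d)%N -> (d %| l.2)%N ->
  exists k, l = (omul d k, (d * (l.2 %/ d))%N) /\ valid_label (k, (l.2 %/ d)%N).
Proof.
case: l => [[m|] k'] /and3P[/= k0 km m0] d0 dk; rewrite mulnC divnK //; last first.
  by exists None; split=> //; rewrite /valid_label /= divn_gt0 // (dvdn_leq k0 dk).
have dm : (d %| m)%N := dvdn_trans dk km.
exists (Some (m %/ d)); split; first by rewrite /= mulnC divnK.
by apply/and3P; split; rewrite /= ?dvdn_divRL ?divnK // divn_gt0 // dvdn_leq.
Qed.

Definition units (T : seq label) := all (fun l : label => l.2 == 1) T.

Lemma units_coprime T : units T -> pairwise coprime (map snd T).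
Proof.
elim: T => [//|[k a] T IHT] /= /andP[/eqP-> /[dup] /IHT -> /allP uT]; rewrite andbT.
by apply/allP => _ /mapP[l /uT/eqP-> ->].
Qed.

Lemma units_all_coprime a T : units T -> all (coprime a) (map snd T).
Proof. by move=> /allP uT; apply/allP => _ /mapP[l /uT/eqP-> ->]; apply: coprimen1. Qed.

Lemma units_count T : units T -> count (fun l : label => l.2 != 1) T = 0.
Proof.
move=> /allP uT; apply/eqP; rewrite -leqn0 leqNgt -has_count; apply/hasPn => l /uT.
by rewrite negbK.
Qed.

Lemma all_flatten_nseq (P : pred label) n T : all P T -> all P (flatten (nseq n T)).
Proof. by move=> PT; elim: n => //= n IHn; rewrite all_cat PT. Qed.

Lemma perm_split (KK : seq label) : perm_eq KK
  ([seq l <- KK | l.2 != 1] ++ [seq l <- KK | l.2 == 1]).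
Proof.
rewrite perm_sym perm_catC.
by apply/permPl/(perm_filterC (fun l : label => l.2 == 1)).
Qed.

Lemma reducible_cyclic d l1 l2 (T : seq label) : (0 < d)%N -> (d %| l1.2)%N -> (d %| l2.2)%N ->
  all valid_label (l1 :: l2 :: T) ->
  (forall k1 k2, all valid_label ((k1, l1.2 %/ d) :: (k2, l2.2 %/ d) :: flatten (nseq d T)) ->
    reducible ((k1, l1.2 %/ d) :: (k2, l2.2 %/ d) :: flatten (nseq d T))) ->
  reducible (l1 :: l2 :: T).
Proof.
move=> d0 dl1 dl2 /and3P[v1 v2 vT] H.
have [k1 [E1 v1']] := split_label v1 d0 dl1; have [k2 [E2 v2']] := split_label v2 d0 dl2.
rewrite E1 E2; apply: (reducible_RI (RI_cyclic _ _ _ _ _ d0)); apply: H.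
by rewrite /= v1' v2' all_flatten_nseq.
Qed.

Lemma reducible_le2 KK : all valid_label KK ->
  (count (fun l : label => l.2 != 1) KK <= 2)%N -> reducible KK.
Proof.
move=> vK; rewrite -size_filter => cK; apply: reducible_perm (perm_split KK) _.
have := vK; rewrite (perm_all _ (perm_split KK)).
have uT : units [seq l <- KK | l.2 == 1] by exact: filter_all.
move: cK uT; move: [seq l <- KK | l.2 != 1] [seq l <- KK | l.2 == 1] => M T.
case: M => [|[k1 a] [|[k2 b] [|? ?]]] // _ uT vMT.
- exists T; split; [exact: vMT|by rewrite units_count|exact: units_coprime|exact: RI_refl].
- exists ((k1, a) :: T); split; [exact: vMT| | |exact: RI_refl].
    by rewrite /= units_count // addn0; case: (_ != _).
  by rewrite /= units_all_coprime // units_coprime.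
- have g0 : (0 < gcdn a b)%N by rewrite gcdn_gt0; case/andP: vMT => /and3P[/= ->].
  apply: (@reducible_cyclic _ (k1, a) (k2, b) T g0 (dvdn_gcdl a b) (dvdn_gcdr a b) vMT) => k1' k2' v.
  have uf : units (flatten (nseq (gcdn a b) T)) by apply: all_flatten_nseq.
  eexists; split; [exact: v| | |exact: RI_refl].
  + by rewrite /= units_count //; do 2!case: (_ != _).
  + rewrite /= units_all_coprime // units_all_coprime // units_coprime // !andbT.
    apply/eqP/eqP; rewrite -(eqn_pmul2l g0) muln_gcdr ![(gcdn a b * _)%N]mulnC.
    by rewrite !divnK ?dvdn_gcdl ?dvdn_gcdr // mul1n.
Qed.

(** The cyclic subgroup of index 2 in the dihedral group: (2,2,n) is doubly covered by (1,1,n,n). *)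
Lemma reducible_22n KK x y z T : perm_eq KK (x :: y :: z :: T) -> all valid_label KK ->
  x.2 = 2 -> y.2 = 2 -> units T -> reducible KK.
Proof.
move=> KP vK x2 y2 uT; apply: (reducible_perm KP); rewrite (perm_all _ KP) in vK.
apply: (@reducible_cyclic 2) => //; rewrite ?x2 ?y2 // => k1 k2 v; apply: reducible_le2 => //.
by rewrite /= count_cat /= cats0 units_count // addn0; case: (_ != _).
Qed.

(** The Klein four-group in A_4: the covering of degree 3 branched over the two points of order 3
    has labels (2,2,2). *)
Lemma reducible_233 KK x y z T : perm_eq KK (x :: y :: z :: T) -> all valid_label KK ->
  x.2 = 2 -> y.2 = 3 -> z.2 = 3 -> units T -> reducible KK.
Proof.
move=> KP vK x2 y3 z3 uT.
have KP' : perm_eq KK (y :: z :: x :: T).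
  by apply: (perm_trans KP); apply/permP => P /=; lia.
apply: (reducible_perm KP'); rewrite (perm_all _ KP') in vK.
apply: (@reducible_cyclic 3) => //; rewrite ?y3 ?z3 // (_ : 3 %/ 3 = 1) // => k1 k2 v.
apply: (@reducible_22n _ x x x ((k1, 1) :: (k2, 1) :: T ++ T ++ T)) => //.
  by apply/permP => P; rewrite /=; do ?rewrite count_cat /=; lia.
by move: uT; rewrite /units /= !all_cat => ->.
Qed.

(** A_4 in S_4: the double covering branched over the points of orders 2 and 4 has labels
    (2,3,3). *)
Lemma reducible_234 KK x y z T : perm_eq KK (x :: y :: z :: T) -> all valid_label KK ->
  x.2 = 2 -> y.2 = 3 -> z.2 = 4 -> units T -> reducible KK.
Proof.
move=> KP vK x2 y3 z4 uT.
have KP' : perm_eq KK (x :: z :: y :: T).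
  by apply: (perm_trans KP); apply/permP => P /=; lia.
apply: (reducible_perm KP'); rewrite (perm_all _ KP') in vK.
apply: (@reducible_cyclic 2) => //; rewrite ?x2 ?z4 // (_ : 2 %/ 2 = 1) // (_ : 4 %/ 2 = 2) // => k1 k2 v.
apply: (@reducible_233 _ (k2, 2) y y ((k1, 1) :: T ++ T)) => //.
  by apply/permP => P; rewrite /=; do ?rewrite count_cat /=; lia.
by move: uT; rewrite /units /= !all_cat => ->.
Qed.

Lemma reducible_235 KK x y z T : perm_eq KK (x :: y :: z :: T) -> all valid_label KK ->
  x.2 = 2 -> y.2 = 3 -> z.2 = 5 -> units T -> reducible KK.
Proof.
move=> KP vK x2 y3 z5 uT.
have KP' : perm_eq KK (z :: x :: y :: T).
  by apply: (perm_trans KP); apply/permP => P /=; lia.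
apply: (reducible_perm KP'); rewrite (perm_all _ KP') in vK.
have /and4P[vz vx vy vT] := vK.
have [kz [zE vz']] := @split_label 5 z vz isT ltac:(by rewrite z5).
have [kx [xE vx']] := @split_label 2 x vx isT ltac:(by rewrite x2).
have [ky [yE vy']] := @split_label 3 y vy isT ltac:(by rewrite y3).
rewrite z5 divnn muln1 in zE vz'; rewrite x2 divnn muln1 in xE vx'; rewrite y3 divnn muln1 in yE vy'.
rewrite zE xE yE; apply: (reducible_RI (RI_five kz kx ky T)).
rewrite xE in vx; rewrite yE in vy.
set LL := _ :: _.
apply: (@reducible_233 _ (omul 2 kx, 2) (omul 3 ky, 3) (omul 3 ky, 3)
  ((kz, 1) :: (kx, 1) :: (ky, 1) :: (kx, 1) :: T ++ T ++ T ++ T ++ T)) => //.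
- apply/permP => P; rewrite /LL /=; do ?rewrite count_cat /=.
  move: (count P T) => n; do 5![move: (nat_of_bool _) => ?]; lia.
- rewrite /LL /=; do ?rewrite all_cat /=.
  have [v1 v2 v3 v4] : [/\ valid_label (kz, 1), valid_label (kx, 1), valid_label (ky, 1) &
    all valid_label T] by [].
  by rewrite v1 v2 v3 v4 vx vy.
- by move: uT; rewrite /units /= !all_cat => ->.
Qed.

(** The inequality is a non-positive Euler characteristic in integer form, with [n] in the role of
    the order of P(K') if that were finite. Finite generation then leaves only K = K'. *)
Lemma reducible_nonspherical KK x y z T : perm_eq KK (x :: y :: z :: T) -> all valid_label KK ->
  (1 < x.2)%N -> (1 < y.2)%N -> (1 < z.2)%N ->
  (forall n, (0 < n)%N -> (n %/ x.2 + (n %/ y.2 + (n %/ z.2 + \sum_(l <- T) n %/ l.2)) + 2 * n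
     <= n * (size T).+3)%N) ->
  finitely_generated (genJ (KT KK) (KT' KK)) -> reducible KK.
Proof.
move=> KP vK x1 y1 z1 chi fg; apply: (reducible_perm KP).
have {}fg := RI_fg (RI_perm KP) fg; rewrite (perm_all _ KP) in vK.
set LL := _ :: _ in fg vK *.
have [triv|] := pselect {in LL, forall l, l.1 = Some l.2}.
  exists [:: (Some 2, 2)]; split=> //.
  by apply: RI_trivial => // l; rewrite inE => /eqP->.
move=> ntriv; exfalso; move: fg.
have [i0 i0L ne] : exists2 i0, (i0 < size LL)%N &
    (nth (None, 0) LL i0).1 <> Some (nth (None, 0) LL i0).2.
  apply: contrapT => H; apply: ntriv => l lL; apply: contrapT => ne; apply: H.
  by exists (index l LL); rewrite ?index_mem // nth_index.
have vT0 : {in T, forall l : label, (0 < l.2)%N}.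
  by move=> l lT; have /and3P[] := allP vK l ltac:(by rewrite !inE lT !orbT).
have posL i : (i < size LL)%N -> (0 < pord LL i)%N.
  by move=> iL; have /and3P[] := allP vK _ (mem_nth (None, 0) iL).
apply: (genJ_not_fg i0L) => //.
- by move=> l /(allP vK)/and3P[_ -> ->].
- move=> i n iL; have [G [D [DL D1 Dord]]] := exact_orders x1 y1 z1 vT0.
  have [f fE] : exists f : ghom (PP LL) G, fmap f (PD LL) = D.
    by apply: PP_hom => // t tD; apply/(Dord t _ tD).
  have tD : (nth (None, 0) LL i, f (pgen LL i)) \in D.
    have := mem_nth (None, 0, 1%g) (s := PD LL) (n := i); rewrite size_PD nth_PD //.
    by move=> /(_ iL)/(mem_fmap f); rewrite fE.
  by move=> gn; apply/(Dord _ n tD); rewrite /= -gmulfXn gn gmulf1.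
- move=> n n0; apply: leq_trans (chi n n0); rewrite leq_add2r.
  rewrite -(big_mkord xpredT (fun i => n %/ pord LL i)) /pord.
  by rewrite -(big_nth (None, 0) xpredT (fun l : label => n %/ l.2)) !big_cons.
Qed.

Lemma sum_divn_le (T : seq label) n : (\sum_(l <- T) n %/ l.2 <= n * size T)%N.
Proof.
elim: T => [|l T IHT]; first by rewrite big_nil.
by rewrite big_cons /= mulnS leq_add // leq_div.
Qed.

Lemma spherical_triples a b c : (1 < a)%N -> (a <= b)%N -> (b <= c)%N ->
  (a * b * c < b * c + a * c + a * b)%N ->
  [\/ a = 2 /\ b = 2, [/\ a = 2, b = 3 & c = 3], [/\ a = 2, b = 3 & c = 4] |
      [/\ a = 2, b = 3 & c = 5]].
Proof.
move=> a1 ab bc H; have a2 : a = 2 by nia.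
subst a; have b4 : (b < 4)%N by nia.
have [b2|b3] : b = 2 \/ b = 3 by lia.
  by constructor 1.
subst b; have [|[|]] : c = 3 \/ (c = 4 \/ c = 5) by lia.
- by move=> ->; constructor 2.
- by move=> ->; constructor 3.
- by move=> ->; constructor 4.
Qed.

(** The second hypothesis is 1/a + 1/b + 1/c <= 1 with denominators cleared, and i, j, k stand for
    the quotients of n by a, b, c. *)
Lemma spherical_defect a b c n i j k : (0 < a * b * c)%N ->
  (b * c + a * c + a * b <= a * b * c)%N ->
  (i * a <= n)%N -> (j * b <= n)%N -> (k * c <= n)%N -> (i + j + k <= n)%N.
Proof.
move=> abc0 H ia jb kc; rewrite -(leq_pmul2l abc0).
apply: (@leq_trans (n * (b * c + a * c + a * b))); last by rewrite mulnC leq_mul2r H orbT.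
have : (i * a * (b * c) <= n * (b * c))%N by rewrite leq_mul2r ia orbT.
have : (j * b * (a * c) <= n * (a * c))%N by rewrite leq_mul2r jb orbT.
have : (k * c * (a * b) <= n * (a * b))%N by rewrite leq_mul2r kc orbT.
lia.
Qed.

Lemma reducible_fg KK : all valid_label KK ->
  finitely_generated (genJ (KT KK) (KT' KK)) -> reducible KK.
Proof.
move=> vK fg; have KP := perm_split KK.
have uT : units [seq l <- KK | l.2 == 1] by exact: filter_all.
set T := [seq l <- KK | l.2 == 1] in KP uT.
set M0 := [seq l <- KK | l.2 != 1] in KP.
pose le (l l' : label) := (l.2 <= l'.2)%N.
have sM : sorted le (sort le M0) by apply: sort_sorted => l l'; exact: leq_total.
have vM : all (fun l : label => 1 < l.2)%N (sort le M0).
  rewrite all_sort; apply/allP => l; rewrite mem_filter => /andP[l1 /(allP vK)/and3P[l0 _ _]].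
  by rewrite ltn_neqAle eq_sym l1.
have {}KP : perm_eq KK (sort le M0 ++ T).
  by apply: (perm_trans KP); rewrite perm_cat2r perm_sym perm_sort.
have [c2|] := leqP (count (fun l : label => l.2 != 1) KK) 2; first exact: reducible_le2.
rewrite -size_filter -/M0 -(size_sort le).
case: (sort le M0) KP sM vM => [|x [|y [|z M]]] //= KP /and3P[xy yz sM] /and4P[x1 y1 z1 M1] _.
have [sph|nsph] := boolP ((M == [::]) && (x.2 * y.2 * z.2 < y.2 * z.2 + x.2 * z.2 + x.2 * y.2)%N).
  case/andP: sph => /eqP M0E; subst M.
  case/(spherical_triples x1 xy yz) => -[].
  - by move=> x2 y2; apply: reducible_22n KP vK x2 y2 uT.
  - by move=> x2 y3 z3; apply: reducible_233 KP vK x2 y3 z3 uT.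
  - by move=> x2 y3 z4; apply: reducible_234 KP vK x2 y3 z4 uT.
  - by move=> x2 y3 z5; apply: reducible_235 KP vK x2 y3 z5 uT.
apply: (reducible_nonspherical KP) => // n n0.
case: M KP sM M1 nsph => [|u M] KP sM M1 nsph /=.
  rewrite andTb -leqNgt in nsph.
  have abc0 : (0 < x.2 * y.2 * z.2)%N by rewrite !muln_gt0 (ltnW x1) (ltnW y1) (ltnW z1).
  have := spherical_defect abc0 nsph (leq_divM n x.2) (leq_divM n y.2) (leq_divM n z.2).
  have := sum_divn_le T n; move: (\sum_(l <- T) _) => s; rewrite !mulnS.
  move: (n %/ x.2) (n %/ y.2) (n %/ z.2) (n * size T) => i j k q; lia.
(* With four entries above 1, four of the quotients are at most n/2 each, which already gives the
   two copies of n that are required. *)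
have := sum_divn_le (M ++ T) n.
have half (l : label) : (1 < l.2)%N -> (n %/ l.2 * 2 <= n)%N.
  by move=> l1; apply: leq_trans (leq_divM n l.2); rewrite leq_mul.
case/andP: M1 => u1 _.
have := half _ x1; have := half _ y1; have := half _ z1; have := half _ u1.
rewrite big_cons; move: (\sum_(l <- M ++ T) _) => s; rewrite /= !mulnS.
move: (n %/ x.2) (n %/ y.2) (n %/ z.2) (n %/ u.2) (n * size (M ++ T)) => i j k m q; lia.
Qed.

Theorem proposition1p10 (p : nat) (K : p.-tuple (option nat))
    (K' : p.-tuple nat) :
  genJ_params K K' ->
  finitely_generated (genJ K K') ->
  exists (q : nat) (L : q.-tuple (option nat)) (L' : q.-tuple nat),
    [/\ genJ_params L L', reduced_params L' &
        reflection_isomorphic K K' L L'].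
Proof.
have [KK [e [KE K'E]]] : exists KK : seq label, exists e : size KK = p,
    map fst KK = K /\ map snd KK = K'.
  have s : size K = size K' by rewrite !size_tuple.
  have e : size (zip K K') = p by rewrite size_zip !size_tuple minnn.
  exists (zip K K'), e.
  by split; [rewrite -/(unzip1 _) unzip1_zip ?s | rewrite -/(unzip2 _) unzip2_zip ?s].
subst p.
have -> : K = KT KK by apply: val_inj; exact: (esym KE).
have -> : K' = KT' KK by apply: val_inj; exact: (esym K'E).
move=> /and4P[_ /allP Kge /allP K0 /forallP Kd] fg.
apply/reducible_reduced_form/reducible_fg => //; apply/allP => l lK; apply/and3P; split.
- by apply: K0; apply: map_f.
- have iK : (index l KK < size KK)%N by rewrite index_mem.
  by have := Kd (Ordinal iK); rewrite !tnth_map (tnth_nth (None, 0)) /= nth_index.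
- have : l.1 \in KT KK by apply: map_f.
  by move=> /Kge; case: l.1 => //= m /ltnW.
Qed.
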